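(* Fix a constant $k \geqslant 1$. There is a randomized Las Vegas algorithm (in the word RAM model with $O(\log n)$-bit words) with the following properties. Given two sets $A$, $B$, each consisting of $n$ integers from $[n^{k}]$, it preprocesses them in time $O(n^2)$. After the preprocessing, it is given any subsets $A' \subseteq A$ and $B' \subseteq B$ together with any set $C'$ of $n$ integers from $[n^{k}]$, and it determines, for every $c \in C'$, whether there exist $a \in A'$ and $b \in B'$ with $a+b=c$. Each such query is answered in expected time $O(n^{1.5}\log n)$.
   Context: $[N] := \{0,1,\ldots,N-1\}$. The word RAM model with $O(\log n)$-bit words: arithmetic and comparison on words take constant time. A Las Vegas algorithm always outputs the correct answer; only its running time is random. *)

(* Defs.v *)
From Stdlib Require Import Arith List Reals.
Import ListNotations.

(* Word RAM.  Memory: cells indexed by nat, each holding a w-bit word. *)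
Inductive instr : Type :=
| IConst (i v : nat)
| IAdd (i j l : nat)
| ISub (i j l : nat)
| IMul (i j l : nat)
| IDiv (i j l : nat)          (* m[i] := m[j] / m[l]  (x/0 = 0)         *)
| IMod (i j l : nat)          (* m[i] := m[j] mod m[l] (x mod 0 = x)    *)
| IAnd (i j l : nat)
| IOr  (i j l : nat)
| IXor (i j l : nat)
| IShl (i j l : nat)
| IShr (i j l : nat)
| ILt  (i j l : nat)
| ILoad (i j : nat)
| IStore (i j : nat)
| IJz (i p : nat)
| IJmp (p : nat)
| IRand (i : nat)
| IIn (i j : nat)
| IOut (i : nat)
| IHalt.

Definition program := list instr.

Record cfg : Type := Cfg {
  pc : nat;
  mem : nat -> nat;
  out : list nat;
  rnd : list bool
}.

Inductive outcome : Type :=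
| Halted (c : cfg)
| Next (c : cfg)
| Stuck.

Definition upd (m : nat -> nat) (a v : nat) : nat -> nat :=
  fun x => if Nat.eqb x a then v else m x.

Definition step (w : nat) (P : program) (inp : list nat) (c : cfg) : outcome :=
  let W := 2 ^ w in
  let m := mem c in
  let nx (m' : nat -> nat) := Next (Cfg (S (pc c)) m' (out c) (rnd c)) in
  let ar (i v : nat) := nx (upd m i (v mod W)) in
  match nth_error P (pc c) with
  | None => Halted c
  | Some IHalt => Halted c
  | Some (IConst i v) => ar i v
  | Some (IAdd i j l) => ar i (m j + m l)
  | Some (ISub i j l) => ar i (m j + (W - m l mod W))
  | Some (IMul i j l) => ar i (m j * m l)
  | Some (IDiv i j l) => ar i (m j / m l)
  | Some (IMod i j l) => ar i (m j mod m l)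
  | Some (IAnd i j l) => ar i (Nat.land (m j) (m l))
  | Some (IOr i j l) => ar i (Nat.lor (m j) (m l))
  | Some (IXor i j l) => ar i (Nat.lxor (m j) (m l))
  | Some (IShl i j l) => ar i (Nat.shiftl (m j) (m l))
  | Some (IShr i j l) => ar i (Nat.shiftr (m j) (m l))
  | Some (ILt i j l) => ar i (if Nat.ltb (m j) (m l) then 1 else 0)
  | Some (ILoad i j) => ar i (m (m j))
  | Some (IStore i j) => nx (upd m (m i) (m j))
  | Some (IJz i p) =>
      Next (Cfg (if Nat.eqb (m i) 0 then p else S (pc c)) m (out c) (rnd c))
  | Some (IJmp p) => Next (Cfg p m (out c) (rnd c))
  | Some (IRand i) =>
      match rnd c with
      | [] => Stuck
      | b :: r => Next (Cfg (S (pc c)) (upd m i (if b then 1 else 0)) (out c) r)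
      end
  | Some (IIn i j) => ar i (nth (m j) inp 0)
  | Some (IOut i) => Next (Cfg (S (pc c)) m (out c ++ [m i]) (rnd c))
  end.

(* [exec w P inp t c = Some c'] iff the machine started in [c] halts within
   [t] steps (the halting step included) in final configuration [c']. *)
Fixpoint exec (w : nat) (P : program) (inp : list nat) (t : nat) (c : cfg)
  : option cfg :=
  match t with
  | 0 => None
  | S t' =>
      match step w P inp c with
      | Halted c' => Some c'
      | Next c' => exec w P inp t' c'
      | Stuck => None
      end
  end.

Definition zero_mem : nat -> nat := fun _ => 0.

Definition word_size (c n : nat) : nat := c * (Nat.log2 n + 1).

Record ds_algorithm : Type := DS {
  ds_wconst : nat;
  ds_prep : program;
  ds_query : program
}.

Definition prep_input (n : nat) (A B : list nat) : list nat := n :: A ++ B.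
Definition query_input (n : nat) (A' B' C' : list nat) : list nat :=
  n :: length A' :: length B' :: A' ++ B' ++ C'.

Definition run_prep (D : ds_algorithm) (n tp : nat) (A B : list nat)
  (r : list bool) : option cfg :=
  exec (word_size (ds_wconst D) n) (ds_prep D) (prep_input n A B) tp
       (Cfg 0 zero_mem [] r).

Definition run_query (D : ds_algorithm) (n tq : nat) (A' B' C' : list nat)
  (c1 : cfg) : option cfg :=
  exec (word_size (ds_wconst D) n) (ds_query D) (query_input n A' B' C') tq
       (Cfg 0 (mem c1) [] (rnd c1)).

Definition answer (A' B' C' : list nat) : list nat :=
  map (fun c => if existsb (fun a => existsb (fun b => Nat.eqb (a + b) c) B') A'
                then 1 else 0) C'.

Fixpoint allbits (l : nat) : list (list bool) :=
  match l with
  | 0 => [[]]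
  | S l' => map (cons false) (allbits l') ++ map (cons true) (allbits l')
  end.

Definition prob (l : nat) (p : list bool -> bool) : R :=
  (INR (length (filter p (allbits l))) / (2 ^ l))%R.

Definition query_slow (D : ds_algorithm) (n tp t : nat) (A B A' B' C' : list nat)
  (r : list bool) : bool :=
  match run_prep D n tp A B r with
  | None => true
  | Some c1 => match run_query D n t A' B' C' c1 with
               | None => true
               | Some _ => false
               end
  end.

(* Partial sums of E[T_query] = sum_{t >= 0} Pr[T_query > t].
   Each step consumes at most one random bit, so strings of length tp + t
   determine the first tp + t steps. *)
Fixpoint exp_partial (D : ds_algorithm) (n tp : nat) (A B A' B' C' : list nat)
  (N : nat) : R :=
  match N with
  | 0 => 0%R
  | S N' => (exp_partial D n tp A B A' B' C' N'
             + prob (tp + N') (query_slow D n tp N' A B A' B' C'))%R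
  end.

Definition int_set (n k : nat) (A : list nat) : Prop :=
  NoDup A /\ length A = n /\ (forall a, In a A -> a < n ^ k).

Definition sub_set (A' A : list nat) : Prop :=
  NoDup A' /\ (forall a, In a A' -> In a A).

(* Main.v *)
(* Let h(x) = floor ((s x mod 2^w) / 2^(w-l)) with a random multiplier s; it takes M = 2^l values,
   M of order n^1.5 / log n, and h(a + b) - h(a) - h(b) is 0 or 1 modulo M. The preprocessing stores
   all pairs (a, b) of A x B sorted by the bucket (h(a) + h(b)) mod M and then by a + b. A query
   convolves the hash counts of A' and B', which gives the number of pairs of A' x B' in every bucket.
   For each c it adds the counts of the two buckets that can contain a pair of sum c and subtracts the
   number of pairs of A' x B' found there with another sum (the false positives), walking through the
   stored pairs and jumping over the contiguous run of sum c: a solution exists iff the difference is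
   positive. A pair is a false positive for c with probability O(1/M), so the walks take expected time
   O(n * n^2 / M) = O(n^1.5 log n); the convolution takes O(M log^2 M) = O(n^1.5 log n). The convolution
   is Nussbaumer's, which works over the integers modulo 2^w and needs no numerical roots of unity. *)
Require Import Defs.
From Stdlib Require Import Arith List Reals Lia Lra Bool ZArith Permutation.
From Stdlib Require Znumtheory Zpow_facts.
From Stdlib Require Import Morphisms Setoid.
Import ListNotations.

(** * A structured language compiled to the word RAM *)

(** The theorem counts the steps of raw instruction lists. The programs are therefore written in a
    structured language whose clock counts the steps of the compiled code, so that time, termination
    and correctness are proved together. All randomness is the [w]-bit multiplier, drawn in the
    preprocessing: for a fixed multiplier a query is deterministic, and its expected time is an
    average over multipliers. The multiplier need not be odd; the count of bad multipliers instead
    strips the factors of two from [a + b - c], which works since that number is shorter than a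
    bucket, [2^(w-l)]. The convolution is verified without polynomial rings: a vector is replaced by
    its value at one integer [z] modulo [z^D + 1], where shifts become multiplications; as this
    holds for every [z], a large [z] gives back the coefficients. Since 2 is not invertible modulo
    [2^w], the inverse butterflies do not halve. The product appears times a known power of two, and
    words are long enough to hold that multiple, so one ordinary division at the end is exact. *)

Inductive bop : Type :=
  OAdd | OAddW | OSub | OSubW | OMul | OMulW | ODiv | OMod | OShl | OLt | OEq.

Inductive expr : Type :=
| EVar (x : nat)
| ECst (v : nat)
| EBin (o : bop) (e1 e2 : expr)
| EArr (a : nat) (e : expr)
| EIn (e : expr).

Inductive cmd : Type :=
| CSkip
| CAsg (x : nat) (e : expr)
| CSto (a : nat) (e1 e2 : expr)
| CRnd (x : nat)
| COut (e : expr)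
| CSeq (c1 c2 : cmd)
| CIf (e : expr) (c1 c2 : cmd)
| CWhile (e : expr) (c : cmd).

Record state : Type := St {
  va : nat -> nat;
  ar : nat -> nat -> nat;
  ou : list nat;
  rn : list bool;
  ck : nat
}.

(** The same function as [upd] under a name that the tactic [ev] does not unfold: updates of
    scalars, whose indices are literals, compute away, while writes to array cells with symbolic
    indices stay folded. *)
Definition wr (f : nat -> nat) (i v : nat) : nat -> nat := upd f i v.

Definition aset (A : nat -> nat -> nat) (a i v : nat) : nat -> nat -> nat :=
  fun b => if Nat.eqb b a then wr (A b) i v else A b.

Definition tick (k : nat) (s : state) : state :=
  St (va s) (ar s) (ou s) (rn s) (ck s + k).

Section Semantics.
Variables (w : nat) (inp : list nat).

Definition bopv (o : bop) (x y : nat) : nat :=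
  match o with
  | OAdd => x + y
  | OAddW => (x + y) mod 2 ^ w
  | OSub => x - y
  | OSubW => (x + (2 ^ w - y)) mod 2 ^ w
  | OMul => x * y
  | OMulW => (x * y) mod 2 ^ w
  | ODiv => x / y
  | OMod => x mod y
  | OShl => x * 2 ^ y
  | OLt => if x <? y then 1 else 0
  | OEq => if x =? y then 1 else 0
  end.

(** An exact operator and its [W] twin compile to the same instruction. The exact one denotes the
    result in the natural numbers and pays with a no-overflow condition; the other denotes the
    residue modulo [2 ^ w] and is always allowed, as hashing and the transform need. *)
Definition bop_ok (o : bop) (x y : nat) : Prop :=
  match o with
  | OAdd => x + y < 2 ^ w
  | OSub => y <= x
  | OMul => x * y < 2 ^ w
  | OShl => x * 2 ^ y < 2 ^ w
  | _ => True
  end.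

Fixpoint eval (e : expr) (s : state) : nat :=
  match e with
  | EVar x => va s x
  | ECst v => v
  | EBin o e1 e2 => bopv o (eval e1 s) (eval e2 s)
  | EArr a e => ar s a (eval e s)
  | EIn e => nth (eval e s) inp 0
  end.

(** Entry [i] of any array sits at an address below [80 + 16 * i], so the bound in the [EArr] case
    keeps the address arithmetic from wrapping around. *)
Fixpoint safe (e : expr) (s : state) : Prop :=
  match e with
  | EVar x => True
  | ECst v => v < 2 ^ w
  | EBin o e1 e2 => safe e1 s /\ safe e2 s /\ bop_ok o (eval e1 s) (eval e2 s)
  | EArr a e => safe e s /\ 80 + 16 * eval e s < 2 ^ w
  | EIn e => safe e s /\ nth (eval e s) inp 0 < 2 ^ w
  end.

(* Scalars live in cells 0-47, expression temporaries in cells 48-63, and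
   entry [i] of array [a < 16] in cell [64 + 16 i + a]: interleaving keeps
   unboundedly long arrays disjoint. *)
Definition acode (a d : nat) : program :=
  [IConst (S d) 16; IMul d d (S d); IConst (S d) (64 + a); IAdd d d (S d)].

(** Equality has no instruction of its own: the difference of two words modulo [2 ^ w] is less than
    1 exactly when they agree. *)
Definition bcode (o : bop) (d : nat) : program :=
  match o with
  | OAdd | OAddW => [IAdd d d (S d)]
  | OSub | OSubW => [ISub d d (S d)]
  | OMul | OMulW => [IMul d d (S d)]
  | ODiv => [IDiv d d (S d)]
  | OMod => [IMod d d (S d)]
  | OShl => [IShl d d (S d)]
  | OLt => [ILt d d (S d)]
  | OEq => [ISub d d (S d); IConst (S d) 1; ILt d d (S d)]
  end.

Fixpoint ecode (e : expr) (d : nat) : program :=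
  match e with
  | EVar x => [IOr d x x]
  | ECst v => [IConst d v]
  | EBin o e1 e2 => ecode e1 d ++ ecode e2 (S d) ++ bcode o d
  | EArr a e => ecode e d ++ acode a d ++ [ILoad d d]
  | EIn e => ecode e d ++ [IIn d d]
  end.

Definition bcost (o : bop) : nat := match o with OEq => 3 | _ => 1 end.

Fixpoint ecost (e : expr) : nat :=
  match e with
  | EVar _ | ECst _ => 1
  | EBin o e1 e2 => ecost e1 + ecost e2 + bcost o
  | EArr _ e => ecost e + 5
  | EIn e => ecost e + 1
  end.

Fixpoint csize (c : cmd) : nat :=
  match c with
  | CSkip => 0
  | CAsg _ e | COut e => ecost e + 1
  | CSto _ e1 e2 => ecost e1 + ecost e2 + 5
  | CRnd _ => 1
  | CSeq c1 c2 => csize c1 + csize c2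
  | CIf e c1 c2 => ecost e + csize c1 + csize c2 + 2
  | CWhile e c => ecost e + csize c + 2
  end.

Fixpoint ccode (c : cmd) (p : nat) : program :=
  match c with
  | CSkip => []
  | CAsg x e => ecode e 48 ++ [IOr x 48 48]
  | COut e => ecode e 48 ++ [IOut 48]
  | CSto a e1 e2 => ecode e1 48 ++ acode a 48 ++ ecode e2 49 ++ [IStore 48 49]
  | CRnd x => [IRand x]
  | CSeq c1 c2 => ccode c1 p ++ ccode c2 (p + csize c1)
  | CIf e c1 c2 =>
      ecode e 48 ++ [IJz 48 (p + ecost e + csize c1 + 2)]
      ++ ccode c1 (p + ecost e + 1)
      ++ [IJmp (p + ecost e + csize c1 + csize c2 + 2)]
      ++ ccode c2 (p + ecost e + csize c1 + 2)
  | CWhile e c =>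
      ecode e 48 ++ [IJz 48 (p + ecost e + csize c + 2)]
      ++ ccode c (p + ecost e + 1) ++ [IJmp p]
  end.

(** Code that works in cell [d] also uses [S d], for a second operand or for address arithmetic; the
    bound 63 keeps both below the arrays. *)
Fixpoint wfe (e : expr) (d : nat) : bool :=
  match e with
  | EVar x => (x <? 48) && (d <? 63)
  | ECst _ => d <? 63
  | EBin _ e1 e2 => wfe e1 d && wfe e2 (S d)
  | EArr a e => (a <? 16) && wfe e d
  | EIn e => wfe e d
  end.

Fixpoint wfc (c : cmd) : bool :=
  match c with
  | CSkip => true
  | CAsg x e => (x <? 48) && wfe e 48
  | COut e => wfe e 48
  | CSto a e1 e2 => (a <? 16) && wfe e1 48 && wfe e2 49
  | CRnd x => x <? 48
  | CSeq c1 c2 => wfc c1 && wfc c2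
  | CIf e c1 c2 => wfe e 48 && wfc c1 && wfc c2
  | CWhile e c => wfe e 48 && wfc c
  end.

(* The clock [ck] counts machine steps of the compiled code exactly. *)
Inductive bs : cmd -> state -> state -> Prop :=
| BSkip s : bs CSkip s s
| BAsg x e s : safe e s ->
    bs (CAsg x e) s
       (St (upd (va s) x (eval e s)) (ar s) (ou s) (rn s) (ck s + (ecost e + 1)))
| BSto a e1 e2 s : safe e1 s -> safe e2 s -> 80 + 16 * eval e1 s < 2 ^ w ->
    bs (CSto a e1 e2) s
       (St (va s) (aset (ar s) a (eval e1 s) (eval e2 s)) (ou s) (rn s)
           (ck s + (ecost e1 + ecost e2 + 5)))
| BRnd x s b r : rn s = b :: r ->
    bs (CRnd x) s
       (St (upd (va s) x (if b then 1 else 0)) (ar s) (ou s) r (ck s + 1))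
| BOut e s : safe e s ->
    bs (COut e) s
       (St (va s) (ar s) (ou s ++ [eval e s]) (rn s) (ck s + (ecost e + 1)))
| BSeq c1 c2 s s1 s2 : bs c1 s s1 -> bs c2 s1 s2 -> bs (CSeq c1 c2) s s2
| BIfT e c1 c2 s s' : safe e s -> eval e s <> 0 ->
    bs c1 (tick (ecost e + 1) s) s' -> bs (CIf e c1 c2) s (tick 1 s')
| BIfF e c1 c2 s s' : safe e s -> eval e s = 0 ->
    bs c2 (tick (ecost e + 1) s) s' -> bs (CIf e c1 c2) s s'
| BWhF e c s : safe e s -> eval e s = 0 ->
    bs (CWhile e c) s (tick (ecost e + 1) s)
| BWhT e c s s1 s2 : safe e s -> eval e s <> 0 ->
    bs c (tick (ecost e + 1) s) s1 -> bs (CWhile e c) (tick 1 s1) s2 ->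
    bs (CWhile e c) s s2.

(** The temporaries 48-63 are only required to be words, so evaluating an expression preserves the
    relation. *)
Definition rel (s : state) (m : nat -> nat) : Prop :=
  (forall x, x < 48 -> m x = va s x) /\
  (forall a i, a < 16 -> m (64 + 16 * i + a) = ar s a i) /\
  (forall x, m x < 2 ^ w).

(** * Correctness of the compiler *)

Lemma ecode_length e d : length (ecode e d) = ecost e.
Proof.
  revert d; induction e as [x|v|o e1 IH1 e2 IH2|a e IH|e IH]; intros d; simpl;
    rewrite ?length_app, ?IH1, ?IH2, ?IH; simpl; auto.
  destruct o; simpl; lia.
Qed.

Lemma ccode_length c p : length (ccode c p) = csize c.
Proof.
  revert p; induction c; intros p; simpl;
    repeat (rewrite ?length_app, ?ecode_length; simpl);
    rewrite ?IHc, ?IHc1, ?IHc2; lia.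
Qed.

Variable P : program.

Definition code_at (p : nat) (l : program) : Prop :=
  forall i, i < length l -> nth_error P (p + i) = nth_error l i.

Lemma code_at_app p l1 l2 :
  code_at p (l1 ++ l2) -> code_at p l1 /\ code_at (p + length l1) l2.
Proof.
  intros H; split; intros i Hi.
  - rewrite H by (rewrite length_app; lia). now apply nth_error_app1.
  - rewrite <- Nat.add_assoc, H by (rewrite length_app; lia).
    rewrite nth_error_app2 by lia. f_equal; lia.
Qed.

Lemma code_at_cons p i l :
  code_at p (i :: l) -> nth_error P p = Some i /\ code_at (S p) l.
Proof.
  intros H; split.
  - replace p with (p + 0) by lia. apply (H 0); simpl; lia.
  - intros j Hj. replace (S p + j) with (p + S j) by lia.
    rewrite H by (simpl; lia). reflexivity.
Qed.

Fixpoint nsteps (k : nat) (c c' : cfg) : Prop :=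
  match k with
  | 0 => c = c'
  | S k => exists c1, step w P inp c = Next c1 /\ nsteps k c1 c'
  end.

Lemma nsteps_trans k1 k2 c1 c2 c3 :
  nsteps k1 c1 c2 -> nsteps k2 c2 c3 -> nsteps (k1 + k2) c1 c3.
Proof.
  revert c1; induction k1; simpl; intros c1 H1 H2.
  - now subst.
  - destruct H1 as (c & Hs & H1). eauto.
Qed.

Lemma nsteps_exec k c c' t : nsteps k c c' -> exec w P inp (k + t) c = exec w P inp t c'.
Proof.
  revert c; induction k; simpl; intros c H.
  - now subst.
  - destruct H as (c1 & -> & H). auto.
Qed.

Lemma pow_w_pos : 0 < 2 ^ w.
Proof. apply Nat.neq_0_lt_0, Nat.pow_nonzero; lia. Qed.

Lemma upd_eq m a v : upd m a v a = v.
Proof. unfold upd; now rewrite Nat.eqb_refl. Qed.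

Lemma upd_neq m a v x : x <> a -> upd m a v x = m x.
Proof. unfold upd; intros H. now destruct (Nat.eqb_spec x a). Qed.

Lemma upd_lt m a v : (forall x, m x < 2 ^ w) -> v < 2 ^ w ->
  forall x, upd m a v x < 2 ^ w.
Proof. intros Hm Hv x; unfold upd; destruct (Nat.eqb x a); auto. Qed.

Lemma mod_w_lt x : x mod 2 ^ w < 2 ^ w.
Proof. apply Nat.mod_upper_bound; pose proof pow_w_pos; lia. Qed.

Lemma bopv_lt o x y : x < 2 ^ w -> y < 2 ^ w -> 1 < 2 ^ w -> bop_ok o x y -> bopv o x y < 2 ^ w.
Proof.
  intros Hx Hy H1; destruct o; simpl; intros Ho; auto using mod_w_lt; try lia.
  - destruct y; [simpl; lia|]. eapply Nat.le_lt_trans; [apply Nat.Div0.div_le_upper_bound|exact Hx]; nia.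
  - destruct y; [simpl; lia|].
    pose proof (Nat.mod_upper_bound x (S y)); lia.
  - destruct (x <? y); lia.
  - destruct (x =? y); lia.
Qed.

(** At depth [d] only the cells from [d] to 63 may change: a left operand stored in [d] survives the
    evaluation of the right one in [S d]. *)
Definition tmp_ok (d : nat) (m m' : nat -> nat) : Prop :=
  (forall x, x < d -> m' x = m x) /\ (forall x, 64 <= x -> m' x = m x) /\
  (forall x, m' x < 2 ^ w).

Lemma tmp_ok_trans d d' m1 m2 m3 :
  d <= d' -> tmp_ok d m1 m2 -> tmp_ok d' m2 m3 -> tmp_ok d m1 m3.
Proof.
  intros Hd (A1 & A2 & A3) (B1 & B2 & B3); repeat split; intros; auto.
  - rewrite B1, A1; auto; lia.
  - rewrite B2, A2; auto; lia.
Qed.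

Lemma tmp_ok_upd d a v m : d <= a < 64 -> v < 2 ^ w -> (forall x, m x < 2 ^ w) ->
  tmp_ok d m (upd m a v).
Proof.
  intros Ha Hv Hm; repeat split; intros; try (apply upd_neq; lia).
  now apply upd_lt.
Qed.

Lemma rel_tmp s m m' d : 48 <= d -> rel s m -> tmp_ok d m m' -> rel s m'.
Proof.
  intros Hd (A & B & C) (D & E & F); repeat split; intros; auto.
  - rewrite D; auto; lia.
  - rewrite E; auto; lia.
Qed.

Lemma rel_tick s m k : rel s m -> rel (tick k s) m.
Proof. auto. Qed.

Lemma step_one p m o r i m' :
  nth_error P p = Some i ->
  step w P inp (Cfg p m o r) = Next (Cfg (S p) m' o r) ->
  nsteps 1 (Cfg p m o r) (Cfg (p + 1) m' o r).
Proof.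
  intros _ H. exists (Cfg (S p) m' o r). rewrite Nat.add_1_r. split; [exact H|reflexivity].
Qed.

Lemma wfe_depth e d : wfe e d = true -> d < 63.
Proof.
  revert d; induction e; simpl; intros d H; rewrite ?andb_true_iff, ?Nat.ltb_lt in H;
    try tauto; auto.
  - apply IHe1; tauto.
  - apply IHe; tauto.
Qed.

Lemma div_self_small x y : x < 2 ^ w -> x / y < 2 ^ w.
Proof.
  intros Hx. destruct y; [simpl; pose proof pow_w_pos; lia|].
  eapply Nat.le_lt_trans; [apply Nat.Div0.div_le_upper_bound|exact Hx]; nia.
Qed.

Lemma acode_correct a d p m o r : 80 < 2 ^ w -> a < 16 -> d < 63 ->
  (forall x, m x < 2 ^ w) -> 80 + 16 * m d < 2 ^ w ->
  code_at p (acode a d) ->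
  exists m', nsteps 4 (Cfg p m o r) (Cfg (p + 4) m' o r) /\
    m' d = 64 + 16 * m d + a /\ tmp_ok d m m'.
Proof.
  intros HW Ha Hd Hm Hs Hc. unfold acode in Hc.
  apply code_at_cons in Hc as [C1 Hc]. apply code_at_cons in Hc as [C2 Hc].
  apply code_at_cons in Hc as [C3 Hc]. apply code_at_cons in Hc as [C4 _].
  set (m1 := upd m (S d) 16). set (m2 := upd m1 d (16 * m d)).
  set (m3 := upd m2 (S d) (64 + a)). set (m4 := upd m3 d (64 + 16 * m d + a)).
  exists m4. split; [|split].
  - exists (Cfg (S p) m1 o r). split.
    { unfold step; cbn [pc mem out rnd]. rewrite C1. rewrite Nat.mod_small by lia. reflexivity. }
    exists (Cfg (S (S p)) m2 o r). split.
    { unfold step; cbn [pc mem out rnd]. rewrite C2.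
      replace (m1 d) with (m d) by (symmetry; apply upd_neq; lia).
      replace (m1 (S d)) with 16 by (symmetry; apply upd_eq).
      rewrite Nat.mod_small by lia. now rewrite Nat.mul_comm. }
    exists (Cfg (S (S (S p))) m3 o r). split.
    { unfold step; cbn [pc mem out rnd]. rewrite C3. rewrite Nat.mod_small by lia. reflexivity. }
    exists (Cfg (S (S (S (S p)))) m4 o r). split.
    { unfold step; cbn [pc mem out rnd]. rewrite C4.
      replace (m3 d) with (16 * m d) by (unfold m3; rewrite upd_neq by lia; symmetry; apply upd_eq).
      replace (m3 (S d)) with (64 + a) by (symmetry; apply upd_eq).
      rewrite Nat.mod_small by lia. unfold m4. do 3 f_equal. lia. }
    simpl. f_equal. lia.
  - apply upd_eq.
  - repeat (match goal with |- tmp_ok _ _ (upd ?x _ _) => idtac | |- tmp_ok _ _ ?x => unfold x end).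
    unfold m3, m2, m1.
    repeat split; intros; repeat (rewrite upd_neq by lia); auto.
    repeat (apply upd_lt; try lia); auto.
Qed.

Lemma bcode_correct b d p m o r : 80 < 2 ^ w -> d < 63 ->
  (forall x, m x < 2 ^ w) -> bop_ok b (m d) (m (S d)) ->
  code_at p (bcode b d) ->
  exists m', nsteps (bcost b) (Cfg p m o r) (Cfg (p + bcost b) m' o r) /\
    m' d = bopv b (m d) (m (S d)) /\ tmp_ok d m m'.
Proof.
  intros HW Hd Hm Hok Hc.
  pose proof (bopv_lt b (m d) (m (S d)) (Hm _) (Hm _) ltac:(lia) Hok) as Hlt.
  assert (Hmod : forall x, m x mod 2 ^ w = m x) by (intros; apply Nat.mod_small; auto).
  destruct b; simpl in Hc, Hok, Hlt |- *;
    try (apply code_at_cons in Hc as [C1 _];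
      eexists (upd m d _); split; [eapply step_one; [exact C1|];
        unfold step; cbn [pc mem out rnd]; rewrite C1; reflexivity|];
      split; [rewrite upd_eq|apply tmp_ok_upd; auto using mod_w_lt; lia]).
  - now apply Nat.mod_small.
  - reflexivity.
  - rewrite Hmod. replace (m d + (2 ^ w - m (S d))) with (m d - m (S d) + 1 * 2 ^ w)
      by (specialize (Hm (S d)); lia).
    rewrite Nat.Div0.mod_add. apply Nat.mod_small. specialize (Hm d); lia.
  - now rewrite Hmod.
  - now apply Nat.mod_small.
  - reflexivity.
  - apply Nat.mod_small. now apply div_self_small.
  - now apply Nat.mod_small.
  - rewrite Nat.shiftl_mul_pow2. now apply Nat.mod_small.
  - destruct (m d <? m (S d)); apply Nat.mod_small; lia.
  - apply code_at_cons in Hc as [C1 Hc]. apply code_at_cons in Hc as [C2 Hc].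
    apply code_at_cons in Hc as [C3 _].
    set (v := (m d + (2 ^ w - m (S d) mod 2 ^ w)) mod 2 ^ w).
    set (m1 := upd m d v). set (m2 := upd m1 (S d) 1).
    set (m3 := upd m2 d (if m d =? m (S d) then 1 else 0)).
    exists m3. split; [|split].
    + exists (Cfg (S p) m1 o r). split.
      { unfold step; cbn [pc mem out rnd]. rewrite C1. reflexivity. }
      exists (Cfg (S (S p)) m2 o r). split.
      { unfold step; cbn [pc mem out rnd]. rewrite C2. rewrite Nat.mod_small by lia. reflexivity. }
      exists (Cfg (S (S (S p))) m3 o r). split.
      { unfold step; cbn [pc mem out rnd]. rewrite C3.
        replace (m2 d) with v by (unfold m2; rewrite upd_neq by lia; symmetry; apply upd_eq).
        replace (m2 (S d)) with 1 by (symmetry; apply upd_eq).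
        unfold m3. do 3 f_equal.
        assert (Hv : (v <? 1) = (m d =? m (S d))).
        { unfold v. rewrite Hmod. pose proof (Hm d); pose proof (Hm (S d)).
          destruct (Nat.eqb_spec (m d) (m (S d))) as [e|ne].
          - replace (m d + (2 ^ w - m (S d))) with (1 * 2 ^ w) by lia.
            rewrite Nat.Div0.mod_mul. reflexivity.
          - apply Nat.ltb_ge.
            destruct (Nat.lt_ge_cases (m d) (m (S d))).
            + rewrite Nat.mod_small; lia.
            + replace (m d + (2 ^ w - m (S d))) with (m d - m (S d) + 1 * 2 ^ w) by lia.
              rewrite Nat.Div0.mod_add, Nat.mod_small; lia. }
        rewrite Hv. destruct (m d =? m (S d)); apply Nat.mod_small; lia. }
      simpl. f_equal. lia.
    + apply upd_eq.
    + unfold m3, m2, m1. repeat split; intros; repeat (rewrite upd_neq by lia); auto.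
      apply upd_lt; [apply upd_lt; [apply upd_lt; auto; apply mod_w_lt|lia]|].
      destruct (m d =? m (S d)); lia.
Qed.

Lemma ecode_correct e : forall d p m o r s,
  80 < 2 ^ w -> 48 <= d -> wfe e d = true -> rel s m -> safe e s ->
  code_at p (ecode e d) ->
  exists m', nsteps (ecost e) (Cfg p m o r) (Cfg (p + ecost e) m' o r) /\
    m' d = eval e s /\ tmp_ok d m m'.
Proof.
  induction e as [x|v|b e1 IH1 e2 IH2|a e IH|e IH];
    intros d p m o r s HW Hd Hwf Hrel Hsafe Hc;
    pose proof (wfe_depth _ _ Hwf) as Hd'; cbn [wfe safe ecode ecost eval] in Hwf, Hsafe, Hc |- *.
  - apply andb_true_iff in Hwf as [Hx _]; apply Nat.ltb_lt in Hx.
    apply code_at_cons in Hc as [C1 _].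
    destruct Hrel as (R1 & R2 & R3).
    exists (upd m d (m x)); split; [eapply step_one; [exact C1|]|split].
    + unfold step; cbn [pc mem out rnd]. rewrite C1, Nat.lor_diag, Nat.mod_small; auto.
    + rewrite upd_eq; auto.
    + apply tmp_ok_upd; auto; lia.
  - apply code_at_cons in Hc as [C1 _]. destruct Hrel as (R1 & R2 & R3).
    exists (upd m d v); split; [eapply step_one; [exact C1|]|split].
    + unfold step; cbn [pc mem out rnd]. rewrite C1, Nat.mod_small; auto.
    + apply upd_eq.
    + apply tmp_ok_upd; auto; lia.
  - apply andb_true_iff in Hwf as [Hw1 Hw2]. destruct Hsafe as (S1 & S2 & S3).
    apply code_at_app in Hc as [C1 Hc]. apply code_at_app in Hc as [C2 C3].
    rewrite ecode_length in *. rewrite ?ecode_length in C3.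
    destruct (IH1 d p m o r s HW Hd Hw1 Hrel S1 C1) as (m1 & N1 & E1 & T1).
    assert (Hrel1 : rel s m1) by (eapply (rel_tmp _ _ _ d); eauto).
    destruct (IH2 (S d) _ m1 o r s HW (le_S _ _ Hd) Hw2 Hrel1 S2 C2) as (m2 & N2 & E2 & T2).
    assert (E1' : m2 d = eval e1 s) by (destruct T2 as (T2 & _); rewrite T2; auto).
    destruct (bcode_correct b d _ m2 o r HW Hd' ltac:(apply T2)
       ltac:(rewrite E1', E2; exact S3) C3) as (m3 & N3 & E3 & T3).
    exists m3; split; [|split].
    + eapply nsteps_trans; [eapply nsteps_trans; [exact N1|exact N2]|].
      replace (p + (ecost e1 + ecost e2 + bcost b)) with (p + ecost e1 + ecost e2 + bcost b) by lia.
      exact N3.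
    + rewrite E3, E1', E2. reflexivity.
    + eapply tmp_ok_trans; [|eapply tmp_ok_trans; [|exact T1|exact T2]|exact T3]; lia.
  - apply andb_true_iff in Hwf as [Ha Hw]; apply Nat.ltb_lt in Ha. destruct Hsafe as (S1 & S2).
    apply code_at_app in Hc as [C1 Hc]. apply code_at_app in Hc as [C2 C3].
    rewrite ecode_length in *. change (length (acode a d)) with 4 in C3.
    apply code_at_cons in C3 as [C3 _].
    destruct (IH d p m o r s HW Hd Hw Hrel S1 C1) as (m1 & N1 & E1 & T1).
    destruct (acode_correct a d _ m1 o r HW Ha Hd' ltac:(apply T1)
      ltac:(rewrite E1; exact S2) C2) as (m2 & N2 & E2 & T2).
    assert (Hrel2 : rel s m2).
    { eapply rel_tmp; [exact Hd|exact Hrel|eapply tmp_ok_trans; [|exact T1|exact T2]; lia]. }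
    exists (upd m2 d (ar s a (eval e s))).
    assert (Hl : m2 (m2 d) = ar s a (eval e s)).
    { rewrite E2, E1. destruct Hrel2 as (_ & R & _). now apply R. }
    split; [|split].
    + replace (ecost e + 5) with (ecost e + 4 + 1) by lia.
      eapply nsteps_trans; [eapply nsteps_trans; [exact N1|exact N2]|].
      rewrite Nat.add_assoc. rewrite (Nat.add_assoc p).
      eapply step_one; [exact C3|]. unfold step; cbn [pc mem out rnd].
      rewrite C3, Hl, Nat.mod_small by (rewrite <- Hl; apply T2). reflexivity.
    + apply upd_eq.
    + assert (T12 : tmp_ok d m m2) by (eapply tmp_ok_trans; [|exact T1|exact T2]; lia).
      apply (tmp_ok_trans d d _ _ _ (le_n d) T12).
      apply tmp_ok_upd; [lia|rewrite <- Hl|]; apply T2.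
  - destruct Hsafe as (S1 & S2).
    apply code_at_app in Hc as [C1 C2]. rewrite ecode_length in *.
    apply code_at_cons in C2 as [C2 _].
    destruct (IH d p m o r s HW Hd Hwf Hrel S1 C1) as (m1 & N1 & E1 & T1).
    exists (upd m1 d (nth (eval e s) inp 0)). split; [|split].
    + eapply nsteps_trans; [exact N1|]. rewrite Nat.add_assoc.
      eapply step_one; [exact C2|]. unfold step; cbn [pc mem out rnd].
      rewrite C2, E1, Nat.mod_small; auto.
    + apply upd_eq.
    + apply (tmp_ok_trans d d _ _ _ (le_n d) T1).
      apply tmp_ok_upd; [lia|auto|apply T1].
Qed.

Lemma eval_lt e s m d : 80 < 2 ^ w -> 48 <= d -> wfe e d = true -> rel s m -> safe e s ->
  eval e s < 2 ^ w.
Proof.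
  intros HW. revert d. induction e; simpl; intros d Hd Hw (R1 & R2 & R3) Hs;
    rewrite ?andb_true_iff, ?Nat.ltb_lt in Hw.
  - rewrite <- R1 by tauto. auto.
  - auto.
  - destruct Hw, Hs as (? & ? & ?).
    assert (rel s m) by (split; auto).
    apply bopv_lt; auto; try lia; [eapply (IHe1 d)|eapply (IHe2 (S d))]; eauto.
  - rewrite <- R2 by tauto. auto.
  - tauto.
Qed.

Lemma rel_upd s m x v o r k : x < 48 -> v < 2 ^ w -> rel s m ->
  rel (St (upd (va s) x v) (ar s) o r k) (upd m x v).
Proof.
  intros Hx Hv (R1 & R2 & R3); repeat split; simpl.
  - intros y Hy. unfold upd. destruct (Nat.eqb y x); auto.
  - intros a i Ha. rewrite upd_neq by lia. rewrite <- R2 by auto. reflexivity.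
  - now apply upd_lt.
Qed.

Lemma bs_clock c s s' : bs c s s' -> ck s <= ck s'.
Proof.
  induction 1; cbn [ck tick] in *; lia.
Qed.

(** Induction on the derivation rather than on the command: one iteration of a loop then comes with
    the hypothesis for the remaining ones, at the same position [p], to which the final jump
    returns. The difference of the clocks is the exact number of steps; [bs_clock] shows that it is
    not truncated. *)
Lemma ccode_correct c s s' : 80 < 2 ^ w -> bs c s s' -> forall p m,
  wfc c = true -> rel s m -> code_at p (ccode c p) ->
  exists m', nsteps (ck s' - ck s) (Cfg p m (ou s) (rn s))
                    (Cfg (p + csize c) m' (ou s') (rn s')) /\ rel s' m'.
Proof.
  intros HW Hbs.
  induction Hbs; intros p m Hwf Hrel Hc; cbn [wfc ccode] in Hwf, Hc;
    rewrite ?andb_true_iff, ?Nat.ltb_lt in Hwf.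
  - exists m. rewrite Nat.sub_diag. split; auto. simpl. f_equal; lia.
  - destruct Hwf as (Hx & Hwf).
    apply code_at_app in Hc as [C1 C2]. rewrite ecode_length in *.
    apply code_at_cons in C2 as [C2 _].
    destruct (ecode_correct e 48 p m (ou s) (rn s) s HW (le_n _) Hwf Hrel H C1)
      as (m1 & N1 & E1 & T1).
    exists (upd m1 x (eval e s)). split.
    + cbn [ck ou rn csize]. replace (ck s + (ecost e + 1) - ck s) with (ecost e + 1) by lia.
      eapply nsteps_trans; [exact N1|]. rewrite Nat.add_assoc.
      eapply step_one; [exact C2|]. unfold step; cbn [pc mem out rnd].
      rewrite C2, E1, Nat.lor_diag, Nat.mod_small; auto. eapply eval_lt; eauto.
    + apply rel_upd; auto. eapply eval_lt; eauto. eapply (rel_tmp _ _ _ 48); eauto.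
  - destruct Hwf as ((Ha & Hw1) & Hw2).
    apply code_at_app in Hc as [C1 Hc]. apply code_at_app in Hc as [C2 Hc].
    apply code_at_app in Hc as [C3 C4]. rewrite !ecode_length in *.
    change (length (acode a 48)) with 4 in C3, C4.
    apply code_at_cons in C4 as [C4 _].
    destruct (ecode_correct e1 48 p m (ou s) (rn s) s HW (le_n _) Hw1 Hrel H C1)
      as (m1 & N1 & E1 & T1).
    destruct (acode_correct a 48 _ m1 (ou s) (rn s) HW Ha ltac:(lia) ltac:(apply T1)
      ltac:(rewrite E1; assumption) C2) as (m2 & N2 & E2 & T2).
    assert (T12 : tmp_ok 48 m m2) by (eapply tmp_ok_trans; [|exact T1|exact T2]; lia).
    assert (Hrel2 : rel s m2) by (eapply (rel_tmp _ _ _ 48); eauto).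
    destruct (ecode_correct e2 49 _ m2 (ou s) (rn s) s HW ltac:(lia) Hw2 Hrel2 H0 C3)
      as (m3 & N3 & E3 & T3).
    assert (T13 : tmp_ok 48 m m3) by (eapply tmp_ok_trans; [|exact T12|exact T3]; lia).
    assert (Hrel3 : rel s m3) by exact (rel_tmp s m m3 48 (le_n _) Hrel T13).
    exists (upd m3 (64 + 16 * eval e1 s + a) (eval e2 s)). split.
    + cbn [ck ou rn csize].
      replace (ck s + (ecost e1 + ecost e2 + 5) - ck s) with (ecost e1 + 4 + ecost e2 + 1) by lia.
      replace (p + (ecost e1 + ecost e2 + 5)) with (p + ecost e1 + 4 + ecost e2 + 1) by lia.
      eapply nsteps_trans; [eapply nsteps_trans; [eapply nsteps_trans; [exact N1|exact N2]|exact N3]|].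
      eapply step_one; [exact C4|]. unfold step; cbn [pc mem out rnd].
      rewrite C4.
      replace (m3 48) with (64 + 16 * eval e1 s + a).
      2:{ destruct T3 as (T3 & _). rewrite T3 by lia. rewrite E2, E1; reflexivity. }
      rewrite E3. reflexivity.
    + destruct Hrel3 as (R1 & R2 & R3). split; [|split]; cbn [va ar].
      * intros x Hx. rewrite upd_neq by lia. auto.
      * intros b i Hb. unfold aset. destruct (Nat.eqb_spec b a) as [->|Hab].
        -- unfold wr, upd at 2. destruct (Nat.eqb_spec i (eval e1 s)) as [->|Hi].
           ++ apply upd_eq.
           ++ rewrite upd_neq by lia. auto.
        -- rewrite upd_neq by lia. auto.
      * apply upd_lt; auto. eapply (eval_lt e2 s m2 49); eauto.
  - apply code_at_cons in Hc as [C1 _].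
    exists (upd m x (if b then 1 else 0)). split.
    + cbn [ck ou rn csize]. replace (ck s + 1 - ck s) with 1 by lia.
      eexists; split; [unfold step; cbn [pc mem out rnd]; rewrite C1, H; reflexivity|].
      simpl. f_equal. lia.
    + apply rel_upd; auto. destruct b; lia.
  - apply code_at_app in Hc as [C1 C2]. rewrite ecode_length in *.
    apply code_at_cons in C2 as [C2 _].
    destruct (ecode_correct e 48 p m (ou s) (rn s) s HW (le_n _) Hwf Hrel H C1)
      as (m1 & N1 & E1 & T1).
    exists m1. split.
    + cbn [ck ou rn csize]. replace (ck s + (ecost e + 1) - ck s) with (ecost e + 1) by lia.
      eapply nsteps_trans; [exact N1|].
      eexists; split; [unfold step; cbn [pc mem out rnd]; rewrite C2, E1; reflexivity|].
      simpl. f_equal. lia.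
    + eapply (rel_tmp _ _ _ 48); eauto.
  - destruct Hwf. apply code_at_app in Hc as [C1 C2]. rewrite ccode_length in *.
    destruct (IHHbs1 p m) as (m1 & N1 & R1); auto.
    destruct (IHHbs2 (p + csize c1) m1) as (m2 & N2 & R2); auto.
    exists m2; split; auto. cbn [csize].
    apply bs_clock in Hbs1, Hbs2.
    replace (ck s2 - ck s) with ((ck s1 - ck s) + (ck s2 - ck s1)) by lia.
    rewrite Nat.add_assoc. eapply nsteps_trans; eauto.
  - destruct Hwf as ((Hw & Hw1) & Hw2).
    apply code_at_app in Hc as [C1 Hc]. rewrite ecode_length in *.
    apply code_at_cons in Hc as [C2 Hc]. apply code_at_app in Hc as [C3 Hc].
    rewrite ccode_length in *. apply code_at_cons in Hc as [C4 _].
    destruct (ecode_correct e 48 p m (ou s) (rn s) s HW (le_n _) Hw Hrel H C1)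
      as (m1 & N1 & E1 & T1).
    destruct (IHHbs (p + ecost e + 1) m1) as (m2 & N2 & R2); auto.
    { apply rel_tick. eapply (rel_tmp _ _ _ 48); eauto. }
    { rewrite (Nat.add_1_r (p + ecost e)) in *. exact C3. }
    exists m2. split; [|apply rel_tick; auto].
    apply bs_clock in Hbs. cbn [ck tick ou rn csize] in *.
    replace (ck s' + 1 - ck s) with (ecost e + (1 + ((ck s' - (ck s + (ecost e + 1))) + 1))) by lia.
    eapply nsteps_trans; [exact N1|].
    eapply nsteps_trans.
    { eexists; split; [unfold step; cbn [pc mem out rnd]; rewrite C2, E1;
        destruct (Nat.eqb_spec (eval e s) 0) as [e0|_]; [contradiction|reflexivity]|reflexivity]. }
    eapply nsteps_trans. { rewrite (Nat.add_1_r (p + ecost e)) in N2. exact N2. }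
    eexists; split; [unfold step; cbn -[Nat.add]|].
    { replace (S (p + ecost e) + csize c1) with (S (p + ecost e) + csize c1) in C4 by lia.
      rewrite C4. reflexivity. }
    cbn. f_equal. lia.
  - destruct Hwf as ((Hw & Hw1) & Hw2).
    apply code_at_app in Hc as [C1 Hc]. rewrite ecode_length in *.
    apply code_at_cons in Hc as [C2 Hc]. apply code_at_app in Hc as [C3 Hc].
    rewrite ccode_length in *. apply code_at_cons in Hc as [C4 C5].
    destruct (ecode_correct e 48 p m (ou s) (rn s) s HW (le_n _) Hw Hrel H C1)
      as (m1 & N1 & E1 & T1).
    destruct (IHHbs (p + ecost e + csize c1 + 2) m1) as (m2 & N2 & R2); auto.
    { apply rel_tick. eapply (rel_tmp _ _ _ 48); eauto. }
    { replace (p + ecost e + csize c1 + 2) with (S (S (p + ecost e) + csize c1)) at 1 by lia. exact C5. }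
    exists m2. split; auto.
    apply bs_clock in Hbs. cbn [ck tick ou rn csize] in *.
    replace (ck s' - ck s) with (ecost e + (1 + (ck s' - (ck s + (ecost e + 1))))) by lia.
    eapply nsteps_trans; [exact N1|].
    eapply nsteps_trans.
    { eexists; split; [unfold step; cbn [pc mem out rnd]; rewrite C2, E1;
        rewrite H0; reflexivity|reflexivity]. }
    replace (p + (ecost e + csize c1 + csize c2 + 2)) with (p + ecost e + csize c1 + 2 + csize c2) by lia.
    exact N2.
  - destruct Hwf as (Hw & Hw1).
    apply code_at_app in Hc as [C1 Hc]. rewrite ecode_length in *.
    apply code_at_cons in Hc as [C2 Hc].
    destruct (ecode_correct e 48 p m (ou s) (rn s) s HW (le_n _) Hw Hrel H C1)
      as (m1 & N1 & E1 & T1).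
    exists m1. split; [|apply rel_tick; eapply (rel_tmp _ _ _ 48); eauto].
    cbn [ck tick ou rn csize] in *.
    replace (ck s + (ecost e + 1) - ck s) with (ecost e + 1) by lia.
    eapply nsteps_trans; [exact N1|].
    eexists; split; [unfold step; cbn [pc mem out rnd]; rewrite C2, E1, H0; reflexivity|].
    cbn -[Nat.add]. f_equal. lia.
  - pose proof Hc as Hc0. pose proof Hwf as Hwf0. destruct Hwf as (Hw & Hw1).
    apply code_at_app in Hc as [C1 Hc]. rewrite ecode_length in *.
    apply code_at_cons in Hc as [C2 Hc]. apply code_at_app in Hc as [C3 Hc].
    rewrite ccode_length in *. apply code_at_cons in Hc as [C4 _].
    destruct (ecode_correct e 48 p m (ou s) (rn s) s HW (le_n _) Hw Hrel H C1)
      as (m1 & N1 & E1 & T1).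
    destruct (IHHbs1 (p + ecost e + 1) m1) as (m2 & N2 & R2); auto.
    { apply rel_tick. eapply (rel_tmp _ _ _ 48); eauto. }
    { rewrite (Nat.add_1_r (p + ecost e)) in *. exact C3. }
    destruct (IHHbs2 p m2) as (m3 & N3 & R3); auto.
    { simpl. now rewrite Hw, Hw1. }
    exists m3. split; auto.
    apply bs_clock in Hbs1, Hbs2. cbn [ck tick ou rn csize] in *.
    replace (ck s2 - ck s) with (ecost e + (1 + ((ck s1 - (ck s + (ecost e + 1))) + (1 + (ck s2 - (ck s1 + 1)))))) by lia.
    eapply nsteps_trans; [exact N1|].
    eapply nsteps_trans.
    { eexists; split; [unfold step; cbn [pc mem out rnd]; rewrite C2, E1;
        destruct (Nat.eqb_spec (eval e s) 0) as [e0|_]; [contradiction|reflexivity]|reflexivity]. }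
    eapply nsteps_trans. { rewrite (Nat.add_1_r (p + ecost e)) in N2. exact N2. }
    eapply nsteps_trans; [|exact N3].
    eexists; split; [unfold step; cbn [pc mem out rnd]; rewrite C4; reflexivity|].
    reflexivity.
Qed.

End Semantics.

(** The extra step is the halting one: compiled code contains no [IHalt], and the machine halts when
    the program counter leaves the program. *)
Theorem compile_correct w inp c s s' m : 80 < 2 ^ w -> wfc c = true ->
  bs w inp c s s' -> rel w s m ->
  exists m', rel w s' m' /\
    exec w (ccode c 0) inp (S (ck s' - ck s)) (Cfg 0 m (ou s) (rn s))
    = Some (Cfg (csize c) m' (ou s') (rn s')).
Proof.
  intros HW Hwf Hbs Hrel.
  destruct (ccode_correct w inp (ccode c 0) c s s' HW Hbs 0 m Hwf Hrel) as (m' & N & R).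
  { intros i Hi. reflexivity. }
  exists m'. split; auto. rewrite <- Nat.add_1_r.
  erewrite nsteps_exec by exact N. simpl.
  unfold step; cbn [pc]. replace (nth_error (ccode c 0) (csize c)) with (@None instr).
  2:{ symmetry. apply nth_error_None. rewrite ccode_length. lia. }
  reflexivity.
Qed.

Lemma exec_mono w P inp t k c c' :
  exec w P inp t c = Some c' -> exec w P inp (t + k) c = Some c'.
Proof.
  revert c; induction t; simpl; intros c H; [discriminate|].
  destruct (step w P inp c); auto.
Qed.

Lemma exec_det w P inp t1 t2 c c1 c2 :
  exec w P inp t1 c = Some c1 -> exec w P inp t2 c = Some c2 -> c1 = c2.
Proof.
  intros H1 H2. apply (exec_mono _ _ _ _ t2) in H1. apply (exec_mono _ _ _ _ t1) in H2.
  rewrite Nat.add_comm in H2. congruence.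
Qed.

Definition more_rnd (x : list bool) (c : cfg) : cfg :=
  Cfg (pc c) (mem c) (out c) (rnd c ++ x).

(** A halting run never asked for a bit beyond the end of its random string, so it cannot notice
    that bits were appended there. *)
Lemma exec_more_rnd w P inp x t c c' :
  exec w P inp t c = Some c' ->
  exec w P inp t (more_rnd x c) = Some (more_rnd x c').
Proof.
  revert c; induction t; intros c H; [discriminate|].
  cbn [exec] in *. destruct c as [p m o r]. unfold step in *. cbn [pc mem out rnd more_rnd] in *.
  destruct (nth_error P p) as [i|]; [|inversion H; reflexivity].
  destruct i; try (apply IHt in H; exact H); try (inversion H; reflexivity).
  destruct r; [discriminate|]. cbn [app]. apply IHt in H. exact H.
Qed.

(** * Weakest preconditions *)

(** [mv], [ma], [mo] and [mr] bound syntactically which scalars and arrays, and whether output and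
    random bits, a command can change. They compute, so a frame condition for a concrete command is
    proved by [eq_refl]. *)
Fixpoint mv (c : cmd) (x : nat) : bool :=
  match c with
  | CAsg y _ | CRnd y => Nat.eqb x y
  | CSeq c1 c2 | CIf _ c1 c2 => mv c1 x || mv c2 x
  | CWhile _ c => mv c x
  | _ => false
  end.

Fixpoint ma (c : cmd) (a : nat) : bool :=
  match c with
  | CSto b _ _ => Nat.eqb a b
  | CSeq c1 c2 | CIf _ c1 c2 => ma c1 a || ma c2 a
  | CWhile _ c => ma c a
  | _ => false
  end.

Fixpoint mo (c : cmd) : bool :=
  match c with
  | COut _ => true
  | CSeq c1 c2 | CIf _ c1 c2 => mo c1 || mo c2
  | CWhile _ c => mo c
  | _ => false
  end.

Fixpoint mr (c : cmd) : bool :=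
  match c with
  | CRnd _ => true
  | CSeq c1 c2 | CIf _ c1 c2 => mr c1 || mr c2
  | CWhile _ c => mr c
  | _ => false
  end.

Definition fr (c : cmd) (s s' : state) : Prop :=
  (forall x, mv c x = false -> va s' x = va s x) /\
  (forall a, ma c a = false -> ar s' a = ar s a) /\
  (mo c = false -> ou s' = ou s) /\
  (mr c = false -> rn s' = rn s).

Lemma bs_fr w inp c s s' : bs w inp c s s' -> fr c s s'.
Proof.
  induction 1; (split; [|split; [|split]]); cbn [mv ma mo mr va ar ou rn tick]; intros; auto;
    rewrite ?orb_false_iff in *; try discriminate;
    repeat match goal with H : fr _ _ _ |- _ => destruct H as (? & ? & ? & ?) end;
    cbn [va ar ou rn tick] in *; try tauto.
  1: unfold upd; now rewrite H0.
  1: unfold aset; now rewrite H2.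
  1: unfold upd; now rewrite H0.
  all: repeat match goal with H : _ /\ _ |- _ => destruct H end.
  all: repeat match goal with
       | H : forall x, _ -> _ = _ |- _ => rewrite H by assumption
       | H : _ -> _ = _ |- _ => rewrite H by assumption
       end; reflexivity.
Qed.

(** Total correctness: a derivation must exist, so a proof of [wp] includes termination and every
    [safe] side condition. The clock is part of the state, hence time bounds are ordinary
    postconditions. *)
Definition wp (w : nat) (inp : list nat) (c : cmd) (s : state) (Q : state -> Prop) : Prop :=
  exists s', bs w inp c s s' /\ Q s'.

Definition CFor (x y : nat) (c : cmd) : cmd :=
  CSeq (CAsg x (ECst 0))
       (CWhile (EBin OLt (EVar x) (EVar y))
               (CSeq c (CAsg x (EBin OAdd (EVar x) (ECst 1))))).

Section WP.
Variables (w : nat) (inp : list nat).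

Lemma wp_conseq c s (Q Q' : state -> Prop) :
  wp w inp c s Q -> (forall s', Q s' -> Q' s') -> wp w inp c s Q'.
Proof. intros (s' & H & HQ) HH; exists s'; auto. Qed.

Lemma wp_fr c s Q : wp w inp c s Q -> wp w inp c s (fun s' => fr c s s' /\ Q s').
Proof. intros (s' & H & HQ). exists s'; split; auto. split; auto. eapply bs_fr; eauto. Qed.

Lemma wp_conseq_fr c s (Q Q' : state -> Prop) :
  wp w inp c s Q -> (forall s', fr c s s' -> Q s' -> Q' s') -> wp w inp c s Q'.
Proof. intros H HH; eapply wp_conseq; [apply wp_fr, H|]. intros s' []; auto. Qed.

Lemma wp_skip s (Q : state -> Prop) : Q s -> wp w inp CSkip s Q.
Proof. exists s; split; auto; constructor. Qed.

Lemma wp_seq c1 c2 s Q :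
  wp w inp c1 s (fun s1 => wp w inp c2 s1 Q) -> wp w inp (CSeq c1 c2) s Q.
Proof. intros (s1 & H1 & s2 & H2 & HQ). exists s2; split; auto. econstructor; eauto. Qed.

Lemma wp_asg x e s (Q : state -> Prop) : safe w inp e s ->
  (forall v, v = eval w inp e s ->
    Q (St (upd (va s) x v) (ar s) (ou s) (rn s) (ck s + (ecost e + 1)))) ->
  wp w inp (CAsg x e) s Q.
Proof. intros H HQ. eexists; split; [apply BAsg; auto|auto]. Qed.

Lemma wp_sto a e1 e2 s (Q : state -> Prop) :
  safe w inp e1 s -> safe w inp e2 s -> 80 + 16 * eval w inp e1 s < 2 ^ w ->
  Q (St (va s) (aset (ar s) a (eval w inp e1 s) (eval w inp e2 s)) (ou s) (rn s)
           (ck s + (ecost e1 + ecost e2 + 5))) ->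
  wp w inp (CSto a e1 e2) s Q.
Proof. intros. eexists; split; [apply BSto; auto|auto]. Qed.

Lemma wp_rnd x s b r (Q : state -> Prop) : rn s = b :: r ->
  Q (St (upd (va s) x (if b then 1 else 0)) (ar s) (ou s) r (ck s + 1)) ->
  wp w inp (CRnd x) s Q.
Proof. intros. eexists; split; [eapply BRnd; eauto|auto]. Qed.

Lemma wp_out e s (Q : state -> Prop) : safe w inp e s ->
  Q (St (va s) (ar s) (ou s ++ [eval w inp e s]) (rn s) (ck s + (ecost e + 1))) ->
  wp w inp (COut e) s Q.
Proof. intros. eexists; split; [eapply BOut; eauto|auto]. Qed.

Lemma wp_if e c1 c2 s (Q : state -> Prop) : safe w inp e s ->
  (eval w inp e s <> 0 -> wp w inp c1 (tick (ecost e + 1) s) (fun s' => Q (tick 1 s'))) ->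
  (eval w inp e s = 0 -> wp w inp c2 (tick (ecost e + 1) s) Q) ->
  wp w inp (CIf e c1 c2) s Q.
Proof.
  intros Hs H1 H2. destruct (Nat.eq_dec (eval w inp e s) 0) as [e0|ne].
  - destruct (H2 e0) as (s' & Hb & HQ). exists s'; split; auto. now apply BIfF.
  - destruct (H1 ne) as (s' & Hb & HQ). exists (tick 1 s'); split; auto. now apply BIfT.
Qed.

Lemma wp_while (I : nat -> state -> Prop) e c s m (Q : state -> Prop) :
  I m s ->
  (forall m s, I m s -> safe w inp e s /\
     (eval w inp e s = 0 -> Q (tick (ecost e + 1) s)) /\
     (eval w inp e s <> 0 ->
        wp w inp c (tick (ecost e + 1) s) (fun s' => exists m', m' < m /\ I m' (tick 1 s')))) ->
  wp w inp (CWhile e c) s Q.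
Proof.
  intros HI H. revert s HI. induction m as [m IH] using lt_wf_ind. intros s HI.
  destruct (H m s HI) as (Hs & H0 & H1).
  destruct (Nat.eq_dec (eval w inp e s) 0) as [e0|ne].
  - eexists; split; [apply BWhF; auto|auto].
  - destruct (H1 ne) as (s1 & Hb & m' & Hm & HI').
    destruct (IH m' Hm _ HI') as (s2 & Hb2 & HQ).
    exists s2; split; auto. eapply BWhT; eauto.
Qed.

(** [T] is the accumulated cost of the body, compared additively to avoid subtraction, so rounds may
    have different costs. A round adds 9 steps (4 for the test, 4 for the increment, 1 for the jump)
    and the loop 6 (2 for the initialisation, 4 for the failing test). The closure condition on [I]
    makes the invariant independent of the counter and the clock. *)
Lemma wp_for_gen (I : nat -> state -> Prop) (T : nat -> nat) x y body s N (Q : state -> Prop) :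
  Nat.eqb x y || mv body x || mv body y = false ->
  va s y = N -> N < 2 ^ w -> 1 < 2 ^ w ->
  (forall i s v k, I i s -> I i (St (upd (va s) x v) (ar s) (ou s) (rn s) k)) ->
  I 0 s ->
  (forall i s', i < N -> fr (CFor x y body) s s' -> I i s' -> va s' x = i ->
     wp w inp body s' (fun s'' => I (S i) s'' /\ ck s'' + T i <= ck s' + T (S i))) ->
  (forall s', fr (CFor x y body) s s' -> I N s' -> va s' x = N ->
     ck s' + T 0 <= ck s + T N + 9 * N + 6 -> Q s') ->
  wp w inp (CFor x y body) s Q.
Proof.
  intros Hm Hy HN HW Hext HI0 Hbody HQ.
  apply orb_false_iff in Hm as [Hm Hmy]. apply orb_false_iff in Hm as [Hxy Hmx].
  apply Nat.eqb_neq in Hxy.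
  apply wp_seq, wp_asg; [simpl; lia|]. intros v ->. cbn [eval].
  set (s0 := St _ _ _ _ _).
  assert (F0 : fr (CFor x y body) s s0).
  { repeat split. intros z Hz. cbn in Hz |- *. unfold upd.
    destruct (Nat.eqb z x); [discriminate|reflexivity]. }
  apply wp_while with (m := N) (I := fun m s' => m <= N /\ fr (CFor x y body) s s' /\
     va s' x = N - m /\ I (N - m) s' /\
     ck s' + T 0 <= ck s + T (N - m) + 9 * (N - m) + 2).
  - rewrite Nat.sub_diag. repeat split; auto; try (apply F0).
    + cbn. apply upd_eq.
    + now apply Hext.
    + cbn. lia.
  - intros m s' (Hm & F & Hx & HI & Hc).
    assert (Hy' : va s' y = N).
    { destruct F as (F & _). rewrite F; auto. cbn [CFor mv].
      rewrite Hmy. destruct (Nat.eqb_spec y x); [congruence|reflexivity]. }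
    split; [cbn; auto|]. cbn [eval bopv ecost bcost]. rewrite Hx, Hy'. split.
    + intros e0. destruct (Nat.ltb_spec (N - m) N); [discriminate|].
      assert (m = 0 \/ N = 0) as HH by lia.
      assert (Em : N - m = N) by lia. rewrite Em in *.
      apply HQ; auto.
      (* The tick is disguised as writing [x] back to itself, the form that the closure condition on
         [I] accepts. *)
      * replace (tick (1 + 1 + 1 + 1) s') with
          (St (upd (va s') x (va s' x)) (ar s') (ou s') (rn s') (ck s' + 4)).
        -- now apply Hext.
        -- unfold tick. f_equal. unfold upd. apply FunctionalExtensionality.functional_extensionality.
           intros z. destruct (Nat.eqb_spec z x); subst; auto.
      * cbn [ck tick]. lia.
    + destruct (Nat.ltb_spec (N - m) N); [|congruence]. intros _.
      apply wp_seq. eapply wp_conseq_fr.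
      * apply (Hbody (N - m)); auto.
        replace (tick (1 + 1 + 1 + 1) s') with
          (St (upd (va s') x (va s' x)) (ar s') (ou s') (rn s') (ck s' + 4)).
        -- now apply Hext.
        -- unfold tick. f_equal. unfold upd. apply FunctionalExtensionality.functional_extensionality.
           intros z. destruct (Nat.eqb_spec z x); subst; auto.
      * intros s1 F1 (HI1 & Hc1). cbn [tick ck] in Hc1.
        assert (Hx1 : va s1 x = N - m).
        { destruct F1 as (F1 & _). rewrite F1 by exact Hmx. exact Hx. }
        apply wp_asg. { cbn. rewrite Hx1. repeat split; lia. }
        intros v Hv. cbn [eval bopv] in Hv. rewrite Hx1 in Hv.
        exists (m - 1). split; [lia|].
        replace (N - (m - 1)) with (S (N - m)) by lia.
        replace v with (S (N - m)) by lia.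
        repeat split; try lia.
        -- intros z Hz. cbn [tick va]. cbn [CFor mv] in Hz.
           apply orb_false_iff in Hz as [Hz1 Hz2]. apply orb_false_iff in Hz2 as [Hz2 _].
           unfold upd. rewrite Hz1.
           destruct F1 as (F1 & _). rewrite F1 by exact Hz2. cbn [tick va].
           destruct F as (F & _). apply F. cbn [CFor mv]. now rewrite Hz1, Hz2.
        -- intros a Ha. cbn [tick ar]. cbn [CFor ma orb] in Ha. rewrite orb_false_r in Ha.
           destruct F1 as (_ & F1 & _). rewrite F1 by exact Ha.
           destruct F as (_ & F & _). apply F. cbn [CFor ma orb]. now rewrite Ha.
        -- intros Ho. cbn [tick ou]. cbn [CFor mo orb] in Ho. rewrite orb_false_r in Ho.
           destruct F1 as (_ & _ & F1 & _). rewrite F1 by exact Ho.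
           destruct F as (_ & _ & F & _). apply F. cbn [CFor mo orb]. now rewrite Ho.
        -- intros Ho. cbn [tick rn]. cbn [CFor mr orb] in Ho. rewrite orb_false_r in Ho.
           destruct F1 as (_ & _ & _ & F1). rewrite F1 by exact Ho.
           destruct F as (_ & _ & _ & F). apply F. cbn [CFor mr orb]. now rewrite Ho.
        -- cbn [tick va]. apply upd_eq.
        -- exact (Hext _ s1 _ _ HI1).
        -- cbn [tick ck ecost bcost]. lia.
Qed.

Lemma wp_for (I : nat -> state -> Prop) (K : nat) x y body s N (Q : state -> Prop) :
  Nat.eqb x y || mv body x || mv body y = false ->
  va s y = N -> N < 2 ^ w -> 1 < 2 ^ w ->
  (forall i s v k, I i s -> I i (St (upd (va s) x v) (ar s) (ou s) (rn s) k)) ->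
  I 0 s ->
  (forall i s', i < N -> fr (CFor x y body) s s' -> I i s' -> va s' x = i ->
     wp w inp body s' (fun s'' => I (S i) s'' /\ ck s'' <= ck s' + K)) ->
  (forall s', fr (CFor x y body) s s' -> I N s' -> va s' x = N ->
     ck s' <= ck s + (K + 9) * N + 6 -> Q s') ->
  wp w inp (CFor x y body) s Q.
Proof.
  intros H1 H2 H3 H4 H5 H6 H7 H8.
  apply wp_for_gen with (I := I) (T := fun i => K * i) (N := N); auto.
  - intros i s' A B C D. eapply wp_conseq; [apply (H7 i); auto|].
    intros s'' (E & F). split; auto. lia.
  - intros s' A B C D. apply H8; auto. lia.
Qed.

Lemma wp_tab (f : nat -> nat) (K : nat) x y a body s N (Q : state -> Prop) :
  Nat.eqb x y || mv body x || mv body y = false ->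
  va s y = N -> N < 2 ^ w -> 1 < 2 ^ w ->
  (forall i s', i < N -> fr (CFor x y body) s s' -> va s' x = i ->
     wp w inp body s' (fun s'' => ar s'' a = wr (ar s' a) i (f i) /\ ck s'' <= ck s' + K)) ->
  (forall s', fr (CFor x y body) s s' -> (forall i, i < N -> ar s' a i = f i) ->
     ck s' <= ck s + (K + 9) * N + 6 -> Q s') ->
  wp w inp (CFor x y body) s Q.
Proof.
  intros H1 H2 H3 H4 H5 H6.
  apply wp_for with (I := fun i s' => forall j, j < i -> ar s' a j = f j) (K := K) (N := N); auto.
  - intros; lia.
  - intros i s' Hi F HI Hx. eapply wp_conseq; [apply (H5 i); auto|].
    intros s'' (E & Hc). split; auto. intros j Hj. rewrite E.
    unfold wr, upd. destruct (Nat.eqb_spec j i); subst; auto. apply HI; lia.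
Qed.

End WP.

Lemma wr_eq f i v : wr f i v i = v.
Proof. apply upd_eq. Qed.

Lemma wr_neq f i v j : j <> i -> wr f i v j = f j.
Proof. apply upd_neq. Qed.

Ltac ev_in H := cbn [eval safe bopv bop_ok va ar ou rn ck tick upd aset Nat.eqb] in H.
Ltac ev := cbn [eval safe bopv bop_ok va ar ou rn ck tick upd aset Nat.eqb].

Ltac known :=
  repeat match goal with
  | H : va ?s ?x = _ |- context [va ?s ?x] => rewrite H
  | H : ar ?s ?x = _ |- context [ar ?s ?x] => rewrite H
  end.
Ltac known_in E :=
  repeat match type of E with
  | context [va ?s ?x] => match goal with H : va s x = _ |- _ => rewrite H in E end
  | context [ar ?s ?x] => match goal with H : ar s x = _ |- _ => rewrite H in E end
  end.

(** Transports every known value of a scalar across a command with frame [F], after computing with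
    [mv] that the command leaves this scalar alone. *)
Ltac carry F :=
  match type of F with
  | fr ?c ?s ?s' =>
      repeat match goal with
      | H : va s ?z = ?e |- _ =>
          lazymatch goal with
          | _ : va s' z = _ |- _ => fail
          | _ => let b := eval vm_compute in (mv c z) in
                 lazymatch b with
                 | false => pose proof (eq_trans (proj1 F z eq_refl) H)
                 | _ => fail
                 end
          end
      end
  end.

Ltac arrs F a :=
  match type of F with
  | fr ?c ?s ?s' => let H := fresh "HA" in
      assert (H : ar s' a = ar s a) by (exact (proj1 (proj2 F) a eq_refl))
  end.

Ltac asg v E :=
  try apply wp_seq; apply wp_asg;
  [ev; known; repeat split; try exact I; auto; try lia
  |intros v E; ev_in E; known_in E; ev].

(** * Fast negacyclic convolution *)

Fixpoint sumz (n : nat) (f : nat -> Z) : Z :=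
  match n with 0 => 0%Z | S n => (sumz n f + f n)%Z end.

Fixpoint pw (z : Z) (n : nat) : Z :=
  match n with 0 => 1%Z | S n => (z * pw z n)%Z end.

(** The sign [(-1)^b]. *)
Definition sg (b : nat) : Z := (1 - 2 * Z.of_nat (b mod 2))%Z.

Fixpoint rvf (f p b : nat) : nat :=
  match f with 0 => 0 | S f => rvf f p (b / 2) / 2 + (b mod 2) * p end.

(* [rv p b / 2p] is the binary radical inverse of [b]: after the splitting of
   [x^(2p) - 1] block [b] is the residue modulo [x^m - w^(rv p b)], [w] being a
   root of unity of order [2p]. *)
Definition rv (p b : nat) : nat := rvf b p b.

(** Coefficient [z^j] of row [t] is stored at [t * q + j]. Row [2 p B + i] with [i < p] collects the
    exponents [i + p j] of block [B], since [y^(i + p j) = x^i z^j]; the other [p] rows are zero and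
    leave room for a product of degree below [2 p] in [x]. *)
Definition splitF (p q : nat) (a : nat -> Z) (g : nat) : Z :=
  if (g / q) mod (2 * p) <? p
  then a (g / q / (2 * p) * (p * q) + (g / q) mod (2 * p) + p * (g mod q)) else 0%Z.

(** The exponent of [z] in the root used at row [t]; [z^(q/p)] is a root of unity of order [2 p].
    Only [t / (2 h)] enters, so both rows of a butterfly use the same root. *)
Definition tw (p q h t : nat) : nat := rv p (2 * ((t / (2 * h)) mod (p / h))) * (q / p).

(** The butterfly [u + c v], [u - c v] with [c = z^E], [E = tw p q h t]. Multiplying a row by [z^E]
    is a cyclic shift in which entries that pass [z^q = -1] change sign; positions are taken modulo
    [2 q], so [jj / q] is that sign, and [d] tells the two halves apart. *)
Definition stF (p q h : nat) (a : nat -> Z) (g : nat) : Z :=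
  let t := g / q in
  let d := (t / h) mod 2 in
  let u := t - d * h in
  let jj := (g mod q + (2 * q - tw p q h t)) mod (2 * q) in
  (a (u * q + g mod q)%nat + sg (d + jj / q) * a ((u + h) * q + jj mod q)%nat)%Z.

(** The inverse butterfly [u + v], [z^(-E) (u - v)], without the division by two. *)
Definition istF (p q h : nat) (a : nat -> Z) (g : nat) : Z :=
  let t := g / q in
  let d := (t / h) mod 2 in
  let u := t - d * h in
  let jj := (g mod q + d * tw p q h t) mod (2 * q) in
  (sg (jj / q) * (a (u * q + jj mod q)%nat + sg d * a ((u + h) * q + jj mod q)%nat))%Z.

(** The reduction by [x^p = z]: row [i + p], shifted by one, is added to row [i], and the
    coefficients return to the order of the powers of [y]. *)
Definition mergeF (p q : nat) (a : nat -> Z) (g : nat) : Z :=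
  let B := g / (p * q) in
  let i := (g mod (p * q)) mod p in
  let j := (g mod (p * q)) / p in
  let jj := (j + (2 * q - 1)) mod (2 * q) in
  (a ((B * (2 * p) + i) * q + j)%nat + sg (jj / q) * a ((B * (2 * p) + i + p) * q + jj mod q)%nat)%Z.

(** At length two the ring is [Z[i]]: this multiplies Gaussian integers, pair by pair. *)
Definition mulF (a b : nat -> Z) (g : nat) : Z :=
  let d := g mod 2 in
  (a (g - d)%nat * b g + sg (1 - d) * (a (g - d + 1)%nat * b (g - d + 1 - d)%nat))%Z.

Fixpoint stages (p q t : nat) (a : nat -> Z) : nat -> Z :=
  match t with 0 => a | S t => stages p q t (stF p q (2 ^ t) a) end.

Fixpoint istages (p q t : nat) (a : nat -> Z) : nat -> Z :=
  match t with 0 => a | S t => istF p q (2 ^ t) (istages p q t a) end.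

(* Nussbaumer's recursion: with [D = p q], [Z[y]/(y^D + 1)] is [S[x]/(x^p - z)]
   for [S = Z[z]/(z^q + 1)] and [z = y^p]; products of polynomials of degree
   [< p] over [S] are evaluated at the [2p]-th roots of unity of [S], which are
   powers of [z]. *)
Fixpoint FW (f d : nat) (a : nat -> Z) : nat -> Z :=
  match f with
  | 0 => a
  | S f => if d <=? 1 then a else
      let p := 2 ^ (d / 2) in let q := 2 ^ (d - d / 2) in
      FW f (d - d / 2) (stages p q (S (d / 2)) (splitF p q a))
  end.

Fixpoint BW (f d : nat) (r : nat -> Z) : nat -> Z :=
  match f with
  | 0 => r
  | S f => if d <=? 1 then r else
      let p := 2 ^ (d / 2) in let q := 2 ^ (d - d / 2) in
      mergeF p q (istages p q (S (d / 2)) (BW f (d - d / 2) r))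
  end.

(** The factor that the inverse butterflies leave behind: [2 p = 2 ^ S (d / 2)] for each level. *)
Fixpoint kap (f d : nat) : nat :=
  match f with
  | 0 => 1
  | S f => if d <=? 1 then 1 else 2 ^ S (d / 2) * kap f (d - d / 2)
  end.

(** * Finite sums, powers and radical inverses *)

Lemma pw_add z m n : pw z (m + n) = (pw z m * pw z n)%Z.
Proof. induction m; cbn [pw Nat.add]; [lia|rewrite IHm; ring]. Qed.

Lemma pw_mul z m n : pw z (m * n) = pw (pw z m) n.
Proof.
  induction n; [now rewrite Nat.mul_0_r|].
  rewrite Nat.mul_succ_r, pw_add, IHn. cbn [pw]. ring.
Qed.

Lemma pw_1 n : pw 1 n = 1%Z.
Proof. induction n; cbn [pw]; lia. Qed.

Lemma sumz_ext n f g : (forall i, i < n -> f i = g i) -> sumz n f = sumz n g.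
Proof. induction n; cbn [sumz]; intros H; auto. rewrite IHn, H; auto. Qed.

Lemma sumz_add n f g : sumz n (fun i => f i + g i)%Z = (sumz n f + sumz n g)%Z.
Proof. induction n; cbn [sumz]; [lia|rewrite IHn; ring]. Qed.

Lemma sumz_scal n c f : sumz n (fun i => c * f i)%Z = (c * sumz n f)%Z.
Proof. induction n; cbn [sumz]; [lia|rewrite IHn; ring]. Qed.

Lemma sumz_zero n : sumz n (fun _ => 0%Z) = 0%Z.
Proof. induction n; cbn [sumz]; lia. Qed.

Lemma sumz_split m n f : sumz (m + n) f = (sumz m f + sumz n (fun i => f (m + i)%nat))%Z.
Proof.
  induction n; [rewrite Nat.add_0_r; cbn [sumz]; lia|].
  rewrite Nat.add_succ_r. cbn [sumz]. rewrite IHn. ring.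
Qed.

Lemma sumz_first n f : sumz (S n) f = (f 0%nat + sumz n (fun i => f (S i)))%Z.
Proof. change (S n) with (1 + n). rewrite sumz_split. cbn [sumz]. reflexivity. Qed.

Lemma sumz_swap m n f :
  sumz m (fun i => sumz n (f i)) = sumz n (fun j => sumz m (fun i => f i j)).
Proof.
  induction m; cbn [sumz]; [now rewrite sumz_zero|].
  rewrite IHm, <- sumz_add. reflexivity.
Qed.

Lemma sumz_prod p q f :
  sumz (p * q) f = sumz p (fun i => sumz q (fun j => f (i + p * j)%nat)).
Proof.
  rewrite sumz_swap. induction q; [now rewrite Nat.mul_0_r|].
  rewrite Nat.mul_succ_r, sumz_split, IHq. cbn [sumz]. f_equal.
  apply sumz_ext; intros. f_equal; lia.
Qed.

Lemma rvf_fuel p f : forall f' b, b <= f -> b <= f' -> rvf f p b = rvf f' p b.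
Proof.
  assert (H0 : forall f, rvf f p 0 = 0).
  { induction f0; cbn [rvf]; auto. change (0 / 2) with 0. rewrite IHf0. reflexivity. }
  induction f as [|f IH]; intros f' b H1 H2.
  - replace b with 0 by lia. now rewrite !H0.
  - destruct f' as [|f'].
    + replace b with 0 by lia. now rewrite !H0.
    + cbn [rvf]. f_equal. f_equal.
      destruct b; [apply IH; simpl; lia|].
      pose proof (Nat.div_lt (S b) 2 ltac:(lia) ltac:(lia)).
      apply IH; lia.
Qed.

Lemma rv_eq p b : rv p b = rv p (b / 2) / 2 + (b mod 2) * p.
Proof.
  unfold rv. destruct b; [reflexivity|]. cbn [rvf]. f_equal. f_equal.
  pose proof (Nat.div_lt (S b) 2 ltac:(lia) ltac:(lia)).
  apply rvf_fuel; lia.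
Qed.

Lemma rv_lt p b : 0 < p -> rv p b < 2 * p.
Proof.
  intros Hp. induction b as [b IH] using lt_wf_ind. rewrite rv_eq.
  pose proof (Nat.mod_upper_bound b 2 ltac:(lia)).
  assert (rv p (b / 2) < 2 * p).
  { destruct b; [exact Hp || (unfold rv; simpl; lia)|]. apply IH. apply Nat.div_lt; lia. }
  assert (rv p (b / 2) / 2 < p) by (apply Nat.Div0.div_lt_upper_bound; lia). nia.
Qed.

(** For an index of at most [S s] bits the halvings inside [rv] meet only multiples of sufficiently
    high powers of two, so they are exact; [rv_double] depends on this. *)
Lemma rv_div s t : t <= S s -> forall b, b < 2 ^ t -> exists m, rv (2 ^ s) b = m * 2 ^ (S s - t).
Proof.
  induction t as [|t IH]; intros Ht b Hb.
  - simpl in Hb. replace b with 0 by lia. exists 0. reflexivity.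
  - assert (Hb2 : b / 2 < 2 ^ t).
    { apply Nat.Div0.div_lt_upper_bound. rewrite Nat.pow_succ_r' in Hb. exact Hb. }
    destruct (IH ltac:(lia) (b / 2) Hb2) as (m & Hm).
    rewrite rv_eq, Hm.
    replace (S s - t) with (S (S s - S t)) by lia. rewrite Nat.pow_succ_r'.
    replace (m * (2 * 2 ^ (S s - S t))) with (m * 2 ^ (S s - S t) * 2) by ring.
    rewrite Nat.div_mul by lia.
    replace (2 ^ s) with (2 ^ t * 2 ^ (S s - S t)) by (rewrite <- Nat.pow_add_r; f_equal; lia).
    exists (m + (b mod 2) * 2 ^ t). ring.
Qed.

Lemma rv_double s b : b < 2 ^ S s ->
  2 * rv (2 ^ s) b = rv (2 ^ s) (b / 2) + (b mod 2) * (2 * 2 ^ s).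
Proof.
  intros Hb. rewrite (rv_eq _ b).
  assert (Hb2 : b / 2 < 2 ^ s).
  { apply Nat.Div0.div_lt_upper_bound. rewrite Nat.pow_succ_r' in Hb. exact Hb. }
  destruct (rv_div s s ltac:(lia) _ Hb2) as (m & Hm). rewrite Hm.
  replace (S s - s) with 1 by lia. rewrite Nat.pow_1_r, Nat.div_mul by lia. ring.
Qed.

(** Read in the exponent of a root of unity of order [2 p]: the power [2 ^ t] of the root at [b] is
    the root at [b / 2 ^ t]. *)
Lemma rv_iter s t b : b < 2 ^ S s ->
  exists m, 2 ^ t * rv (2 ^ s) b = rv (2 ^ s) (b / 2 ^ t) + m * (2 * 2 ^ s).
Proof.
  intros Hb. induction t as [|t (m & IH)].
  - exists 0. rewrite Nat.pow_0_r, Nat.div_1_r. lia.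
  - rewrite Nat.pow_succ_r', (Nat.mul_comm 2), <- Nat.Div0.div_div.
    assert (Hb' : b / 2 ^ t < 2 ^ S s).
    { eapply Nat.le_lt_trans; [|exact Hb]. apply Nat.Div0.div_le_upper_bound.
      pose proof (Nat.pow_nonzero 2 t). nia. }
    pose proof (rv_double s _ Hb') as Hd.
    exists (2 * m + (b / 2 ^ t) mod 2). nia.
Qed.

Lemma sg_0 : sg 0 = 1%Z. Proof. reflexivity. Qed.
Lemma sg_1 : sg 1 = (-1)%Z. Proof. reflexivity. Qed.

Lemma sg_add a b : sg (a + b) = (sg a * sg b)%Z.
Proof.
  unfold sg. rewrite Nat.Div0.add_mod.
  pose proof (Nat.mod_upper_bound a 2 ltac:(lia)).
  pose proof (Nat.mod_upper_bound b 2 ltac:(lia)).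
  destruct (a mod 2) as [|[|]], (b mod 2) as [|[|]]; try lia; reflexivity.
Qed.

Lemma dec_unique h B d i : d < 2 -> i < h ->
  (B * (2 * h) + d * h + i) / h mod 2 = d /\ (B * (2 * h) + d * h + i) / (2 * h) = B.
Proof.
  intros Hd Hi. split.
  - replace (B * (2 * h) + d * h + i) with (i + (d + B * 2) * h) by ring.
    rewrite Nat.div_add, Nat.div_small by lia.
    rewrite Nat.add_0_l, Nat.Div0.mod_add. apply Nat.mod_small; lia.
  - symmetry. apply Nat.div_unique with (r := d * h + i); nia.
Qed.

Lemma dec_exists h t : 0 < h -> exists B d i, t = B * (2 * h) + d * h + i /\ d < 2 /\ i < h.
Proof.
  intros Hh. exists (t / h / 2), ((t / h) mod 2), (t mod h).
  pose proof (Nat.div_mod_eq t h). pose proof (Nat.div_mod_eq (t / h) 2).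
  pose proof (Nat.mod_upper_bound (t / h) 2 ltac:(lia)).
  pose proof (Nat.mod_upper_bound t h ltac:(lia)). repeat split; auto. nia.
Qed.

Lemma blk_divmod q t j : j < q -> (t * q + j) / q = t /\ (t * q + j) mod q = j.
Proof.
  intros Hj. split.
  - symmetry. apply Nat.div_unique with (r := j); lia.
  - symmetry. apply Nat.mod_unique with (q := t); lia.
Qed.

(** The coefficients of a product of polynomials with [m] and [n] coefficients. The algorithm never
    forms them; [level_step] needs a name for the polynomial whose values are the products of
    transformed rows. *)
Fixpoint pconv (m n : nat) (a b : nat -> Z) : nat -> Z :=
  match m with
  | 0 => fun _ => 0%Z
  | S m => fun i : nat => ((if (i <? m + n)%nat then pconv m n a b i else 0)
      + (if (m <=? i)%nat then (if (i - m <? n)%nat then a m * b (i - m)%nat else 0) else 0))%Z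
  end.

Lemma pconv_eval m n (a b : nat -> Z) x :
  (sumz m (fun i => a i * pw x i) * sumz n (fun i => b i * pw x i))%Z
  = sumz (m + n) (fun i => pconv m n a b i * pw x i)%Z.
Proof.
  induction m as [|m IH].
  - cbn [sumz pconv]. rewrite Z.mul_0_l. symmetry. etransitivity; [|exact (sumz_zero (0 + n))].
    apply sumz_ext. intros. apply Z.mul_0_l.
  - cbn [sumz]. rewrite Z.mul_add_distr_r, IH.
    change (S m + n) with (S (m + n)). cbn [sumz pconv].
    rewrite (proj2 (Nat.ltb_ge (m + n) (m + n))) by lia.
    replace (m + n - m) with n by lia. rewrite (proj2 (Nat.ltb_ge n n)) by lia.
    replace (m <=? m + n) with true by (symmetry; apply Nat.leb_le; lia).
    rewrite Z.mul_0_l, Z.add_0_r.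
    rewrite (sumz_split m n (fun i => (_ + _) * pw x i)%Z), (sumz_split m n (fun i => pconv m n a b i * pw x i)%Z), <- Z.add_assoc.
    f_equal.
    + apply sumz_ext. intros i Hi. rewrite (proj2 (Nat.ltb_lt i (m + n))) by lia.
      rewrite (proj2 (Nat.leb_gt m i)) by lia. ring.
    + rewrite <- sumz_scal, <- sumz_add. apply sumz_ext. intros i Hi.
      rewrite (proj2 (Nat.ltb_lt (m + i) (m + n))) by lia.
      rewrite (proj2 (Nat.leb_le m (m + i))) by lia. replace (m + i - m) with i by lia.
      rewrite (proj2 (Nat.ltb_lt i n)) by lia. rewrite pw_add. ring.
Qed.

(** * The transform evaluated at one integer modulo Q *)

Section Cong.
Variable Q : Z.

Definition cg (a b : Z) : Prop := (Q | a - b)%Z.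
Local Infix "==" := cg (at level 70).

Instance cg_equiv : Equivalence cg.
Proof.
  split; red; unfold cg; intros.
  - rewrite Z.sub_diag. apply Z.divide_0_r.
  - replace (y - x)%Z with (- (x - y))%Z by ring. now apply Z.divide_opp_r.
  - replace (x - z)%Z with ((x - y) + (y - z))%Z by ring. now apply Z.divide_add_r.
Qed.

Instance cg_add : Proper (cg ==> cg ==> cg) Z.add.
Proof.
  intros a a' Ha b b' Hb; unfold cg in *.
  replace (a + b - (a' + b'))%Z with ((a - a') + (b - b'))%Z by ring. now apply Z.divide_add_r.
Qed.

Instance cg_mul : Proper (cg ==> cg ==> cg) Z.mul.
Proof.
  intros a a' Ha b b' Hb; unfold cg in *.
  replace (a * b - a' * b')%Z with ((a - a') * b + a' * (b - b'))%Z by ring.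
  apply Z.divide_add_r; [now apply Z.divide_mul_l|now apply Z.divide_mul_r].
Qed.

Instance cg_opp : Proper (cg ==> cg) Z.opp.
Proof.
  intros a a' Ha; unfold cg in *.
  replace (- a - - a')%Z with (- (a - a'))%Z by ring. now apply Z.divide_opp_r.
Qed.

Instance cg_sub : Proper (cg ==> cg ==> cg) Z.sub.
Proof. intros a a' Ha b b' Hb. unfold Z.sub. now rewrite Ha, Hb. Qed.

Lemma cg_of_eq a b : a = b -> a == b.
Proof. intros ->. reflexivity. Qed.

Lemma cg_pw' a b n : a == b -> pw a n == pw b n.
Proof. intros H. induction n; cbn [pw]; [reflexivity|]. now apply cg_mul. Qed.

Lemma cg_sumz n f g : (forall i, i < n -> f i == g i) -> sumz n f == sumz n g.
Proof.
  induction n; cbn [sumz]; intros H; [reflexivity|]. rewrite IHn, (H n) by auto. reflexivity.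
Qed.

Definition evb (z : Z) (n : nat) (a : nat -> Z) (off : nat) : Z :=
  sumz n (fun j => a (off + j)%nat * pw z j)%Z.

(** Induction on [E]: one more shift moves the last coefficient to the front with the opposite sign,
    and this is multiplication by [z] because [z^q = -1]. *)
Lemma shift_ev q z a off E : 0 < q -> pw z q == (-1)%Z -> E <= 2 * q ->
  sumz q (fun j => sg ((j + (2 * q - E)) mod (2 * q) / q)
                   * a (off + (j + (2 * q - E)) mod (2 * q) mod q)%nat * pw z j)%Z
  == (pw z E * evb z q a off)%Z.
Proof.
  intros Hq Hz. induction E as [|E IH]; intros HE.
  - rewrite Nat.sub_0_r. cbn [pw]. rewrite Z.mul_1_l. apply cg_of_eq, sumz_ext. intros j Hj.
    replace (j + 2 * q) with (j + 1 * (2 * q)) by lia.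
    rewrite Nat.Div0.mod_add, Nat.mod_small by lia. rewrite Nat.div_small, Nat.mod_small by lia.
    rewrite ?sg_0, ?sg_1. ring.
  - cbn [pw]. rewrite <- Z.mul_assoc, <- (IH ltac:(lia)).
    set (F := fun j => (sg ((j + (2 * q - E)) mod (2 * q) / q)
                   * a (off + (j + (2 * q - E)) mod (2 * q) mod q)%nat)%Z).
    assert (exists q', q = S q') as (q' & Eq) by (exists (pred q); lia).
    match goal with |- sumz q ?G == _ =>
      replace (sumz q G) with (sumz (S q') G) by now rewrite <- Eq end.
    rewrite sumz_first.
    rewrite (cg_of_eq (z * _)%Z (sumz q' (fun j => F j * pw z (S j)) + F q' * pw z q)%Z).
    2:{ match goal with |- (z * sumz q ?G)%Z = _ =>
          replace (sumz q G) with (sumz (S q') G) by now rewrite <- Eq end.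
        replace (pw z q) with (z * pw z q')%Z by now rewrite Eq.
        cbn [sumz]. rewrite Z.mul_add_distr_l, <- sumz_scal.
        f_equal; [apply sumz_ext; intros|]; unfold F; cbn [pw]; ring. }
    rewrite Hz, Z.add_comm. apply cg_of_eq. f_equal.
    + apply sumz_ext. intros j Hj. unfold F.
      replace (S j + (2 * q - S E)) with (j + (2 * q - E)) by lia. reflexivity.
    + unfold F. cbn [pw]. rewrite Nat.add_0_l, Z.mul_1_r.
      destruct (Nat.lt_ge_cases E q) as [HEq|HEq].
      * rewrite (Nat.mod_small (2 * q - S E)) by lia.
        replace (q' + (2 * q - E)) with (q - S E + 1 * (2 * q)) by lia.
        rewrite Nat.Div0.mod_add, (Nat.mod_small (q - S E) (2 * q)) by lia.
        replace (2 * q - S E) with (1 * q + (q - S E)) by lia.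
        destruct (blk_divmod q 1 (q - S E)) as [-> ->]; [lia|].
        rewrite Nat.div_small, Nat.mod_small by lia. rewrite ?sg_0, ?sg_1. ring.
      * rewrite (Nat.mod_small (2 * q - S E)) by lia.
        rewrite (Nat.mod_small (q' + (2 * q - E))) by lia.
        replace (q' + (2 * q - E)) with (1 * q + (2 * q - S E)) by lia.
        destruct (blk_divmod q 1 (2 * q - S E)) as [-> ->]; [lia|].
        rewrite Nat.div_small, Nat.mod_small by lia. rewrite ?sg_0, ?sg_1. ring.
Qed.

Section Level.
Variables (s r p q : nat).
Hypothesis Hp : p = 2 ^ s.
Hypothesis Hq2 : q = 2 ^ r.
Hypothesis Hsr : s <= r.
Variable z : Z.
Hypothesis Hz : pw z q == (-1)%Z.

Local Notation om := (pw z (q / p)).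

Lemma p_pos : 0 < p. Proof. rewrite Hp. pose proof (Nat.pow_nonzero 2 s). lia. Qed.
Lemma q_pos : 0 < q. Proof. rewrite Hq2. pose proof (Nat.pow_nonzero 2 r). lia. Qed.

Lemma qp_eq : q / p * p = q.
Proof.
  rewrite Hp, Hq2. replace (2 ^ r) with (2 ^ (r - s) * 2 ^ s) by (rewrite <- Nat.pow_add_r; f_equal; lia).
  rewrite Nat.div_mul; auto. apply Nat.pow_nonzero; lia.
Qed.

Lemma om_p : pw om p == (-1)%Z.
Proof. rewrite <- pw_mul, qp_eq. exact Hz. Qed.

Lemma om_2p m : pw om (m * (2 * p)) == 1%Z.
Proof.
  replace (m * (2 * p)) with (p * (2 * m)) by lia. rewrite !pw_mul.
  rewrite (cg_pw' _ _ _ (cg_pw' _ _ _ om_p)). cbn [pw].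
  rewrite (cg_of_eq _ _ (pw_1 m)). reflexivity.
Qed.

(** Each row is collapsed to its value at [z]. Signed shifts then become multiplications by powers
    of [z], and a stage on arrays becomes a butterfly [stT] or [istT] on integers. *)
Definition hat (a : nat -> Z) (t : nat) : Z := evb z q a (t * q).

Definition cT (h t : nat) : Z := pw z (tw p q h t).

Definition stT (h : nat) (v : nat -> Z) (t : nat) : Z :=
  if (t / h) mod 2 =? 0 then (v t + cT h t * v (t + h)%nat)%Z
  else (v (t - h)%nat - cT h t * v t)%Z.

Definition istT (h : nat) (v : nat -> Z) (t : nat) : Z :=
  if (t / h) mod 2 =? 0 then (v t + v (t + h)%nat)%Z
  else (pw z (2 * q - tw p q h t) * (v (t - h)%nat - v t))%Z.

Lemma tw_le h t : tw p q h t <= 2 * q.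
Proof.
  unfold tw. pose proof p_pos. pose proof qp_eq.
  pose proof (rv_lt p (2 * ((t / (2 * h)) mod (p / h))) ltac:(auto)). nia.
Qed.

Lemma hat_stF h a t : 0 < h -> hat (stF p q h a) t == stT h (hat a) t.
Proof.
  intros Hh. pose proof q_pos as Hq. unfold hat at 1, evb.
  transitivity (sumz q (fun j => a ((t - (t / h) mod 2 * h) * q + j)%nat * pw z j)
    + sg ((t / h) mod 2) * sumz q (fun j =>
      sg ((j + (2 * q - tw p q h t)) mod (2 * q) / q)
      * a ((t - (t / h) mod 2 * h + h) * q + (j + (2 * q - tw p q h t)) mod (2 * q) mod q)%nat
      * pw z j))%Z.
  - rewrite <- sumz_scal, <- sumz_add. apply cg_of_eq, sumz_ext. intros j Hj.
    unfold stF. destruct (blk_divmod q t j Hj) as [-> ->]. rewrite sg_add. ring.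
  - rewrite shift_ev by (auto using tw_le).
    destruct (dec_exists h t Hh) as (B & d & i & Et & Hd & Hi).
    pose proof (dec_unique h B d i Hd Hi) as [D1 D2]. rewrite <- Et in D1, D2.
    unfold stT, hat, cT. rewrite D1.
    destruct d as [|[|]]; [| |lia]; cbn [Nat.eqb].
    + rewrite Nat.mul_0_l, Nat.sub_0_r. unfold evb. rewrite sg_0. apply cg_of_eq. ring.
    + rewrite Nat.mul_1_l. replace (t - h + h) with t by lia. apply cg_of_eq.
      unfold evb. rewrite sg_1. ring.
Qed.

Lemma hat_istF h a t : 0 < h -> hat (istF p q h a) t == istT h (hat a) t.
Proof.
  intros Hh. pose proof q_pos as Hq. unfold hat at 1.
  destruct (dec_exists h t Hh) as (B & d & i & Et & Hd & Hi).
  pose proof (dec_unique h B d i Hd Hi) as [D1 D2]. rewrite <- Et in D1, D2.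
  unfold istT. rewrite D1.
  destruct d as [|[|]]; [| |lia]; cbn [Nat.eqb].
  - unfold hat, evb. rewrite <- sumz_add. apply cg_of_eq, sumz_ext. intros j Hj.
    unfold istF. destruct (blk_divmod q t j Hj) as [-> ->]. rewrite D1.
    rewrite !Nat.mul_0_l, Nat.add_0_r, Nat.sub_0_r, (Nat.mod_small j (2 * q)) by lia.
    rewrite Nat.div_small, Nat.mod_small by lia. rewrite sg_0. ring.
  - set (b := fun k => (a ((t - h) * q + k)%nat - a (t * q + k)%nat)%Z).
    transitivity (pw z (2 * q - tw p q h t) * evb z q b 0)%Z.
    + rewrite <- shift_ev by (auto; lia). apply cg_of_eq, sumz_ext. intros j Hj.
      unfold istF. destruct (blk_divmod q t j Hj) as [-> ->]. rewrite D1.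
      pose proof (tw_le h t).
      replace (2 * q - (2 * q - tw p q h t)) with (1 * tw p q h t) by lia.
      rewrite (Nat.mul_1_l h). replace (t - h + h) with t by lia.
      unfold b. rewrite Nat.add_0_l, sg_1. ring.
    + apply cg_mul; [reflexivity|]. apply cg_of_eq. unfold hat, evb, b.
      rewrite <- Z.add_opp_r, Z.opp_eq_mul_m1, Z.mul_comm, <- sumz_scal, <- sumz_add.
      apply sumz_ext. intros. rewrite Nat.add_0_l. ring.
Qed.

Lemma stT_ext h v v' : (forall t, v t == v' t) -> forall t, stT h v t == stT h v' t.
Proof. intros H t. unfold stT. destruct (_ =? 0); now rewrite !H. Qed.

Lemma istT_ext h v v' : (forall t, v t == v' t) -> forall t, istT h v t == istT h v' t.
Proof. intros H t. unfold istT. destruct (_ =? 0); now rewrite !H. Qed.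

(** The butterflies are inverse up to the factor 2, since [z^(2q - E) z^E = (z^q)^2 = 1]. The scalar
    [k] carries the factors of the stages already undone. *)
Lemma istT_stT h k v : 0 < h -> forall t,
  istT h (fun t => k * stT h v t)%Z t == (k * 2 * v t)%Z.
Proof.
  intros Hh t. destruct (dec_exists h t Hh) as (B & d & i & Et & Hd & Hi).
  pose proof (dec_unique h B d i Hd Hi) as [D1 D2]. rewrite <- Et in D1, D2.
  unfold istT, stT. rewrite D1.
  destruct d as [|[|]]; [| |lia]; cbn [Nat.eqb].
  - destruct (dec_unique h B 1 i ltac:(lia) Hi) as [D3 D4].
    replace (B * (2 * h) + 1 * h + i) with (t + h) in D3, D4 by lia.
    rewrite D3. cbn [Nat.eqb]. replace (t + h - h) with t by lia.
    unfold cT, tw. rewrite D2, D4. apply cg_of_eq. ring.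
  - destruct (dec_unique h B 0 i ltac:(lia) Hi) as [D3 D4].
    replace (B * (2 * h) + 0 * h + i) with (t - h) in D3, D4 by lia.
    rewrite D3. cbn [Nat.eqb]. replace (t - h + h) with t by lia.
    replace (cT h (t - h)) with (cT h t) by (unfold cT, tw; now rewrite D2, D4).
    transitivity (pw z (2 * q - tw p q h t + tw p q h t) * (k * 2 * v t))%Z.
    + rewrite pw_add. unfold cT. apply cg_of_eq. ring.
    + replace (2 * q - tw p q h t + tw p q h t) with (q * 2) by (pose proof (tw_le h t); lia).
      rewrite pw_mul, (cg_pw' _ _ 2 Hz). apply cg_of_eq. cbn [pw]. ring.
Qed.

Fixpoint stagesT (t : nat) (v : nat -> Z) : nat -> Z :=
  match t with 0 => v | S t => stagesT t (stT (2 ^ t) v) end.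

Fixpoint istagesT (t : nat) (v : nat -> Z) : nat -> Z :=
  match t with 0 => v | S t => istT (2 ^ t) (istagesT t v) end.

Lemma pow2_pos t : 0 < 2 ^ t.
Proof. pose proof (Nat.pow_nonzero 2 t). lia. Qed.

Lemma stagesT_ext t : forall v v', (forall i, v i == v' i) ->
  forall i, stagesT t v i == stagesT t v' i.
Proof. induction t; cbn [stagesT]; intros v v' H i; auto. apply IHt. now apply stT_ext. Qed.

Lemma istagesT_ext t : forall v v', (forall i, v i == v' i) ->
  forall i, istagesT t v i == istagesT t v' i.
Proof. induction t; cbn [istagesT]; intros v v' H i; auto. apply istT_ext. auto. Qed.

Lemma hat_stages t : forall a i, hat (stages p q t a) i == stagesT t (hat a) i.
Proof.
  induction t; cbn [stages stagesT]; intros a i; [reflexivity|].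
  rewrite IHt. apply stagesT_ext. intros j. apply hat_stF, pow2_pos.
Qed.

Lemma hat_istages t : forall a i, hat (istages p q t a) i == istagesT t (hat a) i.
Proof.
  induction t; cbn [istages istagesT]; intros a i; [reflexivity|].
  rewrite hat_istF by apply pow2_pos. apply istT_ext. auto.
Qed.

Lemma istagesT_stagesT t : forall k v i,
  istagesT t (fun i => k * stagesT t v i)%Z i == (k * Z.of_nat (2 ^ t) * v i)%Z.
Proof.
  induction t; cbn [stagesT istagesT]; intros k v i; [apply cg_of_eq; simpl; lia|].
  rewrite (istT_ext _ _ (fun j => k * Z.of_nat (2 ^ t) * stT (2 ^ t) v j)%Z) by (intros; apply IHt).
  rewrite istT_stT by apply pow2_pos. apply cg_of_eq.
  rewrite Nat.pow_succ_r', Nat2Z.inj_mul. change (Z.of_nat 2) with 2%Z. ring.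
Qed.

(** The largest stage leaves in half [d] of a block its residue modulo
    [x^h - sg d * om^(rv p (2 b))], which the smaller stages evaluate at [X]. This is also the value
    of the whole block at [X], because [X^h] is exactly that constant. *)
Lemma stagesT_eval t : t <= S s -> forall v B j, j < 2 ^ t ->
  stagesT t v (B * 2 ^ t + j) ==
  sumz (2 ^ t) (fun i => v (B * 2 ^ t + i)%nat
                 * pw (pw om (rv p ((B * 2 ^ t + j) mod (2 * p)))) i)%Z.
Proof.
  pose proof p_pos as Hp0.
  induction t as [|t IH]; intros Ht v B j Hj.
  - cbn [stagesT]. simpl in Hj. replace j with 0 by lia. cbn [Nat.pow sumz pw]. apply cg_of_eq. ring.
  - cbn [stagesT]. rewrite Nat.pow_succ_r' in *. set (h := 2 ^ t) in *.
    assert (Hh : 0 < h) by apply pow2_pos.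
    set (d := j / h). set (j' := j mod h).
    assert (Hd : d < 2) by (apply Nat.Div0.div_lt_upper_bound; lia).
    assert (Hj' : j' < h) by (apply Nat.mod_upper_bound; lia).
    assert (Ej : j = d * h + j') by (pose proof (Nat.div_mod_eq j h); unfold d, j'; lia).
    set (be := B * (2 * h) + j).
    replace be with ((2 * B + d) * h + j') by (unfold be; lia).
    rewrite IH by (auto; lia). replace ((2 * B + d) * h + j') with be by (unfold be; lia).
    set (X := pw om (rv p (be mod (2 * p)))).
    assert (Hbm : be mod (2 * p) < 2 ^ S s).
    { rewrite Nat.pow_succ_r', <- Hp. apply Nat.mod_upper_bound; lia. }
    assert (Hph : p / h * h = p).
    { unfold h. rewrite Hp. replace (2 ^ s) with (2 ^ (s - t) * 2 ^ t)
        by (rewrite <- Nat.pow_add_r; f_equal; lia).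
      rewrite Nat.div_mul; auto. apply Nat.pow_nonzero; lia. }
    assert (Hph0 : 0 < p / h) by nia.
    set (b := B mod (p / h)).
    assert (Hb : b < p / h) by (apply Nat.mod_upper_bound; lia).
    assert (Hbe : (be mod (2 * p)) / h = 2 * b + d).
    { symmetry. apply Nat.div_unique with (r := j'); auto.
      symmetry. apply Nat.mod_unique with (q := B / (p / h)); [nia|].
      pose proof (Nat.div_mod_eq B (p / h)) as E. fold b in E. unfold be. nia. }
    (* Raising to the power [h] drops the low bits from the index of the root; the last remaining
       bit [d] contributes [om^p = -1]. *)
    assert (HX : pw X h == (sg d * pw om (rv p (2 * b)))%Z).
    { unfold X. rewrite <- pw_mul.
      destruct (rv_iter s t _ Hbm) as (m & Hm). rewrite <- Hp in Hm. fold h in Hm.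
      rewrite Nat.mul_comm, Hm, Hbe, pw_add, om_2p.
      destruct d as [|[|]]; [| |lia].
      - rewrite Nat.add_0_r, sg_0. apply cg_of_eq. ring.
      - rewrite (rv_eq p (2 * b + 1)), (rv_eq p (2 * b)).
        replace ((2 * b + 1) / 2) with b by (apply Nat.div_unique with (r := 1); lia).
        replace (2 * b / 2) with b by (apply Nat.div_unique with (r := 0); lia).
        replace ((2 * b + 1) mod 2) with 1 by (apply Nat.mod_unique with (q := b); lia).
        replace ((2 * b) mod 2) with 0 by (apply Nat.mod_unique with (q := b); lia).
        rewrite Nat.mul_1_l, Nat.mul_0_l, pw_add, Nat.add_0_r, om_p, sg_1. apply cg_of_eq. ring. }
    match goal with |- _ == sumz (2 * h) ?G =>
      replace (sumz (2 * h) G) with (sumz (h + h) G) by (f_equal; lia) end.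
    rewrite sumz_split.
    transitivity (sumz h (fun i => (v (B * (2 * h) + i)%nat * pw X i)) +
       pw X h * sumz h (fun i => v (B * (2 * h) + (h + i))%nat * pw X i))%Z.
    2:{ apply cg_of_eq. f_equal. rewrite <- sumz_scal. apply sumz_ext. intros. rewrite pw_add. ring. }
    rewrite HX, <- sumz_scal, <- sumz_add. apply cg_sumz. intros i Hi.
    destruct (dec_unique h B d i Hd Hi) as [D1 D2].
    replace (B * (2 * h) + d * h + i) with ((2 * B + d) * h + i) in D1, D2 by lia.
    unfold stT. rewrite D1. unfold cT, tw. rewrite D2. fold b.
    rewrite (Nat.mul_comm (rv p (2 * b))), pw_mul.
    destruct d as [|[|]]; [| |lia]; cbn [Nat.eqb].
    + replace ((2 * B + 0) * h + i + h) with (B * (2 * h) + (h + i)) by lia.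
      replace ((2 * B + 0) * h + i) with (B * (2 * h) + i) by lia. rewrite sg_0. apply cg_of_eq. ring.
    + replace ((2 * B + 1) * h + i - h) with (B * (2 * h) + i) by lia.
      replace ((2 * B + 1) * h + i) with (B * (2 * h) + (h + i)) by lia. rewrite sg_1. apply cg_of_eq. ring.
Qed.

Variable rho : Z.
Hypothesis Hrho : pw rho p = z.

Lemma hat_split a B i : i < 2 * p ->
  hat (splitF p q a) (B * (2 * p) + i) =
  if i <? p then sumz q (fun j => a (B * (p * q) + (i + p * j))%nat * pw z j)%Z else 0%Z.
Proof.
  intros Hi. unfold hat, evb.
  destruct (blk_divmod (2 * p) B i Hi) as [E1 E2].
  rewrite (sumz_ext q _ (fun j => if i <? p then (a (B * (p * q) + (i + p * j))%nat * pw z j)%Z else 0%Z)).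
  - destruct (i <? p); auto using sumz_zero.
  - intros j Hj. unfold splitF. destruct (blk_divmod q (B * (2 * p) + i) j Hj) as [-> ->].
    rewrite E1, E2. destruct (i <? p); [|lia]. do 2 f_equal. lia.
Qed.

Lemma hat_split_poly a B x :
  sumz (2 * p) (fun i => hat (splitF p q a) (B * (2 * p) + i) * pw x i)%Z =
  sumz p (fun i => hat (splitF p q a) (B * (2 * p) + i) * pw x i)%Z.
Proof.
  match goal with |- sumz (2 * p) ?G = _ =>
      replace (sumz (2 * p) G) with (sumz (p + p) G) by (f_equal; lia) end.
  rewrite sumz_split.
  rewrite <- Z.add_0_r. f_equal.
  etransitivity; [|apply (sumz_zero p)]. apply sumz_ext. intros i Hi.
  rewrite hat_split by lia. rewrite (proj2 (Nat.ltb_ge (p + i) p)) by lia. lia.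
Qed.

Lemma ev_split a B :
  evb rho (p * q) a (B * (p * q)) =
  sumz p (fun i => hat (splitF p q a) (B * (2 * p) + i) * pw rho i)%Z.
Proof.
  unfold evb. rewrite sumz_prod. apply sumz_ext. intros i Hi.
  rewrite hat_split by lia. rewrite (proj2 (Nat.ltb_lt i p)) by lia.
  rewrite Z.mul_comm, <- sumz_scal. apply sumz_ext. intros j Hj.
  rewrite pw_add, pw_mul, Hrho. ring.
Qed.

Lemma ev_merge a B :
  evb rho (p * q) (mergeF p q a) (B * (p * q)) ==
  sumz (2 * p) (fun i => hat a (B * (2 * p) + i) * pw rho i)%Z.
Proof.
  pose proof p_pos as Hp0. pose proof q_pos as Hq0.
  unfold evb. rewrite sumz_prod.
  transitivity (sumz p (fun i => pw rho i * (hat a (B * (2 * p) + i) + z * hat a (B * (2 * p) + (p + i))))%Z).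
  - apply cg_sumz. intros i Hi.
    transitivity (pw rho i * (hat a (B * (2 * p) + i) +
       sumz q (fun j => sg ((j + (2 * q - 1)) mod (2 * q) / q)
                   * a ((B * (2 * p) + i + p) * q + (j + (2 * q - 1)) mod (2 * q) mod q)%nat * pw z j)))%Z.
    + unfold hat, evb. rewrite <- sumz_add, <- sumz_scal. apply cg_of_eq, sumz_ext. intros j Hj.
      rewrite pw_add, pw_mul, Hrho. unfold mergeF.
      assert (i + p * j < p * q) by nia.
      destruct (blk_divmod (p * q) B (i + p * j)) as [-> ->]; [assumption|].
      replace (i + p * j) with (j * p + i) by lia.
      destruct (blk_divmod p j i Hi) as [-> ->]. ring.
    + rewrite shift_ev by (auto; lia). cbn [pw]. rewrite Z.mul_1_r.
      replace (B * (2 * p) + i + p) with (B * (2 * p) + (p + i)) by lia. reflexivity.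
  - match goal with |- _ == sumz (2 * p) ?G =>
      replace (sumz (2 * p) G) with (sumz (p + p) G) by (f_equal; lia) end.
    rewrite sumz_split, <- sumz_add.
    apply cg_of_eq, sumz_ext. intros i Hi. rewrite pw_add, Hrho. ring.
Qed.

(** Products of transformed rows are the transform of the product [v] of the row polynomials. It has
    at most [2 p] coefficients, so the inverse stages recover it up to [2 ^ S s]. Evaluation at
    [x = rho], where [rho^p = z], turns it into the product of the values of the original blocks. *)
Lemma level_step a b G k :
  (forall t, hat G t == (k * hat (stages p q (S s) (splitF p q a)) t
                           * hat (stages p q (S s) (splitF p q b)) t)%Z) ->
  forall B, evb rho (p * q) (mergeF p q (istages p q (S s) G)) (B * (p * q)) ==
  (k * Z.of_nat (2 ^ S s) * evb rho (p * q) a (B * (p * q)) * evb rho (p * q) b (B * (p * q)))%Z.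
Proof.
  intros HG B. pose proof p_pos as Hp0.
  assert (E2p : 2 ^ S s = 2 * p) by (now rewrite Nat.pow_succ_r', <- Hp).
  set (A1 := hat (splitF p q a)). set (B1 := hat (splitF p q b)).
  set (v := fun t => pconv p p (fun i => A1 (t / (2 * p) * (2 * p) + i))
                               (fun i => B1 (t / (2 * p) * (2 * p) + i)) (t mod (2 * p))).
  assert (Hv : forall B x, sumz (2 * p) (fun i => v (B * (2 * p) + i)%nat * pw x i)%Z =
     (sumz p (fun i => A1 (B * (2 * p) + i)%nat * pw x i) * sumz p (fun i => B1 (B * (2 * p) + i)%nat * pw x i))%Z).
  { intros B0 x. rewrite (pconv_eval p p (fun i => A1 (B0 * (2 * p) + i)) (fun i => B1 (B0 * (2 * p) + i)) x).
    replace (p + p) with (2 * p) by lia. apply sumz_ext. intros i Hi. unfold v.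
    destruct (blk_divmod (2 * p) B0 i Hi) as [-> ->]. reflexivity. }
  assert (HGv : forall t, hat G t == (k * stagesT (S s) v t)%Z).
  { intros t. rewrite HG, !hat_stages. fold A1 B1.
    replace t with (t / (2 * p) * 2 ^ S s + t mod (2 * p)).
    2:{ rewrite E2p. pose proof (Nat.div_mod_eq t (2 * p)). lia. }
    rewrite !stagesT_eval by (try (rewrite E2p; apply Nat.mod_upper_bound); lia).
    rewrite E2p, Hv. unfold A1, B1. rewrite !hat_split_poly. apply cg_of_eq. ring. }
  rewrite ev_merge.
  transitivity (sumz (2 * p) (fun i => (k * Z.of_nat (2 ^ S s)) * (v (B * (2 * p) + i)%nat * pw rho i))%Z).
  - apply cg_sumz. intros i Hi.
    rewrite hat_istages, (istagesT_ext _ _ _ HGv), istagesT_stagesT. apply cg_of_eq. ring.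
  - rewrite sumz_scal, Hv, !ev_split. apply cg_of_eq. fold A1 B1. ring.
Qed.

End Level.

(** All blocks are treated at once because the recursive call sees the rows as blocks of one array,
    with [z^(2^s)] in the place of [z]. As [d / 2 <= d - d / 2], [p] divides [q], and the required
    roots of unity are powers of the new point. *)
Lemma nussbaumer f : forall f' d a b z, 1 <= d <= f -> d <= f' -> pw z (2 ^ d) == (-1)%Z ->
  forall B, evb z (2 ^ d) (BW f' d (mulF (FW f d a) (FW f d b))) (B * 2 ^ d) ==
    (Z.of_nat (kap f d) * evb z (2 ^ d) a (B * 2 ^ d) * evb z (2 ^ d) b (B * 2 ^ d))%Z.
Proof.
  induction f as [|f IH]; intros f' d a b z Hd Hf' Hz B; [lia|].
  destruct f' as [|f']; [lia|]. cbn [FW BW kap].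
  destruct (Nat.leb_spec d 1) as [H1|H1].
  - replace d with 1 in * by lia. change (2 ^ 1) with 2 in *.
    unfold evb. cbn [sumz pw Z.of_nat] in *. rewrite !Z.mul_1_r in *.
    unfold mulF.
    assert (E0 : (B * 2 + 0) mod 2 = 0) by (rewrite Nat.add_0_r; apply Nat.Div0.mod_mul).
    assert (E1 : (B * 2 + 1) mod 2 = 1) by (apply (blk_divmod 2 B 1); lia).
    rewrite E0, E1. replace (B * 2 + 0 - 0) with (B * 2 + 0) by lia.
    replace (B * 2 + 0 + 1 - 0) with (B * 2 + 1) by lia.
    replace (B * 2 + 0 + 1) with (B * 2 + 1) by lia.
    replace (B * 2 + 1 - 1) with (B * 2 + 0) by lia.
    replace (B * 2 + 0 + 1 - 1) with (B * 2 + 0) by lia.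
    replace (B * 2 + 0 + 1) with (B * 2 + 1) by lia.
    change (1 - 0) with 1. change (1 - 1) with 0. rewrite sg_0, sg_1.
    set (a0 := a _). set (a1 := a (B * 2 + 1)). set (b0 := b _). set (b1 := b (B * 2 + 1)).
    transitivity (a0 * b0 + (z * z) * (a1 * b1) + (a0 * b1 + a1 * b0) * z)%Z.
    + rewrite Hz. apply cg_of_eq. ring.
    + apply cg_of_eq. change (Z.of_nat 1) with 1%Z. ring.
  - set (s := d / 2). set (r := d - s).
    assert (Hs : 1 <= s) by (apply Nat.div_le_lower_bound; lia).
    assert (Hs2 : 2 * s <= d) by (apply Nat.Div0.mul_div_le).
    assert (Epq : 2 ^ d = 2 ^ s * 2 ^ r) by (rewrite <- Nat.pow_add_r; f_equal; unfold r; lia).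
    rewrite Epq in *.
    assert (Hz' : pw (pw z (2 ^ s)) (2 ^ r) == (-1)%Z) by (rewrite <- pw_mul; exact Hz).
    rewrite (level_step s r (2 ^ s) (2 ^ r) eq_refl eq_refl ltac:(unfold r; lia) (pw z (2 ^ s)) Hz' z
      eq_refl a b _ (Z.of_nat (kap f r))).
    + apply cg_of_eq. rewrite Nat2Z.inj_mul. ring.
    + intros t. unfold hat. apply IH; auto; unfold r; lia.
Qed.

End Cong.

(** * From congruences to integer coefficients *)

Lemma sumz_abs_le n f : (Z.abs (sumz n f) <= sumz n (fun i => Z.abs (f i)))%Z.
Proof. induction n; cbn [sumz]; lia. Qed.

Lemma sumz_le n f g : (forall i, i < n -> (f i <= g i)%Z) -> (sumz n f <= sumz n g)%Z.
Proof.
  induction n; cbn [sumz]; intros H; [lia|].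
  specialize (IHn ltac:(auto)). specialize (H n ltac:(lia)). lia.
Qed.

Lemma sumz_nonneg_term n f i : (forall i, 0 <= f i)%Z -> i < n -> (f i <= sumz n f)%Z.
Proof.
  intros Hf. induction n; cbn [sumz]; intros Hi; [lia|].
  assert (0 <= sumz n f)%Z.
  { rewrite <- (sumz_zero n). apply sumz_le. auto. }
  specialize (Hf n). destruct (Nat.eq_dec i n); subst; lia.
Qed.

Lemma pw_pos z n : (0 < z)%Z -> (0 < pw z n)%Z.
Proof. intros H. induction n; cbn [pw]; nia. Qed.

Lemma pw_mono z m n : (0 < z)%Z -> m <= n -> (pw z m <= pw z n)%Z.
Proof.
  intros Hz. induction 1; [lia|]. cbn [pw]. pose proof (pw_pos z m0 Hz). nia.
Qed.

(** Uniqueness of expansions in base [z] with signed digits: the lowest digit is a multiple of [z],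
    hence zero. *)
Lemma digits_zero z n : forall f, (forall i, i < n -> (Z.abs (f i) < z)%Z) ->
  sumz n (fun i => f i * pw z i)%Z = 0%Z -> forall i, i < n -> f i = 0%Z.
Proof.
  induction n as [|n IH]; intros f Hf H i Hi; [lia|].
  rewrite sumz_first in H. cbn [pw] in H.
  rewrite (sumz_ext n _ (fun i => z * (f (S i) * pw z i))%Z) in H by (intros; ring).
  rewrite sumz_scal in H.
  assert (H0 := Hf 0 ltac:(lia)).
  set (X := sumz n _) in *.
  assert (X = 0%Z) as HX by nia.
  destruct i; [nia|]. apply (IH (fun i => f (S i))); auto; [|lia].
  intros; apply Hf; lia.
Qed.

(* Kronecker substitution: a vector of length [n] whose value at every integer
   [z] is a multiple of [z^n + 1] vanishes. *)
Lemma negacyclic_zero n f :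
  (forall z, (0 < z)%Z -> (pw z n + 1 | sumz n (fun i => f i * pw z i))%Z) ->
  forall i, i < n -> f i = 0%Z.
Proof.
  intros H i Hi.
  (* This [B] exceeds every coefficient and makes the value at [B] smaller than [B^n + 1] in
     absolute value; the value is then zero, and so are its digits. *)
  set (B := (1 + sumz n (fun i => Z.abs (f i)))%Z).
  assert (HB : forall i, i < n -> (Z.abs (f i) < B)%Z).
  { intros j Hj. unfold B.
    pose proof (sumz_nonneg_term n (fun i => Z.abs (f i)) j (fun i => Z.abs_nonneg _) Hj) as HH.
    cbn beta in HH. lia. }
  assert (HB0 : (0 < B)%Z) by (specialize (HB i Hi); lia).
  apply (digits_zero B n f HB); auto.
  specialize (H B HB0). destruct H as (m & Hm).
  assert (Habs : (Z.abs (sumz n (fun i => f i * pw B i)) < pw B n + 1)%Z).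
  { eapply Z.le_lt_trans; [apply sumz_abs_le|].
    destruct n as [|n]; [lia|].
    eapply Z.le_lt_trans; [apply (sumz_le _ _ (fun i => pw B n * Z.abs (f i))%Z)|].
    - intros j Hj. rewrite Z.abs_mul, (Z.abs_eq (pw B j)) by (pose proof (pw_pos B j HB0); lia).
      pose proof (pw_mono B j n HB0 ltac:(lia)). nia.
    - rewrite sumz_scal. change (pw B (S n)) with (B * pw B n)%Z. pose proof (pw_pos B n HB0).
      replace (sumz (S n) (fun i => Z.abs (f i))) with (B - 1)%Z by (unfold B; ring).
      clearbody B. nia. }
  pose proof (pw_pos B n HB0). rewrite Hm in *.
  assert (m = 0%Z) by nia. subst m. lia.
Qed.

(** [c] is given by its values: it is an ordinary product that fits into [2 ^ d] coefficients. The
    congruence modulo [z^(2^d) + 1] is available for every positive [z], so the coefficients agree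
    as integers; the word size has not entered yet. *)
Lemma nussbaumer_conv f f' d a b c : 1 <= d <= f -> d <= f' ->
  (forall z, evb z (2 ^ d) a 0 * evb z (2 ^ d) b 0 = evb z (2 ^ d) c 0)%Z ->
  forall g, g < 2 ^ d ->
    BW f' d (mulF (FW f d a) (FW f d b)) g = (Z.of_nat (kap f d) * c g)%Z.
Proof.
  intros Hd Hf' Hc g Hg. apply Z.sub_move_0_r.
  set (r := BW f' d (mulF (FW f d a) (FW f d b))).
  apply (negacyclic_zero (2 ^ d) (fun g => r g - Z.of_nat (kap f d) * c g)%Z); auto.
  intros z Hz.
  pose proof (nussbaumer (pw z (2 ^ d) + 1) f f' d a b z Hd Hf') as HN.
  assert (H1 : cg (pw z (2 ^ d) + 1) (pw z (2 ^ d)) (-1)).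
  { exists 1%Z. ring. }
  specialize (HN H1 0). rewrite Nat.mul_0_l, <- Z.mul_assoc, Hc in HN. fold r in HN.
  unfold cg in HN. unfold evb in HN. rewrite <- sumz_scal in HN.
  replace (sumz (2 ^ d) (fun i => (r i - Z.of_nat (kap f d) * c i) * pw z i)%Z)
    with (sumz (2 ^ d) (fun j => r (0 + j)%nat * pw z j)
          - sumz (2 ^ d) (fun i => Z.of_nat (kap f d) * (c (0 + i)%nat * pw z i)))%Z; auto.
  rewrite <- Z.add_opp_r, Z.opp_eq_mul_m1, Z.mul_comm, <- sumz_scal, <- sumz_add.
  apply sumz_ext. intros. rewrite Nat.add_0_l. ring.
Qed.

Declare Scope cmd_scope.
Delimit Scope cmd_scope with cmd.
Notation V := EVar.
Notation C := ECst.
Infix "+:" := (EBin OAdd) (at level 50, left associativity) : cmd_scope.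
Infix "-:" := (EBin OSub) (at level 50, left associativity) : cmd_scope.
Infix "*:" := (EBin OMul) (at level 40, left associativity) : cmd_scope.
Infix "/:" := (EBin ODiv) (at level 40, left associativity) : cmd_scope.
Infix "%:" := (EBin OMod) (at level 40, left associativity) : cmd_scope.
Infix "+~" := (EBin OAddW) (at level 50, left associativity) : cmd_scope.
Infix "-~" := (EBin OSubW) (at level 50, left associativity) : cmd_scope.
Infix "*~" := (EBin OMulW) (at level 40, left associativity) : cmd_scope.
Infix "<:" := (EBin OLt) (at level 70) : cmd_scope.
Infix "=:" := (EBin OEq) (at level 70) : cmd_scope.
Infix "<<:" := (EBin OShl) (at level 35) : cmd_scope.
Infix "<-" := CAsg (at level 75) : cmd_scope.
Infix ";;" := CSeq (at level 80, right associativity) : cmd_scope.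
Local Open Scope cmd_scope.

(** * The convolution program *)

(* Scalars: 13 position, 14 array size, 15 log of the block size, 16 p, 17 q,
   18 level, 19 half length h, 20 t, 21 j, 22 delta, 23 u, 24 exponent,
   25 shifted index, 26 accumulated factor, 27 p q, 28 2p.
   Arrays: 3 scratch, 12 block sizes by level, 13 radical inverses. *)
Definition p_copy (X : nat) : cmd := CFor 13 14 (CSto X (V 13) (EArr 3 (V 13))).

Definition p_etab : cmd :=
  CSto 13 (C 0) (C 0) ;;
  CFor 13 28 (CSto 13 (V 13) (EArr 13 (V 13 /: C 2) /: C 2 +: (V 13 %: C 2) *: V 16)).

Definition p_split (X : nat) : cmd :=
  CFor 13 14 (
    20 <- V 13 /: V 17 ;; 21 <- V 13 %: V 17 ;; 22 <- V 20 %: V 28 ;; 23 <- V 20 /: V 28 ;;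
    CSto 3 (V 13) ((V 22 <: V 16) *: EArr X (V 23 *: (V 16 *: V 17) +: V 22 +: V 16 *: V 21))) ;;
  p_copy X.

Definition p_locate : cmd :=
  20 <- V 13 /: V 17 ;; 21 <- V 13 %: V 17 ;; 22 <- (V 20 /: V 19) %: C 2 ;;
  23 <- V 20 -: V 22 *: V 19 ;;
  24 <- EArr 13 (C 2 *: ((V 20 /: (C 2 *: V 19)) %: (V 16 /: V 19))) *: (V 17 /: V 16).

Notation e_sg e := (C 1 -~ C 2 *: (e %: C 2)).

Definition p_stage (X : nat) : cmd :=
  CFor 13 14 (
    p_locate ;; 25 <- (V 21 +: (C 2 *: V 17 -: V 24)) %: (C 2 *: V 17) ;;
    CSto 3 (V 13) (EArr X (V 23 *: V 17 +: V 21) +~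
      e_sg (V 22 +: V 25 /: V 17) *~ EArr X ((V 23 +: V 19) *: V 17 +: V 25 %: V 17))) ;;
  p_copy X.

Definition p_istage (X : nat) : cmd :=
  CFor 13 14 (
    p_locate ;; 25 <- (V 21 +: V 22 *: V 24) %: (C 2 *: V 17) ;;
    CSto 3 (V 13) (e_sg (V 25 /: V 17) *~ (EArr X (V 23 *: V 17 +: V 25 %: V 17) +~
      e_sg (V 22) *~ EArr X ((V 23 +: V 19) *: V 17 +: V 25 %: V 17)))) ;;
  p_copy X.

Definition p_merge (X : nat) : cmd :=
  CFor 13 14 (
    23 <- V 13 /: V 27 ;; 24 <- V 13 %: V 27 ;; 22 <- V 24 %: V 16 ;; 21 <- V 24 /: V 16 ;;
    25 <- (V 21 +: (C 2 *: V 17 -: C 1)) %: (C 2 *: V 17) ;;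
    CSto 3 (V 13) (EArr X ((V 23 *: V 28 +: V 22) *: V 17 +: V 21) +~
      e_sg (V 25 /: V 17) *~ EArr X ((V 23 *: V 28 +: V 22 +: V 16) *: V 17 +: V 25 %: V 17))) ;;
  p_copy X.

Definition p_base (X Y : nat) : cmd :=
  CFor 13 14 (
    22 <- V 13 %: C 2 ;; 20 <- V 13 -: V 22 ;;
    CSto 3 (V 13) (EArr X (V 20) *~ EArr Y (V 13) +~
      e_sg (C 1 -: V 22) *~ (EArr X (V 20 +: C 1) *~ EArr Y (V 20 +: C 1 -: V 22)))) ;;
  p_copy X.

Definition p_stages (X : nat) : cmd :=
  19 <- V 16 ;; CWhile (C 0 <: V 19) (p_stage X ;; 19 <- V 19 /: C 2).

Definition p_istages (X : nat) : cmd :=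
  19 <- C 1 ;; CWhile (V 19 <: V 28) (p_istage X ;; 19 <- V 19 *: C 2).

Definition p_params : cmd :=
  16 <- C 1 <<: (V 15 /: C 2) ;; 17 <- C 1 <<: (V 15 -: V 15 /: C 2) ;; 28 <- C 2 *: V 16.

(** [FW] calls itself once, on the whole array, so its recursion is a loop. Array 12 keeps the block
    sizes for the way back. *)
Definition p_fwd (X : nat) : cmd :=
  15 <- V 11 ;; 18 <- C 0 ;; 14 <- V 10 ;; 26 <- C 1 ;;
  CWhile (C 1 <: V 15) (
    CSto 12 (V 18) (V 15) ;; 18 <- V 18 +: C 1 ;; p_params ;;
    14 <- C 2 *: V 14 ;; 26 <- V 26 *: V 28 ;;
    p_split X ;; p_etab ;; p_stages X ;; 15 <- V 15 -: V 15 /: C 2).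

Definition p_bwd (X : nat) : cmd :=
  CWhile (C 0 <: V 18) (
    18 <- V 18 -: C 1 ;; 15 <- EArr 12 (V 18) ;; p_params ;; 27 <- V 16 *: V 17 ;;
    p_etab ;; p_istages X ;; 14 <- V 14 /: C 2 ;; p_merge X).

Definition p_mul : cmd :=
  p_fwd 9 ;; p_fwd 10 ;; p_base 9 10 ;; p_bwd 9 ;;
  CFor 13 10 (CSto 9 (V 13) (EArr 9 (V 13) /: V 26)).

Fixpoint dch (d i : nat) : nat :=
  match i with 0 => d | S i => dch d i - dch d i / 2 end.

Fixpoint nlev (f d : nat) : nat :=
  match f with 0 => 0 | S f => if d <=? 1 then 0 else S (nlev f (d - d / 2)) end.

(** The word [x] represents the integer [z], possibly negative, modulo [2 ^ w]. *)
Definition cw (w x : nat) (z : Z) : Prop := Z.of_nat x = (z mod 2 ^ Z.of_nat w)%Z.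

(** * Machine words as residues *)

Section Words.
Variable w : nat.

Lemma two_w : Z.of_nat (2 ^ w) = (2 ^ Z.of_nat w)%Z.
Proof. rewrite Nat2Z.inj_pow. reflexivity. Qed.

Lemma two_w_pos : (0 < 2 ^ Z.of_nat w)%Z.
Proof. apply Z.pow_pos_nonneg; lia. Qed.

Lemma cw_lt x z : cw w x z -> x < 2 ^ w.
Proof.
  unfold cw. intros H. pose proof (Z.mod_pos_bound z _ two_w_pos).
  apply Nat2Z.inj_lt. rewrite two_w. lia.
Qed.

Lemma cw_add x y a b : cw w x a -> cw w y b -> cw w ((x + y) mod 2 ^ w) (a + b).
Proof.
  unfold cw. intros Ha Hb. rewrite Nat2Z.inj_mod, two_w, Nat2Z.inj_add, Ha, Hb.
  symmetry. apply Zplus_mod.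
Qed.

Lemma cw_mul x y a b : cw w x a -> cw w y b -> cw w ((x * y) mod 2 ^ w) (a * b).
Proof.
  unfold cw. intros Ha Hb. rewrite Nat2Z.inj_mod, two_w, Nat2Z.inj_mul, Ha, Hb.
  symmetry. apply Zmult_mod.
Qed.

Lemma cw_sub x y a b : cw w x a -> cw w y b -> cw w ((x + (2 ^ w - y)) mod 2 ^ w) (a - b).
Proof.
  intros Ha Hb. pose proof (cw_lt _ _ Hb) as Hy. unfold cw in *.
  rewrite Nat2Z.inj_mod, Nat2Z.inj_add, Nat2Z.inj_sub, two_w, Ha, Hb by lia.
  rewrite (Zminus_mod a b).
  replace (a mod 2 ^ Z.of_nat w + (2 ^ Z.of_nat w - b mod 2 ^ Z.of_nat w))%Z
    with (a mod 2 ^ Z.of_nat w - b mod 2 ^ Z.of_nat w + 1 * 2 ^ Z.of_nat w)%Z by ring.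
  apply Z_mod_plus_full.
Qed.

Lemma cw_const x : x < 2 ^ w -> cw w x (Z.of_nat x).
Proof.
  intros H. unfold cw. symmetry. apply Z.mod_small. split; [lia|].
  rewrite <- two_w. lia.
Qed.

Lemma cw_sg b : 80 < 2 ^ w -> cw w ((1 + (2 ^ w - 2 * (b mod 2))) mod 2 ^ w) (sg b).
Proof.
  intros HW. unfold sg. apply cw_sub; [apply (cw_const 1); lia|].
  pose proof (Nat.mod_upper_bound b 2 ltac:(lia)).
  replace (2 * Z.of_nat (b mod 2))%Z with (Z.of_nat (2 * (b mod 2))) by lia.
  apply cw_const. lia.
Qed.

Lemma cw_val x z : cw w x z -> (0 <= z < Z.of_nat (2 ^ w))%Z -> Z.of_nat x = z.
Proof. unfold cw. intros H Hz. rewrite H. apply Z.mod_small. rewrite <- two_w. lia. Qed.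

End Words.

Definition AW (w : nat) (X : nat -> nat) (a : nat -> Z) (n : nat) : Prop :=
  forall g, g < n -> cw w (X g) (a g).

(** * Correctness and cost of the convolution program *)

Section Conv.
Variables (w : nat) (inp : list nat).

Definition lenv (p q sz : nat) (s : state) : Prop :=
  va s 14 = sz /\ va s 16 = p /\ va s 17 = q /\ va s 28 = 2 * p.

Lemma wp_copy X s sz a : 80 + 64 * sz < 2 ^ w -> X < 3 \/ 3 < X -> va s 14 = sz ->
  AW w (ar s 3) a sz ->
  wp w inp (p_copy X) s (fun s' => AW w (ar s' X) a sz /\ ck s' <= ck s + 30 * sz + 6).
Proof.
  intros HW HX Hsz HA. unfold p_copy.
  apply wp_tab with (a := X) (K := 20) (N := sz) (f := ar s 3); auto; try lia.
  - intros i s' Hi F Hx.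
    assert (E3 : ar s' 3 = ar s 3).
    { apply F. cbn [ma CFor]. destruct (Nat.eqb_spec 3 X); [lia|reflexivity]. }
    apply wp_sto; ev; rewrite ?Hx; repeat split; auto; try lia.
    + unfold aset. rewrite Nat.eqb_refl. now rewrite E3.
    + cbn [ecost]. lia.
  - intros s' F HX' Hc. split; [|lia]. intros g Hg. rewrite HX'; auto.
Qed.

(** The array consists of [m] groups of [2 h] rows, which keeps row [u + h] inside. Once the indices
    are bounded, the claim is the definition of [stF] read modulo [2 ^ w]. *)
Lemma wp_stage X s sz a p q h m :
  80 + 64 * sz < 2 ^ w -> X < 3 \/ 3 < X < 13 -> lenv p q sz s -> va s 19 = h ->
  0 < h -> 0 < p -> 0 < q -> sz = m * (2 * h) * q -> (exists m', p = m' * h) -> (exists m', q = m' * p) -> 2 * p * q <= sz ->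
  (forall b, b < 2 * p -> ar s 13 b = rv p b) ->
  AW w (ar s X) a sz ->
  wp w inp (p_stage X) s (fun s' => AW w (ar s' X) (stF p q h a) sz /\ ck s' <= ck s + 150 * sz + 20).
Proof.
  intros HW HX (H14 & H16 & H17 & H28) H19 Hh Hp Hq Hsz (m1 & Hm1) (m2 & Hm2) Hpq He HA.
  unfold p_stage. apply wp_seq.
  assert (HX3 : Nat.eqb X 3 = false) by (apply Nat.eqb_neq; lia).
  set (u := fun g => g / q - (g / q / h) mod 2 * h).
  set (jj := fun g => (g mod q + (2 * q - tw p q h (g / q))) mod (2 * q)).
  apply wp_tab with (a := 3) (K := 110) (N := sz)
    (f := fun g => (ar s X (u g * q + g mod q) +
            ((1 + (2 ^ w - 2 * ((((g / q / h) mod 2) + jj g / q) mod 2))) mod 2 ^ w *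
             ar s X ((u g + h) * q + jj g mod q)) mod 2 ^ w) mod 2 ^ w); auto; try lia.
  - intros i s' Hi F H13. carry F.
    assert (EX : ar s' X = ar s X).
    { apply F. cbn. now rewrite HX3. }
    arrs F 13.
    assert (Ht : i / q < m * (2 * h)) by (apply Nat.Div0.div_lt_upper_bound; lia).
    assert (Hj : i mod q < q) by (apply Nat.mod_upper_bound; lia).
    destruct (dec_exists h (i / q) Hh) as (B & d & i0 & Et & Hd & Hi0).
    destruct (dec_unique h B d i0 Hd Hi0) as [D1 D2]. rewrite <- Et in D1, D2.
    assert (HB : B < m) by (clear - Et Ht Hi0; nia).
    assert (Hqsz : 2 * q <= sz) by (clear - Hpq Hp; nia).
    assert (Hpsz : 2 * p <= sz) by (clear - Hpq Hq; nia).
    assert (Htsz : i / q < sz) by (apply (Nat.lt_le_trans _ _ _ Ht); rewrite Hsz; clear - Hq; nia).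
    pose proof (rv_lt p (2 * ((i / q / (2 * h)) mod (p / h))) Hp) as Hrv.
    assert (Hb : (i / q / (2 * h)) mod (p / h) < p / h).
    { apply Nat.mod_upper_bound. rewrite Hm1, Nat.div_mul by lia. nia. }
    assert (Hbp : p / h <= p) by (apply Nat.Div0.div_le_upper_bound; clear - Hh; nia).
    assert (Hqp : q / p = m2) by (rewrite Hm2, Nat.div_mul by lia; reflexivity).
    assert (HE : tw p q h (i / q) <= 2 * q) by (unfold tw; rewrite Hqp; clear - Hrv Hm2; nia).
    unfold p_locate.
    apply wp_seq. asg t Et'. asg j Ej. asg dd Edd.
    rewrite <- Et' in *. rewrite D1 in Edd. subst dd.
    asg uu Eu.
    rewrite <- ?Et' in *.
    assert (Hh2 : 2 * h <= sz) by (destruct m1; lia).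
    asg E EE.
    { rewrite He by lia. rewrite Hqp. unfold tw in HE. rewrite Hqp in HE. lia. }
    rewrite He in EE by lia. fold (tw p q h t) in EE. rewrite <- EE in HE.
    asg jv Ejv.
    assert (Huq : (uu + h) * q + q <= sz).
    { transitivity ((uu + h + 1) * q); [lia|]. rewrite Hsz. apply Nat.mul_le_mono_r.
      replace uu with (B * (2 * h) + i0) by lia. clear - Hi0 HB. nia. }
    assert (Hjj : jv < 2 * q) by (subst jv; apply Nat.mod_upper_bound; lia).
    assert (Hjq : jv mod q < q) by (apply Nat.mod_upper_bound; lia).
    assert (Hjd : jv / q < 2) by (apply Nat.Div0.div_lt_upper_bound; lia).
    pose proof (Nat.mod_upper_bound (d + jv / q) 2 ltac:(lia)) as Hm2'.
    apply wp_sto; ev; known; rewrite ?EX.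
    + auto.
    + repeat split; auto; try lia.
    + lia.
    + split; [|cbn [ecost bcost]; lia].
      unfold u, jj. rewrite <- !Et', <- ?Ej, D1, <- EE, <- Ejv, <- Eu. reflexivity.
  - intros s' F HY Hc. carry F. eapply wp_conseq; [apply (wp_copy X s' sz (stF p q h a)); auto; try lia|].
    + intros g Hg. rewrite HY by auto. unfold stF. fold (u g).
      assert (Ht : g / q < m * (2 * h)) by (apply Nat.Div0.div_lt_upper_bound; lia).
      assert (Hj : g mod q < q) by (apply Nat.mod_upper_bound; lia).
      destruct (dec_exists h (g / q) Hh) as (B & d & i0 & Et & Hd & Hi0).
      destruct (dec_unique h B d i0 Hd Hi0) as [D1 D2]. rewrite <- Et in D1, D2.
      assert (HB : B < m) by (clear - Et Ht Hi0; nia).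
      assert (Huq : (u g + h) * q + q <= sz).
      { transitivity ((u g + h + 1) * q); [lia|]. rewrite Hsz. apply Nat.mul_le_mono_r.
        unfold u. rewrite D1. replace (g / q - d * h) with (B * (2 * h) + i0) by lia. clear - Hi0 HB. nia. }
      assert (Hjq : jj g mod q < q) by (apply Nat.mod_upper_bound; lia).
      apply cw_add; [apply HA; lia|]. apply cw_mul; [apply cw_sg; lia|]. apply HA. unfold jj in *. lia.
    + intros s'' [A1 A2]. split; auto. lia.
Qed.

Lemma wp_istage X s sz a p q h m :
  80 + 64 * sz < 2 ^ w -> X < 3 \/ 3 < X < 13 -> lenv p q sz s -> va s 19 = h ->
  0 < h -> 0 < p -> 0 < q -> sz = m * (2 * h) * q -> (exists m', p = m' * h) -> (exists m', q = m' * p) -> 2 * p * q <= sz ->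
  (forall b, b < 2 * p -> ar s 13 b = rv p b) ->
  AW w (ar s X) a sz ->
  wp w inp (p_istage X) s (fun s' => AW w (ar s' X) (istF p q h a) sz /\ ck s' <= ck s + 150 * sz + 20).
Proof.
  intros HW HX (H14 & H16 & H17 & H28) H19 Hh Hp Hq Hsz (m1 & Hm1) (m2 & Hm2) Hpq He HA.
  unfold p_istage. apply wp_seq.
  assert (HX3 : Nat.eqb X 3 = false) by (apply Nat.eqb_neq; lia).
  set (u := fun g => g / q - (g / q / h) mod 2 * h).
  set (jj := fun g => (g mod q + (g / q / h) mod 2 * tw p q h (g / q)) mod (2 * q)).
  apply wp_tab with (a := 3) (K := 110) (N := sz)
    (f := fun g => ((1 + (2 ^ w - 2 * ((jj g / q) mod 2))) mod 2 ^ w *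
      ((ar s X (u g * q + jj g mod q) +
            ((1 + (2 ^ w - 2 * (((g / q / h) mod 2) mod 2))) mod 2 ^ w *
             ar s X ((u g + h) * q + jj g mod q)) mod 2 ^ w) mod 2 ^ w)) mod 2 ^ w); auto; try lia.
  - intros i s' Hi F H13. carry F.
    assert (EX : ar s' X = ar s X).
    { apply F. cbn. now rewrite HX3. }
    arrs F 13.
    assert (Ht : i / q < m * (2 * h)) by (apply Nat.Div0.div_lt_upper_bound; lia).
    assert (Hj : i mod q < q) by (apply Nat.mod_upper_bound; lia).
    destruct (dec_exists h (i / q) Hh) as (B & d & i0 & Et & Hd & Hi0).
    destruct (dec_unique h B d i0 Hd Hi0) as [D1 D2]. rewrite <- Et in D1, D2.
    assert (HB : B < m) by (clear - Et Ht Hi0; nia).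
    assert (Hqsz : 2 * q <= sz) by (clear - Hpq Hp; nia).
    assert (Hpsz : 2 * p <= sz) by (clear - Hpq Hq; nia).
    assert (Htsz : i / q < sz) by (apply (Nat.lt_le_trans _ _ _ Ht); rewrite Hsz; clear - Hq; nia).
    pose proof (rv_lt p (2 * ((i / q / (2 * h)) mod (p / h))) Hp) as Hrv.
    assert (Hb : (i / q / (2 * h)) mod (p / h) < p / h).
    { apply Nat.mod_upper_bound. rewrite Hm1, Nat.div_mul by lia. nia. }
    assert (Hbp : p / h <= p) by (apply Nat.Div0.div_le_upper_bound; clear - Hh; nia).
    assert (Hqp : q / p = m2) by (rewrite Hm2, Nat.div_mul by lia; reflexivity).
    assert (HE : tw p q h (i / q) <= 2 * q) by (unfold tw; rewrite Hqp; clear - Hrv Hm2; nia).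
    unfold p_locate.
    apply wp_seq. asg t Et'. asg j Ej. asg dd Edd.
    rewrite <- Et' in *. rewrite D1 in Edd. subst dd.
    asg uu Eu.
    rewrite <- ?Et' in *.
    assert (Hh2 : 2 * h <= sz) by (destruct m1; lia).
    asg E EE.
    { rewrite He by lia. rewrite Hqp. unfold tw in HE. rewrite Hqp in HE. lia. }
    rewrite He in EE by lia. fold (tw p q h t) in EE. rewrite <- EE in HE.
    assert (HdE : d * E <= E) by (clear - Hd; destruct d as [|[|]]; lia).
    asg jv Ejv.
    assert (Huq : (uu + h) * q + q <= sz).
    { transitivity ((uu + h + 1) * q); [lia|]. rewrite Hsz. apply Nat.mul_le_mono_r.
      replace uu with (B * (2 * h) + i0) by lia. clear - Hi0 HB. nia. }
    assert (Hjj : jv < 2 * q) by (subst jv; apply Nat.mod_upper_bound; lia).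
    assert (Hjq : jv mod q < q) by (apply Nat.mod_upper_bound; lia).
    assert (Hjd : jv / q < 2) by (apply Nat.Div0.div_lt_upper_bound; lia).
    pose proof (Nat.mod_upper_bound (jv / q) 2 ltac:(lia)) as Hm2'.
    pose proof (Nat.mod_upper_bound d 2 ltac:(lia)) as Hm3'.
    apply wp_sto; ev; known; rewrite ?EX.
    + auto.
    + repeat split; auto; try lia.
    + lia.
    + split; [|cbn [ecost bcost]; lia].
      unfold u, jj. rewrite <- !Et', <- ?Ej, D1, <- EE, <- Ejv, <- Eu. reflexivity.
  - intros s' F HY Hc. carry F. eapply wp_conseq; [apply (wp_copy X s' sz (istF p q h a)); auto; try lia|].
    + intros g Hg. rewrite HY by auto. unfold istF. fold (u g). fold (jj g).
      assert (Ht : g / q < m * (2 * h)) by (apply Nat.Div0.div_lt_upper_bound; lia).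
      assert (Hj : g mod q < q) by (apply Nat.mod_upper_bound; lia).
      destruct (dec_exists h (g / q) Hh) as (B & d & i0 & Et & Hd & Hi0).
      destruct (dec_unique h B d i0 Hd Hi0) as [D1 D2]. rewrite <- Et in D1, D2.
      assert (HB : B < m) by (clear - Et Ht Hi0; nia).
      assert (Huq : (u g + h) * q + q <= sz).
      { transitivity ((u g + h + 1) * q); [lia|]. rewrite Hsz. apply Nat.mul_le_mono_r.
        unfold u. rewrite D1. replace (g / q - d * h) with (B * (2 * h) + i0) by lia. clear - Hi0 HB. nia. }
      assert (Hjq : jj g mod q < q) by (apply Nat.mod_upper_bound; lia).
      apply cw_mul; [apply cw_sg; lia|].
      apply cw_add; [apply HA; lia|]. apply cw_mul; [apply cw_sg; lia|]. apply HA. lia.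
    + intros s'' [A1 A2]. split; auto. lia.
Qed.

Lemma wp_split X s sz a p q m :
  80 + 64 * (2 * sz) < 2 ^ w -> X < 3 \/ 3 < X < 13 -> lenv p q (2 * sz) s ->
  0 < p -> 0 < q -> sz = m * (p * q) -> AW w (ar s X) a sz ->
  wp w inp (p_split X) s (fun s' => AW w (ar s' X) (splitF p q a) (2 * sz) /\
    ck s' <= ck s + 120 * (2 * sz) + 20).
Proof.
  intros HW HX (H14 & H16 & H17 & H28) Hp Hq Hsz HA.
  unfold p_split. apply wp_seq.
  assert (HX3 : Nat.eqb X 3 = false) by (apply Nat.eqb_neq; lia).
  assert (Hbnd : forall g, g < 2 * sz -> g / q / (2 * p) * (p * q) + p * q <= sz /\
            (g / q) mod (2 * p) < 2 * p /\ p * (g mod q) + p <= p * q /\ g / q <= 2 * sz).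
  { intros g Hg. rewrite Hsz in *.
    assert (Ht : g / q < m * (2 * p)) by (apply Nat.Div0.div_lt_upper_bound; lia).
    assert (HB : g / q / (2 * p) < m) by (apply Nat.Div0.div_lt_upper_bound; lia).
    assert (Hj : g mod q < q) by (apply Nat.mod_upper_bound; lia).
    repeat split.
    - clear - HB. nia.
    - apply Nat.mod_upper_bound; lia.
    - clear - Hj. nia.
    - clear - Ht Hq. nia. }
  apply wp_tab with (a := 3) (K := 80) (N := 2 * sz)
    (f := fun g => (if (g / q) mod (2 * p) <? p then 1 else 0) *
            ar s X (g / q / (2 * p) * (p * q) + (g / q) mod (2 * p) + p * (g mod q))); auto; try lia.
  - intros i s' Hi F H13. carry F.
    assert (EX : ar s' X = ar s X). { apply F. cbn. now rewrite HX3. }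
    destruct (Hbnd i Hi) as (B1 & B2 & B3 & B4).
    asg t Et. rewrite <- Et in *. asg j Ej. rewrite <- Ej in *. asg i0 Ei. rewrite <- Ei in *.
    asg B EB. rewrite <- EB in *.
    apply wp_sto; ev; known; rewrite ?EX.
    + auto.
    + repeat split; auto; try lia.
      destruct (Nat.ltb_spec i0 p); [|lia]. rewrite Nat.mul_1_l.
      eapply cw_lt, HA. lia.
    + lia.
    + split; [reflexivity|cbn [ecost bcost]; lia].
  - intros s' F HY Hc. carry F.
    eapply wp_conseq; [apply (wp_copy X s' (2 * sz) (splitF p q a)); auto; try lia|].
    + intros g Hg. rewrite HY by auto. unfold splitF.
      destruct (Hbnd g Hg) as (B1 & B2 & B3 & B4).
      destruct (Nat.ltb_spec ((g / q) mod (2 * p)) p).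
      * rewrite Nat.mul_1_l. apply HA. lia.
      * rewrite Nat.mul_0_l. apply (cw_const w 0). lia.
    + intros s'' [A1 A2]. split; auto. lia.
Qed.

Lemma wp_merge X s sz a p q m :
  80 + 64 * (2 * sz) < 2 ^ w -> X < 3 \/ 3 < X < 13 -> lenv p q sz s -> va s 27 = p * q ->
  0 < p -> 0 < q -> sz = m * (p * q) -> AW w (ar s X) a (2 * sz) ->
  wp w inp (p_merge X) s (fun s' => AW w (ar s' X) (mergeF p q a) sz /\
    ck s' <= ck s + 150 * sz + 20).
Proof.
  intros HW HX (H14 & H16 & H17 & H28) H27 Hp Hq Hsz HA.
  unfold p_merge. apply wp_seq.
  assert (HX3 : Nat.eqb X 3 = false) by (apply Nat.eqb_neq; lia).
  set (jj := fun g => (g mod (p * q) / p + (2 * q - 1)) mod (2 * q)).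
  assert (Hbnd : forall g, g < sz ->
     (g / (p * q) * (2 * p) + g mod (p * q) mod p + p) * q + q <= 2 * sz /\
     g mod (p * q) / p < q /\ jj g < 2 * q /\ jj g mod q < q /\ g / (p * q) * (2 * p) + g mod (p * q) mod p + p <= 2 * sz /\ 2 * q <= 2 * sz /\ 2 * p <= 2 * sz).
  { intros g Hg. rewrite Hsz in *.
    assert (HB : g / (p * q) < m) by (apply Nat.Div0.div_lt_upper_bound; lia).
    assert (Hi : g mod (p * q) mod p < p) by (apply Nat.mod_upper_bound; lia).
    assert (Hpq : 0 < p * q) by (clear - Hp Hq; nia).
    assert (Hm : p * q <= m * (p * q)) by (clear - HB; nia).
    repeat split.
    - transitivity (m * (2 * p) * q); [|lia].
      transitivity ((g / (p * q) * (2 * p) + g mod (p * q) mod p + p + 1) * q); [lia|].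
      apply Nat.mul_le_mono_r. clear - HB Hi. nia.
    - apply Nat.Div0.div_lt_upper_bound. apply Nat.mod_upper_bound. lia.
    - apply Nat.mod_upper_bound. lia.
    - apply Nat.mod_upper_bound. lia.
    - transitivity (m * (2 * p) * q); [|lia]. transitivity (m * (2 * p)); [|clear - Hq; nia].
      clear - HB Hi. nia.
    - transitivity (2 * (p * q)); [clear - Hp; nia|lia].
    - transitivity (2 * (p * q)); [clear - Hq; nia|lia]. }
  apply wp_tab with (a := 3) (K := 110) (N := sz)
    (f := fun g => (ar s X ((g / (p * q) * (2 * p) + g mod (p * q) mod p) * q + g mod (p * q) / p) +
            ((1 + (2 ^ w - 2 * ((jj g / q) mod 2))) mod 2 ^ w *
             ar s X ((g / (p * q) * (2 * p) + g mod (p * q) mod p + p) * q + jj g mod q)) mod 2 ^ w) mod 2 ^ w);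
    auto; try lia.
  - intros i s' Hi F H13. carry F.
    assert (EX : ar s' X = ar s X). { apply F. cbn. now rewrite HX3. }
    destruct (Hbnd i Hi) as (B1 & B2 & B3 & B4 & B5 & B6 & B7). unfold jj in *.
    asg B EB. rewrite <- EB in *. asg r Er. rewrite <- Er in *.
    asg i0 Ei. rewrite <- Ei in *. asg j Ej. rewrite <- Ej in *.
    asg jv Ejv. rewrite <- Ejv in *.
    pose proof (Nat.mod_upper_bound (jv / q) 2 ltac:(lia)) as Hm2'.
    apply wp_sto; ev; known; rewrite ?EX.
    + auto.
    + repeat split; auto; try lia.
    + lia.
    + split; [reflexivity|cbn [ecost bcost]; lia].
  - intros s' F HY Hc. carry F.
    eapply wp_conseq; [apply (wp_copy X s' sz (mergeF p q a)); auto; try lia|].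
    + intros g Hg. rewrite HY by auto. unfold mergeF. fold (jj g).
      destruct (Hbnd g Hg) as (B1 & B2 & B3 & B4 & B5 & B6 & B7).
      apply cw_add; [apply HA; lia|]. apply cw_mul; [apply cw_sg; lia|]. apply HA. lia.
    + intros s'' [A1 A2]. split; auto. lia.
Qed.

Lemma wp_base X Y s sz a b m :
  80 + 64 * sz < 2 ^ w -> X < 3 \/ 3 < X < 13 -> Y < 3 \/ 3 < Y < 13 -> va s 14 = sz ->
  sz = m * 2 -> AW w (ar s X) a sz -> AW w (ar s Y) b sz ->
  wp w inp (p_base X Y) s (fun s' => AW w (ar s' X) (mulF a b) sz /\
    ck s' <= ck s + 150 * sz + 20).
Proof.
  intros HW HX HY H14 Hsz HA HB.
  unfold p_base. apply wp_seq.
  assert (HX3 : Nat.eqb X 3 = false) by (apply Nat.eqb_neq; lia).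
  assert (HY3 : Nat.eqb Y 3 = false) by (apply Nat.eqb_neq; lia).
  assert (Hbnd : forall g, g < sz -> g mod 2 < 2 /\ g mod 2 <= g /\ g - g mod 2 + 1 < sz).
  { intros g Hg. pose proof (Nat.div_mod_eq g 2). pose proof (Nat.mod_upper_bound g 2 ltac:(lia)). lia. }
  apply wp_tab with (a := 3) (K := 110) (N := sz)
    (f := fun g => ((ar s X (g - g mod 2) * ar s Y g) mod 2 ^ w +
            ((1 + (2 ^ w - 2 * ((1 - g mod 2) mod 2))) mod 2 ^ w *
             ((ar s X (g - g mod 2 + 1) * ar s Y (g - g mod 2 + 1 - g mod 2)) mod 2 ^ w)) mod 2 ^ w) mod 2 ^ w);
    auto; try lia.
  - intros i s' Hi F H13. carry F.
    assert (EX : ar s' X = ar s X). { apply F. cbn. now rewrite HX3. }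
    assert (EY : ar s' Y = ar s Y). { apply F. cbn. now rewrite HY3. }
    destruct (Hbnd i Hi) as (B1 & B2 & B3).
    asg d Ed. rewrite <- Ed in *. asg u Eu. rewrite <- Eu in *.
    pose proof (Nat.mod_upper_bound (1 - d) 2 ltac:(lia)) as Hm2'.
    apply wp_sto; ev; known; rewrite ?EX, ?EY.
    + auto.
    + repeat split; auto; try lia.
    + lia.
    + split; [reflexivity|cbn [ecost bcost]; lia].
  - intros s' F HYY Hc. carry F.
    eapply wp_conseq; [apply (wp_copy X s' sz (mulF a b)); auto; try lia|].
    + intros g Hg. rewrite HYY by auto. unfold mulF.
      destruct (Hbnd g Hg) as (B1 & B2 & B3).
      apply cw_add; [apply cw_mul; [apply HA|apply HB]; lia|].
      apply cw_mul; [apply cw_sg; lia|]. apply cw_mul; [apply HA|apply HB]; lia.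
    + intros s'' [A1 A2]. split; auto. lia.
Qed.

Lemma wp_etab s p : 80 + 64 * (2 * p) < 2 ^ w -> 0 < p -> va s 16 = p -> va s 28 = 2 * p ->
  wp w inp p_etab s (fun s' => (forall b, b < 2 * p -> ar s' 13 b = rv p b) /\
    ck s' <= ck s + 40 * (2 * p) + 20).
Proof.
  intros HW Hp H16 H28. unfold p_etab. apply wp_seq, wp_sto; ev; try lia.
  apply wp_for with (K := 30) (N := 2 * p)
    (I := fun i s' => ar s' 13 0 = 0 /\ forall b, b < i -> ar s' 13 b = rv p b); auto; try lia.
  - split; [reflexivity|lia].
  - intros i s' Hi F (I0 & I1) H13. carry F. cbn [va] in *.
    assert (Hi2 : i / 2 <= i) by (apply Nat.Div0.div_le_upper_bound; lia).
    assert (E2 : ar s' 13 (i / 2) = rv p (i / 2)).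
    { destruct i; [exact I0|]. apply I1. apply Nat.div_lt; lia. }
    assert (H16' : va s' 16 = p) by (rewrite (proj1 F 16 eq_refl); exact H16).
    pose proof (rv_lt p i Hp) as Hr. rewrite rv_eq in Hr.
    assert (Hi3 : i mod 2 < 2) by (apply Nat.mod_upper_bound; lia).
    assert (Hi4 : i mod 2 * p <= 2 * p) by (clear - Hi3; nia).
    apply wp_sto; ev; known; rewrite ?E2; repeat split; auto; try lia.
    + destruct (Nat.eq_dec i 0) as [->|Hi0].
      * rewrite wr_eq, <- (rv_eq p 0). reflexivity.
      * rewrite wr_neq by lia. exact I0.
    + intros b Hb. unfold wr, upd. destruct (Nat.eqb_spec b i) as [->|Hbi].
      * now rewrite (rv_eq p i).
      * apply I1. lia.
    + cbn [ecost bcost]. lia.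
  - intros s' F (I0 & I1) H13 Hc. split; auto. cbn [ck ecost bcost] in Hc. lia.
Qed.

Lemma pow2_gt0 t : 0 < 2 ^ t.
Proof. apply Nat.neq_0_lt_0, Nat.pow_nonzero. lia. Qed.

Lemma pow2_le a b : a <= b -> 2 ^ a <= 2 ^ b.
Proof. apply Nat.pow_le_mono_r. lia. Qed.

Lemma wp_stages X s sz a p q t0 r m :
  80 + 64 * sz < 2 ^ w -> X < 3 \/ 3 < X < 13 -> lenv p q sz s ->
  p = 2 ^ t0 -> q = 2 ^ r -> t0 <= r -> 0 < m -> sz = m * (2 * p) * q ->
  (forall b, b < 2 * p -> ar s 13 b = rv p b) -> AW w (ar s X) a sz ->
  wp w inp (p_stages X) s (fun s' => AW w (ar s' X) (stages p q (S t0) a) sz /\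
     ck s' <= ck s + S t0 * (150 * sz + 40) + 20).
Proof.
  intros HW HX Henv Ep Eq Hr Hm Hsz He HA. unfold p_stages.
  assert (Hp : 0 < p) by (rewrite Ep; apply pow2_gt0).
  assert (Hq : 0 < q) by (rewrite Eq; apply pow2_gt0).
  assert (HX3 : Nat.eqb X 13 = false) by (apply Nat.eqb_neq; lia).
  destruct Henv as (H14 & H16 & H17 & H28).
  asg h0 Eh0.
  (* [t] stages remain. The quotient [2 ^ t / 2] is the next half length, and for [t = 0] it is the
     zero that stops the loop. *)
  apply wp_while with (m := S t0) (I := fun t s' => exists cur,
    lenv p q sz s' /\ va s' 19 = 2 ^ t / 2 /\ t <= S t0 /\
    (forall b, b < 2 * p -> ar s' 13 b = rv p b) /\ AW w (ar s' X) cur sz /\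
    stages p q t cur = stages p q (S t0) a /\
    ck s' + t * (150 * sz + 40) <= ck s + S t0 * (150 * sz + 40) + 10).
  - exists a. unfold lenv. ev. repeat split; auto.
    + rewrite Eh0, Ep, Nat.pow_succ_r', Nat.mul_comm, Nat.div_mul; auto.
    + cbn [ecost]. lia.
  - intros t s' (cur & (A14 & A16 & A17 & A28) & A19 & Ht & Ae & AX & Est & Hck).
    split; [ev; repeat split; auto; lia|]. ev. rewrite A19. split.
    + destruct t as [|t].
      * intros _. split; [now rewrite <- Est|]. cbn [ecost bcost]. lia.
      * rewrite Nat.pow_succ_r', Nat.mul_comm, Nat.div_mul by lia. pose proof (pow2_gt0 t).
        destruct (Nat.ltb_spec 0 (2 ^ t)); [discriminate|lia].
    + destruct t as [|t]; [intros HH; exfalso; apply HH; reflexivity|]. intros _.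
      rewrite Nat.pow_succ_r', Nat.mul_comm, Nat.div_mul in A19 by lia.
      apply wp_seq. eapply wp_conseq_fr.
      * apply (wp_stage X _ sz cur p q (2 ^ t) (m * 2 ^ (t0 - t))); auto.
        -- repeat split; auto.
        -- apply pow2_gt0.
        -- rewrite Hsz, Ep. replace (2 ^ t0) with (2 ^ (t0 - t) * 2 ^ t)
             by (rewrite <- Nat.pow_add_r; f_equal; lia). ring.
        -- exists (2 ^ (t0 - t)). rewrite Ep, <- Nat.pow_add_r. f_equal. lia.
        -- exists (2 ^ (r - t0)). rewrite Ep, Eq, <- Nat.pow_add_r. f_equal. lia.
        -- rewrite Hsz. clear - Hm. nia.
      * intros s1 F (B1 & B2). cbn [ck tick ecost bcost] in B2.
        assert (B19 : va s1 19 = 2 ^ t) by (rewrite (proj1 F 19 eq_refl); exact A19).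
        assert (B14 : va s1 14 = sz) by (rewrite (proj1 F 14 eq_refl); exact A14).
        assert (B16 : va s1 16 = p) by (rewrite (proj1 F 16 eq_refl); exact A16).
        assert (B17 : va s1 17 = q) by (rewrite (proj1 F 17 eq_refl); exact A17).
        assert (B28 : va s1 28 = 2 * p) by (rewrite (proj1 F 28 eq_refl); exact A28).
        assert (B13 : ar s1 13 = ar s' 13).
        { apply F. cbn -[Nat.eqb]. rewrite (Nat.eqb_sym 13 X), HX3. reflexivity. }
        apply wp_asg; [ev; repeat split; auto; lia|]. intros v Ev. ev_in Ev. rewrite B19 in Ev.
        exists t. split; [lia|]. exists (stF p q (2 ^ t) cur). unfold lenv. ev. rewrite B13.
        repeat split; auto; try lia. cbn [ecost bcost]. lia.
Qed.

Lemma wp_istages X s sz a p q t0 r m :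
  80 + 64 * sz < 2 ^ w -> X < 3 \/ 3 < X < 13 -> lenv p q sz s ->
  p = 2 ^ t0 -> q = 2 ^ r -> t0 <= r -> 0 < m -> sz = m * (2 * p) * q ->
  (forall b, b < 2 * p -> ar s 13 b = rv p b) -> AW w (ar s X) a sz ->
  wp w inp (p_istages X) s (fun s' => AW w (ar s' X) (istages p q (S t0) a) sz /\
     ck s' <= ck s + S t0 * (150 * sz + 40) + 20).
Proof.
  intros HW HX Henv Ep Eq Hr Hm Hsz He HA. unfold p_istages.
  assert (Hp : 0 < p) by (rewrite Ep; apply pow2_gt0).
  assert (Hq : 0 < q) by (rewrite Eq; apply pow2_gt0).
  assert (HX3 : Nat.eqb X 13 = false) by (apply Nat.eqb_neq; lia).
  assert (E2p : 2 * p = 2 ^ S t0) by (rewrite Nat.pow_succ_r'; lia).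
  assert (Hpsz : 2 * p <= sz) by
    (rewrite Hsz; assert (1 <= m * q) by (clear - Hm Hq; nia); clear - H; nia).
  destruct Henv as (H14 & H16 & H17 & H28).
  asg h0 Eh0.
  apply wp_while with (m := S t0) (I := fun k s' => exists t, k + t = S t0 /\
    lenv p q sz s' /\ va s' 19 = 2 ^ t /\
    (forall b, b < 2 * p -> ar s' 13 b = rv p b) /\ AW w (ar s' X) (istages p q t a) sz /\
    ck s' <= ck s + t * (150 * sz + 40) + 10).
  - exists 0. unfold lenv. ev. repeat split; auto.
    cbn [ecost]. lia.
  - intros k s' (t & Hk & (A14 & A16 & A17 & A28) & A19 & Ae & AX & Hck).
    split; [ev; repeat split; auto; lia|]. ev. rewrite A19, A28, E2p. split.
    + destruct (Nat.ltb_spec (2 ^ t) (2 ^ S t0)); [discriminate|]. intros _.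
      assert (t = S t0) as -> by (destruct k; [lia|pose proof (Nat.pow_lt_mono_r 2 t (S t0)); lia]).
      split; auto. cbn [ecost bcost]. lia.
    + destruct (Nat.ltb_spec (2 ^ t) (2 ^ S t0)); [|congruence]. intros _.
      assert (Ht : t <= t0).
      { destruct (Nat.le_gt_cases t t0); auto. pose proof (pow2_le (S t0) t). lia. }
      apply wp_seq. eapply wp_conseq_fr.
      * apply (wp_istage X _ sz (istages p q t a) p q (2 ^ t) (m * 2 ^ (t0 - t))); auto.
        -- repeat split; auto.
        -- apply pow2_gt0.
        -- rewrite Hsz, Ep. replace (2 ^ t0) with (2 ^ (t0 - t) * 2 ^ t)
             by (rewrite <- Nat.pow_add_r; f_equal; lia). ring.
        -- exists (2 ^ (t0 - t)). rewrite Ep, <- Nat.pow_add_r. f_equal. lia.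
        -- exists (2 ^ (r - t0)). rewrite Ep, Eq, <- Nat.pow_add_r. f_equal. lia.
        -- rewrite Hsz. clear - Hm. nia.
      * intros s1 F (B1 & B2). cbn [ck tick ecost bcost] in B2.
        assert (B19 : va s1 19 = 2 ^ t) by (rewrite (proj1 F 19 eq_refl); exact A19).
        assert (B14 : va s1 14 = sz) by (rewrite (proj1 F 14 eq_refl); exact A14).
        assert (B16 : va s1 16 = p) by (rewrite (proj1 F 16 eq_refl); exact A16).
        assert (B17 : va s1 17 = q) by (rewrite (proj1 F 17 eq_refl); exact A17).
        assert (B28 : va s1 28 = 2 * p) by (rewrite (proj1 F 28 eq_refl); exact A28).
        assert (B13 : ar s1 13 = ar s' 13).
        { apply F. cbn -[Nat.eqb]. rewrite (Nat.eqb_sym 13 X), HX3. reflexivity. }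
        assert (Hb : 2 ^ t * 2 <= sz).
        { pose proof (pow2_le (S t) (S t0) ltac:(lia)) as HH. rewrite <- E2p, Nat.pow_succ_r' in HH. lia. }
        apply wp_asg; [ev; rewrite B19; repeat split; auto; try lia|].
        intros v Ev. ev_in Ev. rewrite B19 in Ev.
        exists (k - 1). split; [lia|]. exists (S t). unfold lenv. ev. rewrite B13.
        rewrite Nat.pow_succ_r'.
        repeat split; auto; try lia.
        -- intros b Hb'. apply Ae. lia.
        -- cbn [ecost bcost]. lia.
Qed.

Lemma kap_pos f d : 1 <= kap f d.
Proof.
  revert d; induction f as [|f IH]; intros d; cbn [kap]; [lia|].
  destruct (d <=? 1); [lia|]. specialize (IH (d - d / 2)). pose proof (pow2_gt0 (S (d / 2))). nia.
Qed.

Lemma half_bounds d : 2 <= d -> 1 <= d / 2 /\ 2 * (d / 2) <= d /\ d <= 2 * (d / 2) + 1.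
Proof. intros H. pose proof (Nat.div_mod_eq d 2). pose proof (Nat.mod_upper_bound d 2). lia. Qed.

(** A level contributes [d / 2 + 1] bits and leaves [d - d / 2]. The bound decides how much room a
    word must have for the undivided product. *)
Lemma kap_le f d : 1 <= d -> kap f d <= 2 ^ (2 * (d - 1)).
Proof.
  revert d; induction f as [|f IH]; intros d Hd; cbn [kap]; [apply pow2_gt0|].
  destruct (Nat.leb_spec d 1); [apply pow2_gt0|].
  destruct (half_bounds d ltac:(lia)) as (H1 & H2 & H3).
  transitivity (2 ^ S (d / 2) * 2 ^ (2 * (d - d / 2 - 1))).
  - apply Nat.mul_le_mono_l, IH. lia.
  - rewrite <- Nat.pow_add_r. apply pow2_le. lia.
Qed.

(** The potential of the transform is its size times [d * d]: a level doubles the size but halves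
    [d], rounding up, so the potential drops and the loss pays for the level. For [d = 3] there is
    equality. *)
Lemma square_drop d : 2 <= d ->
  8 * ((d - d / 2) * (d - d / 2)) + d + 1 <= 4 * (d * d).
Proof.
  intros H. destruct (half_bounds d H) as (H1 & H2 & H3).
  remember (d / 2) as e eqn:He. clear He. assert (d = 2 * e \/ d = 2 * e + 1) as [->| ->] by lia.
  - replace (2 * e - e) with e by lia. nia.
  - replace (2 * e + 1 - e) with (e + 1) by lia. nia.
Qed.

(** [R] stands for the cost of one level. The constant is [4 * 600]: [square_drop] multiplied by
    [600 * sz] sets [600 * sz * (d + 1)] free, which covers [2 * sz * (190 * d + 400)]. *)
Lemma level_cost d sz R : 2 <= d -> R <= 2 * sz * (190 * d + 400) ->
  R + 2400 * (2 * sz * ((d - d / 2) * (d - d / 2))) <= 2400 * (sz * (d * d)).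
Proof.
  intros Hd HR. pose proof (square_drop d Hd) as HD.
  set (x := (d - d / 2) * (d - d / 2)) in *. set (y := d * d) in *. clearbody x y.
  assert (H : 600 * sz * (8 * x + d + 1) <= 600 * sz * (4 * y))
    by (apply Nat.mul_le_mono_l; exact HD).
  assert (380 * d + 800 <= 600 * d + 600) by lia. nia.
Qed.

Lemma wp_params s d : 2 <= d -> va s 15 = d -> 2 * 2 ^ (d - d / 2) < 2 ^ w -> 80 < 2 ^ w -> d < 2 ^ w ->
  wp w inp p_params s (fun s' => va s' 16 = 2 ^ (d / 2) /\ va s' 17 = 2 ^ (d - d / 2) /\
    va s' 28 = 2 * 2 ^ (d / 2) /\ ck s' <= ck s + 30).
Proof.
  intros Hd H15 HW1 HW2 HW3. destruct (half_bounds d Hd) as (H1 & H2 & H3).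
  pose proof (pow2_le (d / 2) (d - d / 2) ltac:(lia)).
  unfold p_params. asg p Ep. asg q Eq0. asg pp Epp.
  repeat split; try lia. cbn [ecost bcost]. lia.
Qed.

Lemma wp_fwd X s a d0 :
  80 + 64 * 2 ^ (2 * d0) < 2 ^ w -> X < 3 \/ 3 < X < 12 -> 1 <= d0 ->
  va s 10 = 2 ^ d0 -> va s 11 = d0 -> AW w (ar s X) a (2 ^ d0) ->
  wp w inp (p_fwd X) s (fun s' => exists lv,
    lv = nlev d0 d0 /\ va s' 18 = lv /\ va s' 14 = 2 ^ (d0 + lv) /\ va s' 26 = kap d0 d0 /\
    lv + 1 <= d0 /\ dch d0 lv = 1 /\
    (forall i, i < lv -> ar s' 12 i = dch d0 i /\ 1 < dch d0 i) /\
    2 ^ (d0 + lv) <= 2 ^ d0 * (d0 * d0) /\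
    AW w (ar s' X) (FW d0 d0 a) (2 ^ (d0 + lv)) /\
    ck s' <= ck s + 2400 * (2 ^ d0 * (d0 * d0)) + 20).
Proof.
  intros HW HX Hd0 H10 H11 HA. unfold p_fwd.
  assert (HX12 : Nat.eqb X 12 = false) by (apply Nat.eqb_neq; lia).
  assert (HX13 : Nat.eqb X 13 = false) by (apply Nat.eqb_neq; lia).
  asg dz Edz. asg lv0 Elv0. asg sz1 Esz1. asg fac1 Efac1. subst dz lv0 sz1 fac1.
  (* [cur] is the current array: finishing [FW] from it gives the final result, and likewise for the
     number of levels and the factor. The last clause is the potential argument: time spent plus
     2400 times the potential never exceeds its initial value by more than 10. *)
  apply wp_while with (m := d0) (I := fun d s' => exists f cur lv fac,
    1 <= d <= f /\ FW f d cur = FW d0 d0 a /\ lv + nlev f d = nlev d0 d0 /\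
    fac * kap f d = kap d0 d0 /\ lv + d <= d0 /\ dch d0 lv = d /\
    va s' 15 = d /\ va s' 18 = lv /\ va s' 14 = 2 ^ (d0 + lv) /\ va s' 26 = fac /\
    (forall i, i < lv -> ar s' 12 i = dch d0 i /\ 1 < dch d0 i) /\
    2 ^ (d0 + lv) * (d * d) <= 2 ^ d0 * (d0 * d0) /\
    AW w (ar s' X) cur (2 ^ (d0 + lv)) /\
    ck s' + 2400 * (2 ^ (d0 + lv) * (d * d)) <= ck s + 2400 * (2 ^ d0 * (d0 * d0)) + 10).
  - exists d0, a, 0, 1. ev. rewrite Nat.add_0_r.
    repeat split; auto; try lia. cbn [ecost]. lia.
  - intros d s' (f & cur & lv & fac & Hdf & HFW & Hlv & Hfac & Hlvd & Hdch & H15 & H18 & H14 & H26 & H12 & Hsq & HAX & Hck).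
    split; [ev; repeat split; auto; lia|]. ev. rewrite H15. split.
    + destruct (Nat.ltb_spec 1 d); [discriminate|]. intros _.
      assert (d = 1) as -> by lia.
      assert (E1 : forall A (x y : A), (if 1 <=? 1 then x else y) = x) by reflexivity.
      destruct f as [|f]; [lia|]. cbn [FW nlev kap] in *. rewrite E1 in *.
      exists lv. rewrite <- HFW. repeat split; auto; try lia; try (apply H12; auto).
      cbn [ecost bcost]. lia.
    + destruct (Nat.ltb_spec 1 d) as [Hd|]; [|congruence]. intros _.
      destruct (half_bounds d ltac:(lia)) as (Hh1 & Hh2 & Hh3).
      destruct f as [|f]; [lia|]. cbn [FW nlev kap] in *.
      destruct (Nat.leb_spec d 1) as [|_]; [lia|].
      set (p := 2 ^ (d / 2)) in *. set (q := 2 ^ (d - d / 2)) in *.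
      set (sz := 2 ^ (d0 + lv)) in *.
      assert (Hp : 0 < p) by apply pow2_gt0. assert (Hq : 0 < q) by apply pow2_gt0.
      assert (Epq : p * q = 2 ^ d) by (unfold p, q; rewrite <- Nat.pow_add_r; f_equal; lia).
      assert (Hm : exists m, 0 < m /\ sz = m * (p * q)).
      { exists (2 ^ (d0 + lv - d)). split; [apply pow2_gt0|]. rewrite Epq. unfold sz.
        rewrite <- Nat.pow_add_r. f_equal. lia. }
      destruct Hm as (m & Hm0 & Hm).
      assert (Esz2 : 2 * sz = 2 ^ (d0 + S lv)) by (unfold sz; rewrite Nat.add_succ_r, Nat.pow_succ_r'; reflexivity).
      assert (Hszb : 2 * sz <= 2 ^ (2 * d0)) by (rewrite Esz2; apply pow2_le; lia).
      assert (Hpq : p * q <= sz) by (rewrite Hm; clear - Hm0; nia).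
      assert (Hpb : p <= sz) by (clear - Hpq Hq; nia).
      assert (Hqb : q <= sz) by (clear - Hpq Hp; nia).
      assert (Hdb : d < q * 2).
      { unfold q. apply (Nat.lt_le_trans _ (2 * (d - d / 2) + 1)); [lia|].
        pose proof (Nat.pow_gt_lin_r 2 (d - d / 2) ltac:(lia)). lia. }
      assert (Hlvb : lv < 2 ^ (2 * d0)).
      { apply (Nat.lt_le_trans _ (2 ^ lv)); [apply Nat.pow_gt_lin_r; lia|apply pow2_le; lia]. }
      assert (Hfacb : fac * (2 * p) < 2 ^ w).
      { apply (Nat.le_lt_trans _ (2 ^ (2 * d0))); [|lia].
        transitivity (kap d0 d0); [|etransitivity; [apply kap_le; lia|apply pow2_le; lia]].
        rewrite <- Hfac. pose proof (kap_pos f (d - d / 2)) as HK.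
        rewrite Nat.pow_succ_r'. fold p. clear - HK. nia. }
      apply wp_seq, wp_sto; ev; known; try lia.
      asg lv' Elv'.
      apply wp_seq. eapply wp_conseq_fr; [apply (wp_params _ d); auto; fold q; ev; lia|].
      fold p q. intros s1 F1 (G16 & G17 & G28 & Gck).
      assert (G14 : va s1 14 = sz) by (rewrite (proj1 F1 14 eq_refl); exact H14).
      assert (G15 : va s1 15 = d) by (rewrite (proj1 F1 15 eq_refl); exact H15).
      assert (G18 : va s1 18 = lv') by (rewrite (proj1 F1 18 eq_refl); reflexivity).
      assert (G26 : va s1 26 = fac) by (rewrite (proj1 F1 26 eq_refl); exact H26).
      assert (GX : ar s1 X = ar s' X).
      { rewrite (proj1 (proj2 F1) X eq_refl). cbn [ar]. unfold aset. now rewrite HX12. }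
      assert (G12 : ar s1 12 = wr (ar s' 12) lv d) by (rewrite (proj1 (proj2 F1) 12 eq_refl); reflexivity).
      cbn [ck ecost bcost] in Gck. clear F1.
      asg sz2 Esz'. asg fac2 Efac2.
      apply wp_seq. eapply wp_conseq_fr.
      { apply (wp_split X _ sz cur p q m); auto; try lia; ev; auto.
        - unfold lenv. ev. rewrite Esz'. auto.
        - rewrite GX. exact HAX. }
      intros s2 F2 (AX2 & C2). cbn [ck ecost bcost] in C2.
      assert (K14 : va s2 14 = 2 * sz) by (rewrite (proj1 F2 14 eq_refl); exact Esz').
      assert (K15 : va s2 15 = d) by (rewrite (proj1 F2 15 eq_refl); exact G15).
      assert (K16 : va s2 16 = p) by (rewrite (proj1 F2 16 eq_refl); exact G16).
      assert (K17 : va s2 17 = q) by (rewrite (proj1 F2 17 eq_refl); exact G17).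
      assert (K18 : va s2 18 = lv') by (rewrite (proj1 F2 18 eq_refl); exact G18).
      assert (K28 : va s2 28 = 2 * p) by (rewrite (proj1 F2 28 eq_refl); exact G28).
      assert (K26 : va s2 26 = fac2) by (rewrite (proj1 F2 26 eq_refl); reflexivity).
      assert (K12 : ar s2 12 = wr (ar s' 12) lv d).
      { rewrite (proj1 (proj2 F2) 12); [exact G12|]. cbn -[Nat.eqb]. now rewrite (Nat.eqb_sym 12 X), HX12. }
      clear F2.
      apply wp_seq. eapply wp_conseq_fr; [apply (wp_etab _ p); auto; lia|].
      intros s3 F3 (T3 & C3). carry F3.
      assert (L12 : ar s3 12 = wr (ar s' 12) lv d) by (rewrite (proj1 (proj2 F3) 12 eq_refl); exact K12).
      assert (AX3 : AW w (ar s3 X) (splitF p q cur) (2 * sz)).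
      { rewrite (proj1 (proj2 F3) X); auto. cbn -[Nat.eqb]. now rewrite HX13. }
      clear F3.
      apply wp_seq. eapply wp_conseq_fr.
      { apply (wp_stages X _ (2 * sz) (splitF p q cur) p q (d / 2) (d - d / 2) m); auto; try lia.
        repeat split; auto. }
      intros s4 F4 (AX4 & C4). carry F4.
      assert (M12 : ar s4 12 = wr (ar s' 12) lv d).
      { rewrite (proj1 (proj2 F4) 12); [exact L12|]. cbn -[Nat.eqb]. now rewrite (Nat.eqb_sym 12 X), HX12. }
      clear F4.
      apply wp_asg; [ev; known; repeat split; auto; lia|]. intros d' Ed'. ev_in Ed'. known_in Ed'.
      assert (HR := level_cost d sz ((ck s4 + 8) - ck s') ltac:(lia)).
      assert (HR1 : ck s4 + 8 - ck s' <= 2 * sz * (190 * d + 400)).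
      { assert (HS : S (d / 2) * (150 * (2 * sz) + 40) <= d * (150 * (2 * sz) + 40))
          by (apply Nat.mul_le_mono_r; lia).
        assert (HS2 : d * 40 <= d * 40 * sz) by (clear - Hpb Hp; nia).
        cbn [ck tick ecost bcost] in *. lia. }
      specialize (HR HR1). clear HR1.
      exists d'. split; [lia|]. exists f, (stages p q (S (d / 2)) (splitF p q cur)), (S lv), fac2.
      ev. rewrite <- Esz2, Ed'.
      repeat split; auto; try lia.
      * rewrite <- Hfac, Efac2. rewrite (Nat.pow_succ_r' 2 (d / 2)). fold p. ring.
      * cbn [dch]. now rewrite Hdch.
      * rewrite M12. destruct (Nat.eq_dec i lv) as [->|Hi]; [now rewrite wr_eq|].
        rewrite wr_neq by auto. apply H12. lia.
      * destruct (Nat.eq_dec i lv) as [->|Hi]; [lia|]. apply H12. lia.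
      * cbn [ck ecost bcost] in *. lia.
Qed.

Lemma dch_le d0 lv : (forall i, i < lv -> 1 < dch d0 i) -> forall i, i <= lv -> 1 <= d0 ->
  dch d0 i + i <= d0 /\ 1 <= dch d0 i.
Proof.
  intros H i Hi Hd0. induction i as [|i IH]; cbn [dch]; [lia|].
  specialize (IH ltac:(lia)). specialize (H i ltac:(lia)).
  destruct (half_bounds (dch d0 i)); lia.
Qed.

Lemma wp_bwd X s r d0 lv :
  80 + 64 * 2 ^ (2 * d0) < 2 ^ w -> X < 3 \/ 3 < X < 12 -> 1 <= d0 ->
  va s 18 = lv -> va s 14 = 2 ^ (d0 + lv) -> lv + 1 <= d0 -> dch d0 lv = 1 ->
  (forall i, i < lv -> ar s 12 i = dch d0 i /\ 1 < dch d0 i) ->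
  AW w (ar s X) r (2 ^ (d0 + lv)) ->
  wp w inp (p_bwd X) s (fun s' => AW w (ar s' X) (BW d0 d0 r) (2 ^ d0) /\
    ck s' <= ck s + 2400 * (2 ^ d0 * (d0 * d0)) + 20).
Proof.
  intros HW HX Hd0 H18 H14 Hlv Hdlv Hch HA. unfold p_bwd.
  assert (HX12 : Nat.eqb X 12 = false) by (apply Nat.eqb_neq; lia).
  assert (HX13 : Nat.eqb X 13 = false) by (apply Nat.eqb_neq; lia).
  pose proof (dch_le d0 lv (fun i Hi => proj2 (Hch i Hi))) as Hdle.
  assert (HHsq : forall i, i <= lv -> 2 ^ (d0 + i) * (dch d0 i * dch d0 i) <= 2 ^ d0 * (d0 * d0)).
  { induction i as [|i IH]; intros Hi; cbn [dch]; [rewrite Nat.add_0_r; lia|].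
    specialize (IH ltac:(lia)). destruct (Hch i ltac:(lia)) as [_ Hd].
    pose proof (square_drop (dch d0 i) ltac:(lia)) as Hsq.
    rewrite Nat.add_succ_r, Nat.pow_succ_r'.
    set (x := (dch d0 i - dch d0 i / 2) * (dch d0 i - dch d0 i / 2)) in *.
    etransitivity; [|exact IH]. rewrite (Nat.mul_comm 2), <- Nat.mul_assoc.
    apply Nat.mul_le_mono_l. lia. }
  (* [i] levels remain to be undone, and [d0 - i] is the fuel that [BW d0 d0] has left after [i]
     calls. At the start the exponent of the block size is 1, where [BW] is the identity. *)
  apply wp_while with (m := lv) (I := fun i s' =>
    i <= lv /\ va s' 18 = i /\ va s' 14 = 2 ^ (d0 + i) /\
    (forall i, i < lv -> ar s' 12 i = dch d0 i) /\
    AW w (ar s' X) (BW (d0 - i) (dch d0 i) r) (2 ^ (d0 + i)) /\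
    ck s' <= ck s + 2400 * (2 ^ (d0 + i) * (dch d0 i * dch d0 i)) /\
    2 ^ (d0 + i) * (dch d0 i * dch d0 i) <= 2 ^ d0 * (d0 * d0)).
  - replace (BW (d0 - lv) (dch d0 lv) r) with r.
    2:{ rewrite Hdlv. destruct (d0 - lv); reflexivity. }
    repeat split; auto; try lia. intros; apply Hch; auto.
  - intros i s' (Hi & A18 & A14 & A12 & AX & Hck & Hsq).
    split; [ev; repeat split; auto; lia|]. ev. rewrite A18. split.
    + destruct (Nat.ltb_spec 0 i); [discriminate|]. intros _. assert (i = 0) as -> by lia.
      cbn [dch] in *. rewrite Nat.sub_0_r, Nat.add_0_r in *. split; auto. cbn [ecost bcost]. lia.
    + destruct i as [|i]; [intros HH; exfalso; apply HH; reflexivity|]. intros _.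
      destruct (Hch i ltac:(lia)) as [_ Hd1]. destruct (Hdle i ltac:(lia) Hd0) as [Hd2 _].
      cbn [dch] in *. set (d := dch d0 i) in *.
      destruct (half_bounds d ltac:(lia)) as (Hh1 & Hh2 & Hh3).
      set (p := 2 ^ (d / 2)) in *. set (q := 2 ^ (d - d / 2)) in *.
      set (sz := 2 ^ (d0 + i)) in *.
      assert (Hp : 0 < p) by apply pow2_gt0. assert (Hq : 0 < q) by apply pow2_gt0.
      assert (Epq : p * q = 2 ^ d) by (unfold p, q; rewrite <- Nat.pow_add_r; f_equal; lia).
      assert (Hm : exists m, 0 < m /\ sz = m * (p * q)).
      { exists (2 ^ (d0 + i - d)). split; [apply pow2_gt0|]. rewrite Epq. unfold sz.
        rewrite <- Nat.pow_add_r. f_equal. lia. }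
      destruct Hm as (m & Hm0 & Hm).
      assert (Esz2 : 2 * sz = 2 ^ (d0 + S i)) by (unfold sz; rewrite Nat.add_succ_r, Nat.pow_succ_r'; reflexivity).
      rewrite <- Esz2 in *.
      assert (Hszb : 2 * sz <= 2 ^ (2 * d0)) by (rewrite Esz2; apply pow2_le; lia).
      assert (Hpq : p * q <= sz) by (rewrite Hm; clear - Hm0; nia).
      assert (Hpb : p <= sz) by (clear - Hpq Hq; nia).
      assert (Hqb : q <= sz) by (clear - Hpq Hp; nia).
      assert (Hdb : d < q * 2).
      { unfold q. apply (Nat.lt_le_trans _ (2 * (d - d / 2) + 1)); [lia|].
        pose proof (Nat.pow_gt_lin_r 2 (d - d / 2) ltac:(lia)). lia. }
      assert (Hlvb : lv < 2 ^ (2 * d0)).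
      { apply (Nat.lt_le_trans _ (2 ^ lv)); [apply Nat.pow_gt_lin_r; lia|apply pow2_le; lia]. }
      asg i' Ei'. replace (S i - 1) with i in Ei' by lia.
      asg d' Ed'. rewrite Ei', A12 in Ed' by lia. fold d in Ed'.
      apply wp_seq. eapply wp_conseq_fr; [apply (wp_params _ d); auto; fold q; ev; lia|].
      fold p q. intros s1 F1 (G16 & G17 & G28 & Gck).
      assert (G14 : va s1 14 = 2 * sz) by (rewrite (proj1 F1 14 eq_refl); exact A14).
      assert (G15 : va s1 15 = d) by (rewrite (proj1 F1 15 eq_refl); exact Ed').
      assert (G18 : va s1 18 = i) by (rewrite (proj1 F1 18 eq_refl); exact Ei').
      assert (GX : ar s1 X = ar s' X) by (rewrite (proj1 (proj2 F1) X eq_refl); reflexivity).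
      assert (G12 : ar s1 12 = ar s' 12) by (rewrite (proj1 (proj2 F1) 12 eq_refl); reflexivity).
      cbn [ck ecost bcost tick] in Gck. clear F1.
      asg pq Epq'.
      apply wp_seq. eapply wp_conseq_fr; [apply (wp_etab _ p); auto; lia|].
      intros s3 F3 (T3 & C3). cbn [ck ecost bcost] in C3.
      assert (K14 : va s3 14 = 2 * sz) by (rewrite (proj1 F3 14 eq_refl); exact G14).
      assert (K16 : va s3 16 = p) by (rewrite (proj1 F3 16 eq_refl); exact G16).
      assert (K17 : va s3 17 = q) by (rewrite (proj1 F3 17 eq_refl); exact G17).
      assert (K18 : va s3 18 = i) by (rewrite (proj1 F3 18 eq_refl); exact G18).
      assert (K28 : va s3 28 = 2 * p) by (rewrite (proj1 F3 28 eq_refl); exact G28).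
      assert (K27 : va s3 27 = p * q) by (rewrite (proj1 F3 27 eq_refl); exact Epq').
      assert (L12 : ar s3 12 = ar s' 12) by (rewrite (proj1 (proj2 F3) 12 eq_refl); exact G12).
      assert (LX : ar s3 X = ar s' X).
      { rewrite (proj1 (proj2 F3) X); auto. cbn -[Nat.eqb]. now rewrite HX13. }
      clear F3. rewrite <- LX in AX.
      apply wp_seq. eapply wp_conseq_fr.
      { apply (wp_istages X _ (2 * sz) (BW (d0 - S i) (d - d / 2) r) p q (d / 2) (d - d / 2) m); auto; try lia.
        repeat split; auto. }
      intros s4 F4 (AX4 & C4). carry F4.
      assert (M12 : ar s4 12 = ar s' 12).
      { rewrite (proj1 (proj2 F4) 12); [exact L12|]. cbn -[Nat.eqb]. now rewrite (Nat.eqb_sym 12 X), HX12. }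
      clear F4.
      asg sz' Esz'. replace (2 * sz / 2) with sz in Esz' by (rewrite Nat.mul_comm, Nat.div_mul; auto).
      eapply wp_conseq_fr.
      { apply (wp_merge X _ sz (istages p q (S (d / 2)) (BW (d0 - S i) (d - d / 2) r)) p q m); auto; try lia.
        repeat split; auto. }
      intros s5 F5 (AX5 & C5). cbn [ck ecost bcost] in C5.
      assert (N12 : ar s5 12 = ar s' 12).
      { rewrite (proj1 (proj2 F5) 12); [exact M12|]. cbn -[Nat.eqb]. now rewrite (Nat.eqb_sym 12 X), HX12. }
      assert (N18 : va s5 18 = i) by (rewrite (proj1 F5 18 eq_refl); cbn [va upd Nat.eqb]; assumption).
      assert (N14 : va s5 14 = sz) by (rewrite (proj1 F5 14 eq_refl); exact Esz').
      clear F5.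
      assert (HR := level_cost d sz ((ck s5 + 1) - ck s') ltac:(lia)).
      assert (HR1 : ck s5 + 1 - ck s' <= 2 * sz * (190 * d + 400)).
      { assert (HS : S (d / 2) * (150 * (2 * sz) + 40) <= d * (150 * (2 * sz) + 40))
          by (apply Nat.mul_le_mono_r; lia).
        assert (HS2 : d * 40 <= d * 40 * sz) by (clear - Hpb Hp; nia).
        cbn [ck tick ecost bcost] in *. lia. }
      specialize (HR HR1). clear HR1.
      exists i. split; [lia|]. ev. fold d sz. rewrite N12.
      repeat split; auto; try lia; [|apply HHsq; lia].
      replace (d0 - i) with (S (d0 - S i)) by lia. cbn [BW].
      destruct (Nat.leb_spec d 1); [lia|exact AX5].
Qed.

(** The factor [kap] is a power of two and cannot be cancelled modulo [2 ^ w]. The last hypothesis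
    bounds the product times [2 ^ (2 * d0)], and so times [kap], by a word: after the inverse
    transform the words hold the true integers, and the final division is exact. *)
Lemma wp_mul s a b c d0 :
  80 + 64 * 2 ^ (2 * d0) < 2 ^ w -> 1 <= d0 -> va s 10 = 2 ^ d0 -> va s 11 = d0 ->
  AW w (ar s 9) a (2 ^ d0) -> AW w (ar s 10) b (2 ^ d0) ->
  (forall z, evb z (2 ^ d0) a 0 * evb z (2 ^ d0) b 0 = evb z (2 ^ d0) c 0)%Z ->
  (forall g, g < 2 ^ d0 -> (0 <= c g)%Z /\ (Z.of_nat (2 ^ (2 * d0)) * c g < Z.of_nat (2 ^ w))%Z) ->
  wp w inp p_mul s (fun s' => (forall g, g < 2 ^ d0 -> Z.of_nat (ar s' 9 g) = c g) /\
    ck s' <= ck s + 2 * 4000 * (2 ^ d0 * (d0 * d0)) + 100).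
Proof.
  intros HW Hd0 H10 H11 HA HB Hc Hb. unfold p_mul.
  assert (HD : 2 ^ d0 <= 2 ^ (2 * d0)) by (apply pow2_le; lia).
  apply wp_seq. eapply wp_conseq_fr; [apply (wp_fwd 9 _ a d0); auto; lia|].
  intros s1 F1 (lv & Elv & _ & _ & _ & _ & _ & _ & _ & A9 & C1). carry F1.
  assert (B10 : ar s1 10 = ar s 10) by (exact (proj1 (proj2 F1) 10 eq_refl)).
  clear F1. rewrite <- B10 in HB.
  apply wp_seq. eapply wp_conseq_fr; [apply (wp_fwd 10 _ b d0); auto; lia|].
  intros s2 F2 (lv2 & Elv2 & G18 & G14 & G26 & Glv & Gdch & G12 & Gsq & A10 & C2).
  rewrite <- Elv in Elv2. subst lv2. carry F2.
  assert (B9 : ar s2 9 = ar s1 9) by (exact (proj1 (proj2 F2) 9 eq_refl)). clear F2.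
  rewrite <- B9 in A9.
  assert (Hsz : 2 ^ (d0 + lv) <= 2 ^ (2 * d0)) by (apply pow2_le; lia).
  apply wp_seq. eapply wp_conseq_fr.
  { apply (wp_base 9 10 _ (2 ^ (d0 + lv)) (FW d0 d0 a) (FW d0 d0 b) (2 ^ (d0 + lv - 1))); auto; try lia.
    rewrite Nat.mul_comm, <- Nat.pow_succ_r'. f_equal. lia. }
  intros s3 F3 (B3 & C3). carry F3.
  assert (B12 : ar s3 12 = ar s2 12) by (exact (proj1 (proj2 F3) 12 eq_refl)). clear F3.
  apply wp_seq. eapply wp_conseq_fr.
  { apply (wp_bwd 9 _ (mulF (FW d0 d0 a) (FW d0 d0 b)) d0 lv); auto; try lia. now rewrite B12. }
  intros s4 F4 (A4 & C4). carry F4. clear F4.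
  assert (Hval : forall g, g < 2 ^ d0 -> Z.of_nat (ar s4 9 g) = (Z.of_nat (kap d0 d0) * c g)%Z).
  { intros g Hg. destruct (Hb g Hg) as [Hb1 Hb2].
    rewrite <- (nussbaumer_conv d0 d0 d0 a b c) by (auto; lia).
    apply (cw_val w); [apply A4; auto|].
    rewrite (nussbaumer_conv d0 d0 d0 a b c) by (auto; lia).
    assert (HK : kap d0 d0 <= 2 ^ (2 * d0)) by (etransitivity; [apply kap_le; lia|apply pow2_le; lia]).
    split; [nia|]. eapply Z.le_lt_trans; [|exact Hb2]. apply Z.mul_le_mono_nonneg_r; lia. }
  apply wp_for with (K := 20) (N := 2 ^ d0)
    (I := fun i s' => (forall g, g < 2 ^ d0 -> i <= g -> ar s' 9 g = ar s4 9 g) /\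
                      forall g, g < i -> Z.of_nat (ar s' 9 g) = c g); auto; try lia.
  - split; auto. intros; lia.
  - intros i s' Hi F (I1 & I2) H13. carry F.
    assert (Hi1 : 80 + 16 * i < 2 ^ w) by lia.
    apply wp_sto; ev; known; repeat split; auto.
    + intros g Hg Hig. rewrite wr_neq by lia. apply I1; lia.
    + intros g Hg. destruct (Nat.eq_dec g i) as [->|Hgi].
      * rewrite wr_eq, I1 by lia. pose proof (kap_pos d0 d0) as HK.
        rewrite Nat2Z.inj_div, Hval, Z.mul_comm by lia. apply Z.div_mul. lia.
      * rewrite wr_neq by lia. apply I2. lia.
    + cbn [ecost bcost]. lia.
  - intros s' F (I1 & I2) H13 Hck. split; auto.
    set (X := 2 ^ d0 * (d0 * d0)) in *.
    assert (HD2 : 2 ^ d0 <= X) by (unfold X; assert (1 <= d0 * d0) by (clear - Hd0; nia); clear - H14; nia).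
    clearbody X. clear - HD2 Hck C1 C2 C3 C4 Gsq. lia.
Qed.

End Conv.

(** * Radix sort *)

Fixpoint sumn (n : nat) (f : nat -> nat) : nat :=
  match n with 0 => 0 | S n => sumn n f + f n end.

Definition b2n (b : bool) : nat := if b then 1 else 0.

Lemma sumn_ext n f g : (forall i, i < n -> f i = g i) -> sumn n f = sumn n g.
Proof. induction n; cbn [sumn]; intros H; auto. rewrite IHn, H; auto. Qed.

Lemma sumn_le n f g : (forall i, i < n -> f i <= g i) -> sumn n f <= sumn n g.
Proof.
  induction n; cbn [sumn]; intros H; auto. specialize (IHn ltac:(auto)).
  specialize (H n ltac:(lia)). lia.
Qed.

Lemma sumn_add n f g : sumn n (fun i => f i + g i) = sumn n f + sumn n g.
Proof. induction n; cbn [sumn]; lia. Qed.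

Lemma sumn_mull n c f : sumn n (fun i => c * f i) = c * sumn n f.
Proof. induction n; cbn [sumn]; nia. Qed.

Lemma sumn_const n c : sumn n (fun _ => c) = n * c.
Proof. induction n; cbn [sumn]; lia. Qed.

Lemma sumn_le_upper m n f : m <= n -> sumn m f <= sumn n f.
Proof. induction 1; cbn [sumn]; lia. Qed.

Definition cnt_eq (f : nat -> nat) (n d : nat) : nat := sumn n (fun i => b2n (f i =? d)).
Definition cnt_lt (f : nat -> nat) (n d : nat) : nat := sumn n (fun i => b2n (f i <? d)).
(** The target position of item [i] in a stable counting sort by [f]. *)
Definition rank (f : nat -> nat) (n i : nat) : nat := cnt_lt f n (f i) + cnt_eq f i (f i).

Lemma cnt_eq_S f n d : cnt_eq f (S n) d = cnt_eq f n d + b2n (f n =? d).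
Proof. reflexivity. Qed.

Lemma cnt_lt_S f n d : cnt_lt f n (S d) = cnt_lt f n d + cnt_eq f n d.
Proof.
  unfold cnt_lt, cnt_eq. rewrite <- sumn_add. apply sumn_ext. intros i _.
  destruct (Nat.ltb_spec (f i) (S d)), (Nat.ltb_spec (f i) d), (Nat.eqb_spec (f i) d); simpl; lia.
Qed.

Lemma cnt_lt_mono f n d e : d <= e -> cnt_lt f n d <= cnt_lt f n e.
Proof.
  intros H. apply sumn_le. intros i _.
  destruct (Nat.ltb_spec (f i) d), (Nat.ltb_spec (f i) e); simpl; lia.
Qed.

Lemma cnt_lt_le f n d : cnt_lt f n d <= n.
Proof.
  rewrite <- (Nat.mul_1_r n) at 2. rewrite <- sumn_const. apply sumn_le. intros.
  destruct (f i <? d); simpl; lia.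
Qed.

Lemma cnt_eq_le f n d : cnt_eq f n d <= n.
Proof.
  rewrite <- (Nat.mul_1_r n) at 2. rewrite <- sumn_const. apply sumn_le. intros.
  destruct (f i =? d); simpl; lia.
Qed.

Lemma cnt_eq_lt f i j : i < j -> cnt_eq f i (f i) < cnt_eq f j (f i).
Proof.
  intros H. apply (Nat.lt_le_trans _ (cnt_eq f (S i) (f i))).
  - unfold cnt_eq. cbn [sumn]. rewrite Nat.eqb_refl. simpl. lia.
  - now apply sumn_le_upper.
Qed.

Lemma rank_lt_S f n i : i < n -> rank f n i < cnt_lt f n (S (f i)).
Proof. intros H. rewrite cnt_lt_S. unfold rank. pose proof (cnt_eq_lt f i n H). lia. Qed.

Lemma rank_lt f n i : i < n -> rank f n i < n.
Proof. intros H. pose proof (rank_lt_S f n i H). pose proof (cnt_lt_le f n (S (f i))). lia. Qed.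

Lemma rank_mono f n i j : i < n -> j < n -> f i < f j \/ (f i = f j /\ i < j) ->
  rank f n i < rank f n j.
Proof.
  intros Hi Hj [H|[H1 H2]].
  - pose proof (rank_lt_S f n i Hi). pose proof (cnt_lt_mono f n (S (f i)) (f j) H).
    unfold rank at 2. lia.
  - unfold rank. rewrite <- H1. pose proof (cnt_eq_lt f i j H2). lia.
Qed.

Lemma rank_order f n i j : i < n -> j < n -> rank f n i < rank f n j ->
  f i < f j \/ (f i = f j /\ i < j).
Proof.
  intros Hi Hj H.
  destruct (Nat.lt_trichotomy (f i) (f j)) as [|[E|G]]; auto.
  - destruct (Nat.lt_trichotomy i j) as [|[->|G]]; auto; [lia|].
    pose proof (rank_mono f n j i Hj Hi ltac:(auto)). lia.
  - pose proof (rank_mono f n j i Hj Hi ltac:(auto)). lia.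
Qed.

Lemma rank_inj f n i j : i < n -> j < n -> rank f n i = rank f n j -> i = j.
Proof.
  intros Hi Hj H. destruct (Nat.lt_trichotomy (f i) (f j)) as [G|[E|G]].
  - pose proof (rank_mono f n i j Hi Hj ltac:(auto)). lia.
  - destruct (Nat.lt_trichotomy i j) as [G|[->|G]]; auto.
    + pose proof (rank_mono f n i j Hi Hj ltac:(auto)). lia.
    + pose proof (rank_mono f n j i Hj Hi ltac:(auto)). lia.
  - pose proof (rank_mono f n j i Hj Hi ltac:(auto)). lia.
Qed.

Lemma map_perm_seq pi n : (forall i, i < n -> pi i < n) ->
  (forall i j, i < n -> j < n -> pi i = pi j -> i = j) ->
  Permutation (map pi (seq 0 n)) (seq 0 n).
Proof.
  intros H1 H2. apply NoDup_Permutation_bis.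
  - assert (HH : forall l, NoDup l -> (forall x, In x l -> x < n) -> NoDup (map pi l)).
    { induction l as [|x l IH]; simpl; intros Hnd Hl; [constructor|].
      inversion Hnd; subst. constructor; [|apply IH; auto].
      intros Hin. apply in_map_iff in Hin as (y & E & Hy). apply H2 in E; subst; auto. }
    apply HH; [apply seq_NoDup|]. intros x Hx. apply in_seq in Hx. lia.
  - rewrite length_map. lia.
  - intros x Hx. apply in_map_iff in Hx as (y & <- & Hy). apply in_seq in Hy.
    apply in_seq. specialize (H1 y ltac:(lia)). lia.
Qed.

(* 12 number of passes, 13 size, 14 divisor selecting the digit, 15 number of
   counters, 16 position, 17 digit, 18 target, 19 pass; arrays 3 scratch, 4 counters. *)
Definition p_pass (X : nat) : cmd :=
  CFor 16 15 (CSto 4 (V 16) (C 0)) ;;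
  CFor 16 13 (17 <- EArr X (V 16) /: V 14 %: V 3 +: C 1 ;; CSto 4 (V 17) (EArr 4 (V 17) +: C 1)) ;;
  CFor 16 3 (CSto 4 (V 16 +: C 1) (EArr 4 (V 16 +: C 1) +: EArr 4 (V 16))) ;;
  CFor 16 13 (17 <- EArr X (V 16) /: V 14 %: V 3 ;; 18 <- EArr 4 (V 17) ;;
              CSto 3 (V 18) (EArr X (V 16)) ;; CSto 4 (V 17) (V 18 +: C 1)) ;;
  CFor 16 13 (CSto X (V 16) (EArr 3 (V 16))).

Definition p_sort (X : nat) : cmd :=
  15 <- V 3 +: C 1 ;; 14 <- C 1 ;; CFor 19 12 (p_pass X ;; 14 <- V 14 *~ V 3).

Section Sort.
Variables (w : nat) (inp : list nat).

Lemma wp_pass X s N TL D f :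
  X < 3 -> va s 3 = TL -> va s 13 = N -> va s 15 = TL + 1 -> va s 14 = D -> 0 < TL ->
  (forall i, i < N -> ar s X i = f i) ->
  80 + 16 * (N + TL + 2) < 2 ^ w ->
  wp w inp (p_pass X) s (fun s' =>
    (forall i, i < N -> ar s' X (rank (fun i => (f i / D) mod TL) N i) = f i) /\
    ck s' <= ck s + 200 * (N + TL) + 100).
Proof.
  intros HX H3 H13 H15 H14 HTL Hf HW. unfold p_pass.
  assert (HX3 : Nat.eqb X 3 = false) by (apply Nat.eqb_neq; lia).
  assert (HX4 : Nat.eqb X 4 = false) by (apply Nat.eqb_neq; lia).
  set (g := fun i => (f i / D) mod TL).
  assert (Hg : forall i, g i < TL) by (intros; apply Nat.mod_upper_bound; lia).
  apply wp_seq. apply wp_tab with (a := 4) (K := 20) (N := TL + 1) (f := fun _ => 0); auto; try lia.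
  { intros i s' Hi F Hx. apply wp_sto; ev; known; repeat split; auto; try lia. cbn [ecost]. lia. }
  intros s1 F1 A1 C1. carry F1.
  assert (E1 : ar s1 X = ar s X). { apply F1. cbn -[Nat.eqb]. now rewrite HX4. }
  clear F1.
  (* A digit is counted one cell further up, so that the prefix sums yield the number of smaller
     digits, which is the first target position of each digit. *)
  apply wp_seq. apply wp_for with (K := 40) (N := N)
    (I := fun i s' => forall k, k <= TL -> ar s' 4 k = cnt_eq (fun i => g i + 1) i k); auto; try lia.
  { intros k Hk. rewrite A1 by lia. reflexivity. }
  { intros i s' Hi F I1 Hx. carry F.
    assert (E2 : ar s' X = ar s X). { rewrite <- E1. apply F. cbn -[Nat.eqb]. now rewrite HX4. }
    clear F. specialize (Hg i).
    asg k Ek; rewrite ?E2, ?Hf by auto; fold (g i); try lia.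
    rewrite Hf in Ek by auto. fold (g i) in Ek.
    assert (Hc : cnt_eq (fun i => g i + 1) i k <= i).
    { apply cnt_eq_le. }
    apply wp_sto; ev; rewrite ?I1 by lia; repeat split; auto; try lia.
    - intros k' Hk'. rewrite cnt_eq_S.
      rewrite <- Ek. unfold wr, upd. rewrite (Nat.eqb_sym k' k).
      destruct (Nat.eqb_spec k k'); subst; cbn [b2n]; rewrite ?I1; lia.
    - cbn [ecost bcost]. lia. }
  intros s2 F2 A2 _ C2. carry F2.
  assert (E2 : ar s2 X = ar s X). { rewrite <- E1. apply F2. cbn -[Nat.eqb]. now rewrite HX4. }
  clear F2.
  assert (Ec : forall k, cnt_eq (fun i => g i + 1) N (S k) = cnt_eq g N k).
  { intros k. apply sumn_ext. intros. f_equal. rewrite Nat.add_1_r. reflexivity. }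
  assert (Hc : forall k, cnt_eq g N k <= N).
  { intros k. apply cnt_eq_le. }
  apply wp_seq. apply wp_for with (K := 40) (N := TL)
    (I := fun i s' => (forall k, k <= i -> ar s' 4 k = cnt_lt g N k) /\
             (forall k, i < k -> k <= TL -> ar s' 4 k = cnt_eq (fun i => g i + 1) N k)); auto; try lia.
  { split; intros k Hk; [|intros; apply A2; lia]. replace k with 0 by lia. rewrite A2 by lia.
    unfold cnt_eq, cnt_lt. apply sumn_ext. intros. rewrite Nat.add_1_r. reflexivity. }
  { intros i s' Hi F (I1 & I2) Hx. clear F. pose proof (cnt_lt_le g N i). specialize (Hc i).
    apply wp_sto; ev; known; rewrite ?I2, ?I1, ?Nat.add_1_r, ?Ec by lia; repeat split; auto; try lia.
    - intros k Hk. destruct (Nat.eq_dec k (S i)) as [->|Hki].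
      + rewrite wr_eq, cnt_lt_S. lia.
      + rewrite wr_neq by lia. apply I1. lia.
    - intros k Hk Hk2. rewrite wr_neq by lia. apply I2; lia.
    - cbn [ecost bcost]. lia. }
  intros s3 F3 (A3 & _) _ C3. carry F3.
  assert (E3 : ar s3 X = ar s X). { rewrite <- E2. apply F3. cbn -[Nat.eqb]. now rewrite HX4. }
  clear F3.
  apply wp_seq. apply wp_for with (K := 60) (N := N)
    (I := fun i s' => (forall k, k < TL -> ar s' 4 k = cnt_lt g N k + cnt_eq g i k) /\
             (forall j, j < i -> ar s' 3 (rank g N j) = f j)); auto; try lia.
  { split; [|intros; lia]. intros k Hk. rewrite A3 by lia. unfold cnt_eq. cbn [sumn]. lia. }
  { intros i s' Hi F (I1 & I2) Hx. carry F.
    assert (E4 : ar s' X = ar s X).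
    { rewrite <- E3. apply F. cbn -[Nat.eqb]. now rewrite HX3, HX4. }
    clear F. pose proof (Hg i) as Hgi. pose proof (rank_lt g N i Hi) as Hr.
    asg k Ek. rewrite Hf in Ek by auto. fold (g i) in Ek. subst k.
    asg ps Ep. rewrite I1 in Ep by auto. change (ps = rank g N i) in Ep. rewrite <- Ep in Hr.
    apply wp_seq, wp_sto; ev; auto; try lia.
    apply wp_sto; ev; known; rewrite ?E4, ?Hf by auto; repeat split; auto; try lia.
    - intros k Hk. rewrite cnt_eq_S.
      unfold wr, upd. rewrite (Nat.eqb_sym k (g i)).
      destruct (Nat.eqb_spec (g i) k); subst; simpl; [|rewrite I1; lia].
      unfold rank. lia.
    - intros j Hj. destruct (Nat.eq_dec j i) as [->|Hji].
      + rewrite Ep. apply wr_eq.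
      + rewrite wr_neq; [apply I2; lia|]. intros HH. apply Hji. eapply (rank_inj g N); auto; lia.
    - cbn [ecost bcost]. lia. }
  intros s4 F4 (_ & A4) _ C4. carry F4. clear F4.
  apply wp_tab with (a := X) (K := 20) (N := N) (f := ar s4 3); auto; try lia.
  { intros i s' Hi F Hx.
    assert (E5 : ar s' 3 = ar s4 3). { apply F. cbn -[Nat.eqb]. now rewrite (Nat.eqb_sym 3 X), HX3. }
    apply wp_sto; ev; known; repeat split; auto; try lia.
    - unfold aset. now rewrite Nat.eqb_refl.
    - cbn [ecost]. lia. }
  intros s5 F5 A5 C5. split; [|lia].
  intros i Hi. rewrite A5 by (apply rank_lt; auto). apply A4; auto.
Qed.

Definition sorted_arr (X : nat -> nat) (N : nat) : Prop := forall i j, i <= j -> j < N -> X i <= X j.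

Lemma wp_sort X s N L c TL f :
  X < 3 -> va s 3 = TL -> TL = 2 ^ L -> va s 13 = N -> va s 12 = c -> w = c * L -> 1 <= c ->
  (forall i, i < N -> ar s X i = f i /\ f i < 2 ^ w) -> c < 2 ^ w ->
  80 + 16 * (N + TL + 2) < 2 ^ w ->
  wp w inp (p_sort X) s (fun s' =>
    Permutation (map (ar s' X) (seq 0 N)) (map f (seq 0 N)) /\ sorted_arr (ar s' X) N /\
    ck s' <= ck s + c * (200 * (N + TL) + 150) + 100).
Proof.
  intros HX H3 HTL H13 H12 Hw Hc Hf HcW HW. unfold p_sort.
  assert (HTL0 : 0 < TL) by (rewrite HTL; apply pow2_gt0).
  asg tl1 Etl. asg D0 ED0.
  (* After the last pass the divisor would be [2 ^ w] and wraps around to zero, hence its value is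
     claimed only for [t < c]. *)
  apply wp_for with (K := 200 * (N + TL) + 120) (N := c)
    (I := fun t s' => (t < c -> va s' 14 = 2 ^ (t * L)) /\
      Permutation (map (ar s' X) (seq 0 N)) (map f (seq 0 N)) /\
      (forall i j, i <= j -> j < N -> ar s' X i mod 2 ^ (t * L) <= ar s' X j mod 2 ^ (t * L))); auto; try lia.
  - cbn [ar va upd Nat.eqb]. repeat split; auto.
    erewrite map_ext_in; [reflexivity|]. intros i Hi. apply in_seq in Hi. apply Hf. lia.
  - intros t s' Ht F (I1 & I2 & I3) Hx. carry F.
    assert (H15 : va s' 15 = TL + 1) by (rewrite (proj1 F 15 eq_refl); exact Etl).
    assert (H3' : va s' 3 = TL) by (rewrite (proj1 F 3 eq_refl); exact H3).
    assert (H13' : va s' 13 = N) by (rewrite (proj1 F 13 eq_refl); exact H13).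
    clear F. specialize (I1 Ht).
    apply wp_seq. eapply wp_conseq_fr.
    { apply (wp_pass X s' N TL (2 ^ (t * L)) (ar s' X)); auto. }
    intros s1 F1 (A1 & C1). carry F1. clear F1.
    set (g := fun i => (ar s' X i / 2 ^ (t * L)) mod TL) in *.
    assert (Hperm : Permutation (map (rank g N) (seq 0 N)) (seq 0 N)).
    { apply map_perm_seq; intros; [apply rank_lt; auto|eapply rank_inj; eauto]. }
    assert (Hsurj : forall p, p < N -> exists i, i < N /\ p = rank g N i).
    { intros p Hp. assert (In p (map (rank g N) (seq 0 N))) as Hin.
      { eapply Permutation_in; [symmetry; exact Hperm|]. apply in_seq. lia. }
      apply in_map_iff in Hin as (i & Ei & Hi). apply in_seq in Hi. exists i. split; auto; lia. }
    asg D' ED'. cbn [ck]. repeat split.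
    + intros Ht'. rewrite ED'. rewrite Nat.mod_small; rewrite HTL, <- Nat.pow_add_r.
      * f_equal. lia.
      * apply Nat.pow_lt_mono_r; [lia|]. rewrite Hw.
        assert (L <> 0). { intros ->. rewrite Nat.mul_0_r in Hw. subst w. simpl in HW. lia. }
        nia.
    + rewrite <- I2. transitivity (map (ar s1 X) (map (rank g N) (seq 0 N))).
      * apply Permutation_map. symmetry. exact Hperm.
      * rewrite map_map. erewrite map_ext_in; [reflexivity|].
        intros i Hi. apply in_seq in Hi. apply A1. lia.
    + intros p q Hpq Hq. destruct (Nat.eq_dec p q) as [->|Hne]; [lia|].
      destruct (Hsurj p ltac:(lia)) as (i & Hi & ->). destruct (Hsurj q Hq) as (j & Hj & ->).
      rewrite !A1 by auto.
      assert (Hmod : forall x, x mod 2 ^ (S t * L) = ((x / 2 ^ (t * L)) mod TL) * 2 ^ (t * L) + x mod 2 ^ (t * L)).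
      { intros x. cbn [Nat.mul]. rewrite Nat.add_comm, Nat.pow_add_r, <- HTL.
        rewrite Nat.Div0.mod_mul_r. lia. }
      rewrite !Hmod. fold (g i) (g j).
      assert (Hlow : forall x, x mod 2 ^ (t * L) < 2 ^ (t * L)).
      { intros. apply Nat.mod_upper_bound. pose proof (pow2_gt0 (t * L)). lia. }
      (* Either the new digits differ and decide, or they agree and stability preserves the order by
         lower bits that the earlier passes achieved. *)
      destruct (rank_order g N i j Hi Hj ltac:(lia)) as [Hg1|[Hg1 Hg2]].
      * pose proof (Hlow (ar s' X i)) as HL. clear - Hg1 HL. nia.
      * rewrite Hg1. pose proof (I3 i j ltac:(lia) Hj). lia.
    + cbn [ecost bcost]. lia.
  - intros s' F (_ & I2 & I3) _ C. cbn [ck ecost bcost] in C.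
    split; [|split].
    + exact I2.
    + intros i j Hij Hj. specialize (I3 i j Hij Hj). rewrite <- Hw in I3.
      assert (Hlt : forall i, i < N -> ar s' X i < 2 ^ w).
      { intros k Hk. assert (In (ar s' X k) (map f (seq 0 N))) as Hin.
        { eapply Permutation_in; [exact I2|]. apply in_map, in_seq. lia. }
        apply in_map_iff in Hin as (k' & <- & Hk'). apply in_seq in Hk'. apply Hf. lia. }
      rewrite !Nat.mod_small in I3 by (apply Hlt; lia). exact I3.
    + lia.
Qed.

End Sort.

(** * Preprocessing *)

(* Global scalars: 0 n, 1 L, 2 word size, 3 2^L, 4 l, 5 M = 2^l, 6 divisor of the
   hash function, 7 random multiplier, 8 2^((k+1)L), 9 n^2, 10 2M, 11 l+1, 12 word size / L,
   29 2^2L, 30 2^((k+3)L).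
   Arrays: 0 A sorted, 1 B sorted, 2 sorted records, 5 first record of each
   bucket, 6 next record with another bucket or another sum. *)
Notation e_hash e := (V 7 *~ e /: V 6).

Definition p_init (k : nat) : cmd :=
  0 <- EIn (C 0) ;; 1 <- C 1 ;; 13 <- V 0 /: C 2 ;;
  CWhile (V 13) (1 <- V 1 +: C 1 ;; 13 <- V 13 /: C 2) ;;
  12 <- C (k + 20) ;; 2 <- V 12 *: V 1 ;; 3 <- C 1 <<: V 1 ;;
  4 <- C 1 ;; 5 <- C 2 ;; 14 <- V 3 *: V 3 *: V 3 ;;
  CWhile (V 5 *: V 1 *: (V 5 *: V 1) <: V 14) (4 <- V 4 +: C 1 ;; 5 <- C 2 *: V 5) ;;
  6 <- C 1 <<: (V 2 -: V 4) ;; 8 <- C 1 <<: (C (k + 1) *: V 1) ;; 9 <- V 0 *: V 0 ;;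
  10 <- C 2 *: V 5 ;; 11 <- V 4 +: C 1 ;; 29 <- V 3 *: V 3 ;; 30 <- V 29 *: V 8.

Definition p_rand : cmd := 7 <- C 0 ;; CFor 13 2 (CRnd 14 ;; 7 <- C 2 *: V 7 +: V 14).

Definition p_read : cmd :=
  CFor 13 0 (CSto 0 (V 13) (EIn (V 13 +: C 1))) ;;
  CFor 13 0 (CSto 1 (V 13) (EIn (V 13 +: V 0 +: C 1))) ;;
  13 <- V 0 ;; p_sort 0 ;; p_sort 1.

(* The record of the pair (i, j) packs its bucket, its sum, i and j in one word. *)
Definition p_build : cmd :=
  CFor 20 0 (CFor 21 0 (
    22 <- (e_hash (EArr 0 (V 20)) +: e_hash (EArr 1 (V 21))) %: V 5 ;;
    CSto 2 (V 20 *: V 0 +: V 21)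
      (((V 22 *: V 8 +: (EArr 0 (V 20) +: EArr 1 (V 21))) *: V 3 +: V 20) *: V 3 +: V 21))) ;;
  13 <- V 9 ;; p_sort 2.

(** The scan runs from right to left: the last write to a cell of array 5 is the leftmost record of
    the bucket, and array 6 can copy the pointer of the right neighbour when bucket and sum agree.
    Empty buckets keep [n * n], the position past the end. *)
Definition p_index : cmd :=
  CFor 16 5 (CSto 5 (V 16) (V 9)) ;;
  CFor 16 9 (
    17 <- V 9 -: C 1 -: V 16 ;; 18 <- EArr 2 (V 17) ;;
    CSto 5 (V 18 /: V 30) (V 17) ;;
    19 <- (V 17 +: C 1 <: V 9) *: (EArr 2 (V 17 +: C 1) /: V 29 =: V 18 /: V 29) ;;
    CIf (V 19) (CSto 6 (V 17) (EArr 6 (V 17 +: C 1))) (CSto 6 (V 17) (V 17 +: C 1))).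

Definition p_prep (k : nat) : cmd := p_init k ;; p_rand ;; p_read ;; p_build ;; p_index.

(** * Sizes of words, tables and hash values *)

Definition Ln (n : nat) : nat := Nat.log2 n + 1.
Definition TLn (n : nat) : nat := 2 ^ Ln n.

(** Searches from [l] upwards for an exponent with [2 ^ l * L] at least the power 1.5 of [2 ^ L];
    both sides are squared to avoid the root. [p_init] runs the same search. *)
Fixpoint lfind (f L l : nat) : nat :=
  match f with 0 => l | S f => if 8 ^ L <=? (2 ^ l * L) * (2 ^ l * L) then l else lfind f L (S l) end.

(* [M = 2^l] hash values; the choice makes [M L] of order [n^1.5]. *)
Definition lpar (n : nat) : nat := lfind (2 * Ln n) (Ln n) 1.
Definition Mn (n : nat) : nat := 2 ^ lpar n.
(** A record takes at most [k + 5] groups of [L] bits: two for the bucket, [k + 1] for the sum, one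
    for each index. The surplus provides for addresses and for the undivided convolution when [k] is
    small. *)
Definition wn (k n : nat) : nat := word_size (k + 20) n.
Definition Un (k n : nat) : nat := 2 ^ (wn k n - lpar n).
(** A base for packing that exceeds every sum of two numbers below [n ^ k]. *)
Definition SKn (k n : nat) : nat := 2 ^ ((k + 1) * Ln n).

Definition hashn (k n sh x : nat) : nat := (sh * x) mod 2 ^ wn k n / Un k n.

Lemma wn_eq k n : wn k n = (k + 20) * Ln n.
Proof. reflexivity. Qed.

Lemma Ln_pos n : 1 <= Ln n.
Proof. unfold Ln; lia. Qed.

Lemma n_lt_TL n : n < TLn n.
Proof.
  unfold TLn, Ln. rewrite Nat.add_1_r. destruct n; [simpl; lia|].
  apply Nat.log2_spec. lia.
Qed.

Lemma TL_le n : 1 <= n -> TLn n <= 2 * n.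
Proof.
  intros H. unfold TLn, Ln. rewrite Nat.add_1_r, Nat.pow_succ_r'.
  apply Nat.mul_le_mono_l. apply Nat.log2_spec. lia.
Qed.

Lemma Ln_lt_TL n : Ln n < TLn n.
Proof. apply Nat.pow_gt_lin_r. lia. Qed.

Lemma TL_ge2 n : 2 <= TLn n.
Proof. pose proof (Ln_lt_TL n). pose proof (Ln_pos n). lia. Qed.

Lemma lfind_spec f L : forall l, l <= lfind f L l <= l + f /\
  (lfind f L l < l + f -> 8 ^ L <= (2 ^ lfind f L l * L) * (2 ^ lfind f L l * L)) /\
  (lfind f L l = l \/ (2 ^ (lfind f L l - 1) * L) * (2 ^ (lfind f L l - 1) * L) < 8 ^ L).
Proof.
  induction f as [|f IH]; intros l; cbn [lfind]; [repeat split; try lia; auto|].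
  destruct (Nat.leb_spec (8 ^ L) ((2 ^ l * L) * (2 ^ l * L))) as [H|H]; [repeat split; try lia; auto|].
  destruct (IH (S l)) as (A & B & [C|C]).
  - split; [lia|split; [intros; apply B; lia|]]. right. rewrite C. replace (S l - 1) with l by lia. exact H.
  - split; [lia|split; [intros; apply B; lia|]]. right. exact C.
Qed.

Lemma pow8 L : 8 ^ L = 2 ^ L * 2 ^ L * 2 ^ L.
Proof. change 8 with (2 * 2 * 2). now rewrite !Nat.pow_mul_l. Qed.

(** From [l = 2 L] on the square is at least [2 ^ (4 L)], beyond the threshold [2 ^ (3 L)]; so the
    fuel of [lpar] suffices. *)
Lemma lfind_stop L l : 1 <= L -> 2 * L <= l -> 8 ^ L <= (2 ^ l * L) * (2 ^ l * L).
Proof.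
  intros HL Hl. pose proof (pow2_le (2 * L) l Hl) as H.
  replace (2 * L) with (L + L) in H by lia. rewrite Nat.pow_add_r in H.
  rewrite pow8. pose proof (pow2_gt0 L) as Hp. set (T := 2 ^ L) in *. set (P := 2 ^ l) in *.
  clearbody T P. assert (T * T * (T * T) <= P * P) by (apply Nat.mul_le_mono; auto).
  assert (P * P <= (P * L) * (P * L)) by (apply Nat.mul_le_mono; clear - HL; nia).
  assert (T * T * T <= T * T * (T * T)) by (clear - Hp; nia). lia.
Qed.

Lemma lpar_bounds n : 1 <= lpar n <= 2 * Ln n.
Proof.
  unfold lpar. pose proof (Ln_pos n) as HL.
  destruct (lfind_spec (2 * Ln n) (Ln n) 1) as (A & B & C).
  split; [lia|]. destruct C as [C|C]; [lia|].
  destruct (Nat.le_gt_cases (lfind (2 * Ln n) (Ln n) 1) (2 * Ln n)); auto.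
  pose proof (lfind_stop (Ln n) (lfind (2 * Ln n) (Ln n) 1 - 1) HL ltac:(lia)). lia.
Qed.

Lemma lpar_lower n : TLn n * TLn n * TLn n <= (Mn n * Ln n) * (Mn n * Ln n).
Proof.
  unfold TLn, Mn. rewrite <- pow8. pose proof (lpar_bounds n).
  unfold lpar in *. apply lfind_spec. lia.
Qed.

(** The previous exponent failed the test and one more step doubles [M], whence the factor 4 between
    squares. If the search stops at once, [M = 2], and [L < 2 ^ L] is enough. *)
Lemma lpar_upper n : (Mn n * Ln n) * (Mn n * Ln n) <= 4 * (TLn n * TLn n * TLn n).
Proof.
  unfold TLn, Mn. rewrite <- pow8. pose proof (lpar_bounds n) as HB. unfold lpar in *.
  destruct (lfind_spec (2 * Ln n) (Ln n) 1) as (_ & _ & [E|H]).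
  - rewrite E. pose proof (Ln_lt_TL n) as HL. unfold TLn in HL. rewrite pow8.
    pose proof (TL_ge2 n) as H2. unfold TLn in H2.
    set (T := 2 ^ Ln n) in *. set (L := Ln n) in *. clearbody T L. clear - HL H2.
    assert (L * L <= T * T) by (apply Nat.mul_le_mono; lia). rewrite Nat.pow_1_r. nia.
  - set (l := lfind _ _ _) in *. replace l with (S (l - 1)) by lia. rewrite Nat.pow_succ_r'. nia.
Qed.

Lemma M_le n : Mn n <= TLn n * TLn n.
Proof.
  unfold Mn, TLn. rewrite <- Nat.pow_add_r. apply pow2_le. pose proof (lpar_bounds n). lia.
Qed.

Lemma big_word k n : 1 <= k -> 160 * 2 ^ (12 * Ln n) < 2 ^ wn k n.
Proof.
  intros Hk. rewrite wn_eq. pose proof (Ln_pos n).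
  apply (Nat.le_lt_trans _ (2 ^ (8 * Ln n) * 2 ^ (12 * Ln n))).
  - apply Nat.mul_le_mono_r. transitivity (2 ^ 8); [simpl; lia|apply pow2_le; lia].
  - rewrite <- Nat.pow_add_r. apply Nat.pow_lt_mono_r; nia.
Qed.

Lemma pow_TL j n : 2 ^ (j * Ln n) = TLn n ^ j.
Proof. unfold TLn. rewrite <- Nat.pow_mul_r. f_equal. lia. Qed.

Lemma nk_lt k n : 1 <= k -> n ^ k < 2 ^ (k * Ln n).
Proof.
  intros Hk. rewrite pow_TL. apply Nat.pow_lt_mono_l; [lia|apply n_lt_TL].
Qed.

Lemma SK_ge k n : 1 <= k -> 2 * 2 ^ (k * Ln n) <= SKn k n.
Proof.
  intros Hk. unfold SKn. rewrite Nat.mul_add_distr_r, Nat.pow_add_r.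
  pose proof (TL_ge2 n). unfold TLn in *. rewrite Nat.mul_1_l. nia.
Qed.

Lemma word_bits k n : Mn n * SKn k n * (TLn n * TLn n) * 2 ^ (15 * Ln n) <= 2 ^ wn k n.
Proof.
  unfold Mn, SKn, TLn. rewrite <- !Nat.pow_add_r. apply pow2_le. rewrite wn_eq.
  pose proof (lpar_bounds n). nia.
Qed.

Lemma M_pos n : 2 <= Mn n.
Proof. unfold Mn. pose proof (lpar_bounds n). apply (pow2_le 1). lia. Qed.

Definition bval (acc : nat) (r : list bool) : nat := fold_left (fun a b => 2 * a + b2n b) r acc.

Lemma bval_lt r : forall acc e, acc < 2 ^ e -> bval acc r < 2 ^ (e + length r).
Proof.
  induction r as [|b r IH]; intros acc e H; cbn [bval fold_left length]; [now rewrite Nat.add_0_r|].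
  replace (e + S (length r)) with (S e + length r) by lia. apply IH.
  rewrite Nat.pow_succ_r'. destruct b; simpl; lia.
Qed.

Lemma bval_snoc acc r b : bval acc (r ++ [b]) = 2 * bval acc r + b2n b.
Proof. unfold bval. now rewrite fold_left_app. Qed.

Lemma firstn_S_skipn {A} m (r : list A) b r' : skipn m r = b :: r' ->
  firstn (S m) r = firstn m r ++ [b] /\ skipn (S m) r = r'.
Proof.
  revert r; induction m as [|m IH]; intros [|x r] H; simpl in H; try discriminate.
  - inversion H; subst. auto.
  - apply IH in H as [H1 H2]. rewrite !firstn_cons, skipn_cons, H1. auto.
Qed.

Lemma map_nth_seq0 (A : list nat) : map (fun i => nth i A 0) (seq 0 (length A)) = A.
Proof.
  induction A as [|x A IH]; [reflexivity|]. cbn [length seq map]. f_equal.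
  rewrite <- seq_shift, map_map. exact IH.
Qed.

Lemma pack_lt a b A B : a < A -> b < B -> a * B + b < A * B.
Proof. intros. nia. Qed.

(** Bucket and sum are the leading digits, so sorting the words orders the records by bucket and
    then by sum, and dropping the two indices leaves a key made of exactly these two. *)
Definition enc (k n sh : nat) (a b : nat -> nat) (i j : nat) : nat :=
  (((hashn k n sh (a i) + hashn k n sh (b j)) mod Mn n * SKn k n + (a i + b j)) * TLn n + i) * TLn n + j.

(** [v] is where the run of equal keys that starts at or before [p] ends. *)
Definition nxok (K : nat -> nat) (N p v : nat) : Prop :=
  p < v <= N /\ (forall p', p <= p' < v -> K p' = K p) /\ (v < N -> K v <> K p).

(** The first position of bucket [r]; if the bucket is empty, the conditions force [v = N]. *)
Definition startok (g : nat -> nat) (N r v : nat) : Prop :=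
  v <= N /\ (forall p, p < N -> g p = r -> v <= p) /\ (v < N -> g v = r).

(** * Correctness and cost of the preprocessing *)

Section Prep.
Variables (k n : nat).
Hypothesis Hk : 1 <= k.
Variable inp : list nat.

Local Notation w := (wn k n).
Local Notation L := (Ln n).
Local Notation TL := (TLn n).
Local Notation M := (Mn n).
Local Notation l := (lpar n).
Local Notation SK := (SKn k n).
Local Notation U := (Un k n).

Definition penv (s : state) : Prop :=
  va s 0 = n /\ va s 1 = L /\ va s 2 = w /\ va s 3 = TL /\ va s 4 = l /\ va s 5 = M /\
  va s 6 = U /\ va s 8 = SK /\ va s 9 = n * n /\ va s 10 = 2 * M /\ va s 11 = l + 1 /\
  va s 12 = k + 20 /\ va s 29 = TL * TL /\ va s 30 = TL * TL * SK.

Lemma penv_fr c s s' : fr c s s' ->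
  forallb (fun x => negb (mv c x)) [0;1;2;3;4;5;6;8;9;10;11;12;29;30] = true -> penv s -> penv s'.
Proof.
  intros (F & _) H. cbn [forallb] in H. rewrite !andb_true_iff, !negb_true_iff in H.
  unfold penv. rewrite !F by tauto. auto.
Qed.

(* [X12] bounds every address and index of the program. *)
Let X12 := 2 ^ (12 * L).

Lemma X12_word : 1 <= X12 /\ 160 * X12 < 2 ^ w.
Proof. split; [apply pow2_gt0|apply big_word; auto]. Qed.

Lemma X12_TL j : j <= 12 -> TL ^ j <= X12.
Proof. intros H. unfold X12. rewrite <- pow_TL. apply pow2_le. nia. Qed.

Lemma X12_facts : n < TL /\ L < TL /\ 2 <= TL /\ TL * TL * TL * TL <= X12 /\ M <= TL * TL /\
  TL * TL <= TL * TL * TL * TL /\ TL <= TL * TL /\ n * n <= TL * TL /\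
  TL * TL * TL <= TL * TL * TL * TL.
Proof.
  pose proof (n_lt_TL n). pose proof (Ln_lt_TL n). pose proof (TL_ge2 n) as H2.
  pose proof (X12_TL 4 ltac:(lia)) as H4. pose proof (M_le n).
  cbn [Nat.pow] in H4. rewrite Nat.mul_1_r in H4.
  repeat split; auto; try lia; clear H4; set (T := TL) in *; clearbody T.
  - clear - H2. nia.
  - clear - H2. nia.
  - clear - H. nia.
  - clear - H2. nia.
Qed.

Lemma k_small : k + 20 < 2 ^ w.
Proof.
  rewrite wn_eq. pose proof (Ln_pos n). pose proof (Nat.pow_gt_lin_r 2 ((k + 20) * L) ltac:(lia)). nia.
Qed.

Lemma w_small : w < 2 ^ w.
Proof. apply Nat.pow_gt_lin_r. lia. Qed.

Lemma init_spec s : nth 0 inp 0 = n ->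
  wp w inp (p_init k) s (fun s' => penv s' /\ ck s' <= ck s + 100 * L + 200).
Proof.
  intros Hinp. pose proof X12_word as HX. pose proof X12_facts as (B1 & B2 & B3 & B4 & B5 & B6 & B7 & B8 & B9).
  pose proof (Ln_pos n) as HL. pose proof k_small as Hks. pose proof w_small as Hws.
  unfold p_init.
  asg v0 E0. subst v0. asg v1 Ev1. asg v13 E13. rewrite Hinp in *.
  pose proof (pow2_gt0 L) as HTp.
  (* Hence the halving loop stops with scalar 1 equal to [L], also for [n = 0], where [L = 1]. *)
  assert (Hdiv : forall i, 1 <= i <= L -> n / 2 ^ i = 0 <-> i = L).
  { intros i Hi. split.
    - intros H0. destruct (Nat.eq_dec i L) as [|Hne]; auto. exfalso.
      apply Nat.div_small_iff in H0; [|pose proof (pow2_gt0 i); lia].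
      unfold Ln in Hi, Hne. assert (Hn : n <> 0).
      { intros Hn. rewrite Hn in Hi, Hne. change (Nat.log2 0) with 0 in Hi, Hne. lia. }
      pose proof (Nat.log2_spec n ltac:(lia)) as [HH _].
      pose proof (pow2_le i (Nat.log2 n) ltac:(lia)). lia.
    - intros ->. apply Nat.div_small. exact B1. }
  apply wp_seq. apply wp_while with (m := L - 1) (I := fun m s' => exists i, 1 <= i <= L /\ m = L - i /\
    va s' 0 = n /\ va s' 1 = i /\ va s' 13 = n / 2 ^ i /\ ck s' <= ck s + 20 * i + 20).
  { exists 1. ev. rewrite Ev1, E13. repeat split; try lia. cbn [ecost bcost]. lia. }
  intros m s' (i & Hi & Em & A0 & A1 & A13 & Ck). split; [ev; auto|]. ev. rewrite A13. split.
  2:{ intros Hne. rewrite (Hdiv i Hi) in Hne. asg i1 Ei1.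
    apply wp_asg; [ev; repeat split; auto; lia|]. intros h Eh. ev_in Eh. rewrite A13 in Eh. ev.
    exists (m - 1). split; [lia|]. exists (S i).
    rewrite Eh, Ei1, Nat.pow_succ_r', (Nat.mul_comm 2), Nat.Div0.div_div.
    repeat split; auto; try lia. cbn [ecost bcost]. lia. }
  intros H0. apply (Hdiv i Hi) in H0. subst i. clear A13 Hi Hdiv.
  assert (HT4 : 4 * (TL * TL) <= TL * TL * TL * TL).
  { clear - B3. set (T := TL) in *. clearbody T. nia. }
  asg v12 E12. asg v2 E2'; rewrite ?E12, <- ?wn_eq; try lia. rewrite E12, <- wn_eq in E2'.
  asg v3 E3'; rewrite ?Nat.mul_1_l; change (2 ^ L) with TL; try lia. rewrite Nat.mul_1_l in E3'.
  change (2 ^ L) with TL in E3'.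
  asg v4 E4'. asg v5 E5'. asg v14 E14; rewrite ?E3'; try lia. rewrite E3' in E14.
  (* The clause on [lfind] says that the search resumed at [i] with the remaining fuel still ends in
     [l], so the loop follows [lfind] step by step. *)
  apply wp_seq. apply wp_while with (m := 2 * L) (I := fun m s1 => exists i, 1 <= i <= 2 * L /\ m = 2 * L - i + 1 /\
    va s1 0 = n /\ va s1 1 = L /\ va s1 2 = w /\ va s1 3 = TL /\ va s1 12 = k + 20 /\
    va s1 4 = i /\ va s1 5 = 2 ^ i /\ va s1 14 = TL * TL * TL /\ lfind (2 * L + 1 - i) L i = l /\
    ck s1 <= ck s' + 40 * i + 100).
  { exists 1. ev. rewrite E5'. change (2 ^ 1) with 2.
    repeat split; auto; try lia; [unfold lpar; f_equal; lia|]. cbn [ecost bcost]. lia. }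
  clear v2 E2' v3 E3' v4 E4' v5 E5' v14 E14.
  intros m1 s1 (i & Hi & Em1 & Z0 & Z1 & A2 & A3 & A12 & A4 & A5 & A14 & Alf & Ck1).
  assert (HP : 2 ^ i <= TL * TL).
  { unfold TLn. rewrite <- Nat.pow_add_r. apply pow2_le. lia. }
  assert (HPL : 2 ^ i * L <= TL * TL * TL) by (apply Nat.mul_le_mono; lia).
  assert (HPL2 : 2 ^ i * L * (2 ^ i * L) <= X12).
  { etransitivity; [|apply (X12_TL 6); lia]. cbn [Nat.pow]. rewrite Nat.mul_1_r.
    transitivity (TL * TL * TL * (TL * TL * TL)); [apply Nat.mul_le_mono; auto|lia]. }
  split; [ev; known; repeat split; auto; lia|]. ev. known. split.
  2:{ destruct (Nat.ltb_spec (2 ^ i * L * (2 ^ i * L)) (TL * TL * TL)) as [Hlt|]; [|congruence].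
    intros _.
    assert (Hi2 : i < 2 * L).
    { destruct (Nat.le_gt_cases (2 * L) i) as [Hge|]; auto.
      pose proof (lfind_stop L i HL Hge) as HH. rewrite pow8 in HH. change (2 ^ L) with TL in HH. lia. }
    asg i1 Ei1. apply wp_asg; [ev; known; repeat split; auto; lia|]. intros h Eh. ev_in Eh. rewrite A5 in Eh. ev.
    exists (m1 - 1). split; [lia|]. exists (S i). rewrite Nat.pow_succ_r'.
    replace (2 * L + 1 - i) with (S (2 * L + 1 - S i)) in Alf by lia. cbn [lfind] in Alf.
    rewrite pow8 in Alf. change (2 ^ L) with TL in Alf.
    destruct (Nat.leb_spec (TL * TL * TL) (2 ^ i * L * (2 ^ i * L))) as [Hge|_]; [lia|].
    repeat split; auto; try lia. cbn [ecost bcost]. lia. }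
  destruct (Nat.ltb_spec (2 ^ i * L * (2 ^ i * L)) (TL * TL * TL)) as [|Hge]; [discriminate|].
  intros _.
  replace (2 * L + 1 - i) with (S (2 * L + 1 - S i)) in Alf by lia. cbn [lfind] in Alf.
  rewrite pow8 in Alf. change (2 ^ L) with TL in Alf.
  destruct (Nat.leb_spec (TL * TL * TL) (2 ^ i * L * (2 ^ i * L))) as [_|Hlt]; [|lia].
  rewrite Alf in *. change (2 ^ l) with M in *.
  pose proof (lpar_bounds n) as Hl12.
  assert (HU : U < 2 ^ w) by (apply Nat.pow_lt_mono_r; rewrite ?wn_eq, ?Nat.mul_add_distr_r; lia).
  assert (HSK : TL * TL * SK < 2 ^ w).
  { unfold TLn, SKn. rewrite <- !Nat.pow_add_r. apply Nat.pow_lt_mono_r; rewrite ?wn_eq, ?Nat.mul_add_distr_r; lia. }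
  assert (HSK1 : SK <= TL * TL * SK).
  { rewrite <- (Nat.mul_1_l SK) at 1. apply Nat.mul_le_mono_r. lia. }
  assert (HkL : (k + 1) * L <= w) by (rewrite wn_eq; apply Nat.mul_le_mono_r; lia).
  assert (Hlw : l <= w) by (rewrite wn_eq, Nat.mul_add_distr_r; lia).
  asg v6 E6; [rewrite Nat.mul_1_l; exact HU|]. rewrite Nat.mul_1_l in E6.
  asg v8 E8; [rewrite Nat.mul_1_l; unfold SKn in *; lia|]. rewrite Nat.mul_1_l in E8.
  asg v9 E9. asg v10 E10. asg v11 E11. asg v29 E29.
  change (v8 = SK) in E8.
  apply wp_asg; [ev; rewrite E29, E8; auto|]. intros v30 E30. ev_in E30. rewrite E29, E8 in E30.
  split; [unfold penv; ev; repeat split; auto; lia|]. cbn [ck ecost bcost]. lia.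
Qed.

Lemma rand_spec s : penv s -> w <= length (rn s) ->
  wp w inp p_rand s (fun s' => va s' 7 = bval 0 (firstn w (rn s)) /\ rn s' = skipn w (rn s) /\
    ck s' <= ck s + 30 * w + 20).
Proof.
  intros He Hr. pose proof X12_word as HX. pose proof w_small as Hws. unfold p_rand.
  assert (H2 : va s 2 = w) by apply He.
  asg v7 E7.
  apply wp_for with (K := 20) (N := w) (I := fun i s' => va s' 7 = bval 0 (firstn i (rn s)) /\
    rn s' = skipn i (rn s)); auto; try lia.
  - intros i s' Hi F (I1 & I2) Hx.
    destruct (skipn i (rn s)) as [|b r'] eqn:Esk.
    { apply (f_equal (@length bool)) in Esk. rewrite length_skipn in Esk. simpl in Esk. lia. }
    destruct (firstn_S_skipn i (rn s) b r' Esk) as [F1 F2].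
    apply wp_seq. eapply wp_rnd; [exact I2|].
    assert (Hb : bval 0 (firstn (S i) (rn s)) < 2 ^ w).
    { eapply Nat.lt_le_trans; [apply (bval_lt _ 0 0); simpl; lia|]. apply pow2_le.
      rewrite length_firstn. lia. }
    rewrite F1, bval_snoc in Hb.
    apply wp_asg; ev; rewrite I1; [destruct b; cbn [b2n] in Hb; repeat split; auto; lia|].
    intros v Ev. ev. rewrite F1, F2, bval_snoc.
    repeat split; auto. cbn [ecost bcost]. lia.
  - intros s' F (I1 & I2) _ Hc. repeat split; auto. cbn [ck ecost] in Hc. lia.
Qed.

Lemma read_spec s A B : penv s -> inp = n :: A ++ B -> length A = n -> length B = n ->
  (forall x, In x A \/ In x B -> x < n ^ k) ->
  wp w inp p_read s (fun s' =>
    (Permutation (map (ar s' 0) (seq 0 n)) A /\ sorted_arr (ar s' 0) n) /\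
    (Permutation (map (ar s' 1) (seq 0 n)) B /\ sorted_arr (ar s' 1) n) /\
    ck s' <= ck s + 2 * ((k + 20) * (200 * (n + TL) + 150)) + 100 * n + 300).
Proof.
  intros He Hinp HA HB Hlt. pose proof X12_word as HX. pose proof w_small as Hws.
  pose proof X12_facts as (B1 & B2 & B3 & B4 & B5 & B6 & B7 & B8 & B9). pose proof k_small as Hks.
  assert (Hnk : forall x, x < n ^ k -> x < 2 ^ w).
  { intros x Hx. eapply Nat.lt_trans; [exact Hx|]. eapply Nat.lt_le_trans; [apply nk_lt; auto|].
    apply pow2_le. rewrite wn_eq. apply Nat.mul_le_mono_r. lia. }
  assert (HnA : forall i, i < n -> nth i A 0 < 2 ^ w).
  { intros i Hi. apply Hnk, Hlt. left. apply nth_In. lia. }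
  assert (HnB : forall i, i < n -> nth i B 0 < 2 ^ w).
  { intros i Hi. apply Hnk, Hlt. right. apply nth_In. lia. }
  unfold p_read. destruct He as (H0 & H1 & H2 & H3 & _ & _ & _ & _ & _ & _ & _ & H12 & _).
  apply wp_seq. apply wp_tab with (a := 0) (K := 20) (N := n) (f := fun i => nth i A 0); auto; try lia.
  { intros i s' Hi F Hx.
    assert (En : nth (i + 1) inp 0 = nth i A 0).
    { rewrite Hinp, Nat.add_1_r. cbn [nth]. apply app_nth1. lia. }
    apply wp_sto; ev; known; repeat split; auto; try lia; try (rewrite En; auto).
    cbn [ecost bcost]. lia. }
  intros s1 F1 A1 C1. carry F1. clear F1.
  apply wp_seq. apply wp_tab with (a := 1) (K := 20) (N := n) (f := fun i => nth i B 0); auto; try lia.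
  { intros i s' Hi F Hx. carry F.
    assert (En : nth (i + n + 1) inp 0 = nth i B 0).
    { rewrite Hinp, Nat.add_1_r. cbn [nth]. rewrite app_nth2 by lia. f_equal. lia. }
    apply wp_sto; ev; known; repeat split; auto; try lia; try (rewrite En; auto).
    cbn [ecost bcost]. lia. }
  intros s2 F2 A2 C2. carry F2. arrs F2 0. rewrite <- HA0 in A1. clear F2.
  asg v13 E13.
  apply wp_seq. eapply wp_conseq_fr.
  { apply (wp_sort w inp 0 _ n L (k + 20) TL (fun i => nth i A 0)); auto; try lia; ev; auto.
  }
  intros s3 F3 (P1 & S1 & C3). carry F3. arrs F3 1. cbn [ar ck ecost] in *.
  assert (H3' : va s3 3 = TL) by (rewrite (proj1 F3 3 eq_refl); assumption).
  assert (H13' : va s3 13 = n) by (rewrite (proj1 F3 13 eq_refl); assumption).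
  assert (H12' : va s3 12 = k + 20) by (rewrite (proj1 F3 12 eq_refl); assumption).
  clear F3.
  eapply wp_conseq_fr.
  { apply (wp_sort w inp 1 _ n L (k + 20) TL (fun i => nth i B 0)); auto; try lia.
    intros i Hi. rewrite HA1. split; auto. }
  intros s4 F4 (P2 & S2 & C4). arrs F4 0. rewrite HA2.
  rewrite <- HA in P1 at 2. rewrite map_nth_seq0 in P1.
  rewrite <- HB in P2 at 2. rewrite map_nth_seq0 in P2.
  repeat split; auto. lia.
Qed.

Lemma hashn_lt sh x : hashn k n sh x < M.
Proof.
  unfold hashn, Un, Mn. pose proof (lpar_bounds n).
  assert (l <= w) by (rewrite wn_eq, Nat.mul_add_distr_r; lia).
  apply Nat.Div0.div_lt_upper_bound. rewrite <- Nat.pow_add_r.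
  replace (w - l + l) with w by lia. apply Nat.mod_upper_bound. pose proof (pow2_gt0 w). lia.
Qed.

Lemma sum_lt_SK x y : x < n ^ k -> y < n ^ k -> x + y < SK.
Proof. intros Hx Hy. pose proof (nk_lt k n Hk). pose proof (SK_ge k n Hk). lia. Qed.

Section Enc.
Variables (sh : nat) (a b : nat -> nat).
Hypothesis Ha : forall i, i < n -> a i < n ^ k.
Hypothesis Hb : forall i, i < n -> b i < n ^ k.

Local Notation bkt i j := ((hashn k n sh (a i) + hashn k n sh (b j)) mod M).
Local Notation enc := (enc k n sh a b).

Lemma bkt_lt i j : bkt i j < M.
Proof. apply Nat.mod_upper_bound. pose proof (M_pos n). lia. Qed.

Lemma enc_parts i j : i < n -> j < n ->
  bkt i j * SK + (a i + b j) < M * SK /\ (bkt i j * SK + (a i + b j)) * TL + i < M * SK * TL /\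
  enc i j < M * SK * TL * TL.
Proof.
  intros Hi Hj. pose proof (n_lt_TL n).
  assert (H1 : bkt i j * SK + (a i + b j) < M * SK) by (apply pack_lt; [apply bkt_lt|apply sum_lt_SK; auto]).
  assert (H2 : (bkt i j * SK + (a i + b j)) * TL + i < M * SK * TL) by (apply pack_lt; lia).
  repeat split; auto. apply pack_lt; lia.
Qed.

Lemma enc_decode i j : i < n -> j < n ->
  enc i j mod TL = j /\ enc i j / TL mod TL = i /\ enc i j / (TL * TL) = bkt i j * SK + (a i + b j) /\
  enc i j / (TL * TL) mod SK = a i + b j /\ enc i j / (TL * TL * SK) = bkt i j.
Proof.
  intros Hi Hj. pose proof (n_lt_TL n).
  destruct (blk_divmod TL ((bkt i j * SK + (a i + b j)) * TL + i) j ltac:(lia)) as [D1 D2].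
  destruct (blk_divmod TL (bkt i j * SK + (a i + b j)) i ltac:(lia)) as [D3 D4].
  destruct (blk_divmod SK (bkt i j) (a i + b j) ltac:(apply sum_lt_SK; auto)) as [D5 D6].
  fold (enc i j) in D1, D2.
  rewrite <- !Nat.Div0.div_div. rewrite D1, D2, D3, D4, D5, D6. auto.
Qed.

Lemma word_lt : M * SK * TL * TL < 2 ^ w.
Proof.
  pose proof (word_bits k n) as H. pose proof (Ln_pos n).
  eapply Nat.lt_le_trans; [|exact H]. rewrite <- Nat.mul_assoc.
  assert (0 < M * SK * (TL * TL)).
  { unfold Mn, SKn, TLn. rewrite <- !Nat.pow_add_r. apply pow2_gt0. }
  pose proof (pow2_le 1 (15 * L) ltac:(lia)) as H2. change (2 ^ 1) with 2 in H2.
  set (P := M * SK * (TL * TL)) in *. set (R := 2 ^ (15 * L)) in *. clearbody P R. clear - H1 H2. nia.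
Qed.

End Enc.

Lemma build_spec s sh : penv s -> va s 7 = sh ->
  (forall i, i < n -> ar s 0 i < n ^ k) -> (forall i, i < n -> ar s 1 i < n ^ k) ->
  wp w inp p_build s (fun s' =>
    Permutation (map (ar s' 2) (seq 0 (n * n)))
      (map (fun t => enc k n sh (ar s 0) (ar s 1) (t / n) (t mod n)) (seq 0 (n * n))) /\
    sorted_arr (ar s' 2) (n * n) /\
    ck s' <= ck s + (k + 20) * (200 * (n * n + TL) + 150) + 200 * (n * n) + 100 * n + 300).
Proof.
  intros He H7 Ha Hb. pose proof X12_word as HX. pose proof w_small as Hws.
  pose proof X12_facts as (B1 & B2 & B3 & B4 & B5 & B6 & B7 & B8 & B9). pose proof k_small as Hks.
  unfold p_build. destruct He as (H0 & H1 & H2 & H3 & H4 & H5 & H6 & H8 & H9 & H10 & H11 & H12 & _).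
  set (f := fun t => enc k n sh (ar s 0) (ar s 1) (t / n) (t mod n)).
  apply wp_seq. apply wp_for with (K := 200 * n + 20) (N := n)
    (I := fun i s' => forall t, t < i * n -> ar s' 2 t = f t); auto; try lia.
  { intros i s1 Hi F1 I1 Hx. carry F1. arrs F1 0. arrs F1 1. clear F1.
    apply wp_for with (K := 150) (N := n)
      (I := fun j s' => forall t, t < i * n + j -> ar s' 2 t = f t); auto; try lia.
    { intros t Ht. apply I1. lia. }
    { intros j s2 Hj F2 I2 Hx2. carry F2. arrs F2 0. arrs F2 1. rewrite HA in HA1. rewrite HA0 in HA2.
      clear F2 HA HA0.
      pose proof (hashn_lt sh (ar s 0 i)) as Hh1. pose proof (hashn_lt sh (ar s 1 j)) as Hh2.
      assert (HN : i * n + j < n * n) by (apply pack_lt; auto).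
      asg bk Ebk.
      { unfold hashn in Hh1, Hh2. lia. }
      change (bk = (hashn k n sh (ar s 0 i) + hashn k n sh (ar s 1 j)) mod M) in Ebk.
      destruct (enc_parts sh (ar s 0) (ar s 1) Ha Hb i j Hi Hj) as (P1 & P2 & P3).
      rewrite <- Ebk in P1, P2. pose proof word_lt as Hwl.
      assert (Q1 : M * SK * TL <= M * SK * TL * TL) by (clear - B3; nia).
      assert (Q2 : M * SK <= M * SK * TL) by (clear - B3; nia).
      assert (P3' : ((bk * SK + (ar s 0 i + ar s 1 j)) * TL + i) * TL + j < M * SK * TL * TL)
        by (rewrite Ebk; exact P3).
      apply wp_sto; ev; known; repeat split; auto; try lia.
      + intros t Ht. unfold wr, upd. destruct (Nat.eqb_spec t (i * n + j)) as [->|Hne].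
        * unfold f. destruct (blk_divmod n i j Hj) as [-> ->]. unfold enc. rewrite <- Ebk. reflexivity.
        * apply I2. lia.
      + cbn [ecost bcost]. lia. }
    { intros s2 F2 I2 _ C2. split; [|lia]. intros t Ht. apply I2. lia. } }
  intros s1 F1 I1 _ C1. carry F1. clear F1.
  asg v13 E13.
  eapply wp_conseq.
  { apply (wp_sort w inp 2 _ (n * n) L (k + 20) TL f); auto; try lia; ev; auto.
    intros t Ht. split; [apply I1; auto|].
    assert (Hn : 0 < n) by (clear - Ht; nia).
    eapply Nat.lt_trans; [|apply word_lt].
    refine (proj2 (proj2 (enc_parts sh (ar s 0) (ar s 1) Ha Hb (t / n) (t mod n) _ _))).
    - apply Nat.Div0.div_lt_upper_bound. exact Ht.
    - apply Nat.mod_upper_bound. lia. }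
  intros s2 (P2 & S2 & C2). cbn [ck ecost] in C2. repeat split; auto. lia.
Qed.

Lemma index_spec s : penv s -> sorted_arr (ar s 2) (n * n) ->
  (forall p, p < n * n -> ar s 2 p / (TL * TL * SK) < M) ->
  wp w inp p_index s (fun s' =>
    (forall r, r < M -> startok (fun p => ar s 2 p / (TL * TL * SK)) (n * n) r (ar s' 5 r)) /\
    (forall p, p < n * n -> nxok (fun p => ar s 2 p / (TL * TL)) (n * n) p (ar s' 6 p)) /\
    ck s' <= ck s + 200 * (n * n) + 50 * M + 100).
Proof.
  intros He HS Hg. pose proof X12_word as HX. pose proof w_small as Hws.
  pose proof X12_facts as (B1 & B2 & B3 & B4 & B5 & B6 & B7 & B8 & B9). pose proof k_small as Hks.
  unfold p_index. destruct He as (H0 & H1 & H2 & H3 & H4 & H5 & H6 & H8 & H9 & H10 & H11 & H12 & H29 & H30).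
  set (X := ar s 2) in *. set (g := fun p => X p / (TL * TL * SK)) in *. set (K := fun p => X p / (TL * TL)).
  set (N := n * n) in *.
  apply wp_seq. apply wp_tab with (a := 5) (K := 20) (N := M) (f := fun _ => N); auto; try lia.
  { intros i s1 Hi F1 Hx. carry F1. apply wp_sto; ev; known; repeat split; auto; try lia.
    cbn [ecost]. lia. }
  intros s1 F1 A1 C1. carry F1. arrs F1 2. fold X in HA. clear F1.
  (* After [i] rounds the last [i] records are indexed; a bucket without a record among them still
     holds [N]. *)
  apply wp_for with (K := 150) (N := N)
    (I := fun i s' =>
      (forall r, r < M -> ar s' 5 r <= N /\ (forall p, N - i <= p < N -> g p = r -> ar s' 5 r <= p) /\
          (ar s' 5 r < N -> N - i <= ar s' 5 r /\ g (ar s' 5 r) = r)) /\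
      (forall p, N - i <= p < N -> nxok K N p (ar s' 6 p))); auto; try lia.
  { split; [|intros; lia]. intros r Hr. rewrite A1 by auto. repeat split; intros; lia. }
  { intros i s2 Hi F2 (I1 & I2) Hx. carry F2. arrs F2 2. rewrite HA in HA0. clear F2.
    asg p Ep. asg x Exx.
    assert (HpN : p < N) by lia. specialize (Hg p HpN) as Hgp.
    assert (Hx1 : x / (TL * TL * SK) = g p) by (rewrite Exx; reflexivity).
    assert (Hx2 : x / (TL * TL) = K p) by (rewrite Exx; reflexivity).
    apply wp_seq, wp_sto; ev; known; rewrite ?Hx1; auto; try (unfold g; lia).
    assert (Hb1 : forall c : bool, (if c then 1 else 0) <= 1) by (intros []; lia).
    asg v Ev.
    { match goal with |- ?A * ?B < _ => assert (A * B <= 1 * 1) by (apply Nat.mul_le_mono; apply Hb1) end. lia. }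
    change (X (p + 1) / (TL * TL)) with (K (p + 1)) in Ev. rewrite Hx2 in Ev.
    assert (Hst : forall r, r < M -> wr (ar s2 5) (g p) p r <= N /\
       (forall p0, N - S i <= p0 < N -> g p0 = r -> wr (ar s2 5) (g p) p r <= p0) /\
       (wr (ar s2 5) (g p) p r < N -> N - S i <= wr (ar s2 5) (g p) p r /\ g (wr (ar s2 5) (g p) p r) = r)).
    { intros r Hr. unfold wr, upd. destruct (Nat.eqb_spec r (g p)) as [->|Hne].
      - repeat split; intros; lia.
      - destruct (I1 r Hr) as (J1 & J2 & J3). split; [auto|split].
        + intros p0 Hp0 Hr0. destruct (Nat.eq_dec p0 p) as [->|]; [congruence|]. apply J2; auto. lia.
        + intros HH. destruct (J3 HH). split; auto. lia. }
    assert (HnxE : forall v', (nxok K N p v') -> forall p0, N - S i <= p0 < N -> nxok K N p0 (wr (ar s2 6) p v' p0)).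
    { intros v' Hv' p0 Hp0. unfold wr, upd. destruct (Nat.eqb_spec p0 p) as [->|Hne]; auto.
      apply I2. lia. }
    apply wp_if; ev; [auto| |]; intros Hv.
    - assert (p + 1 < N /\ K (p + 1) = K p) as [Hp1 HK1].
      { rewrite Ev in Hv. destruct (Nat.ltb_spec (p + 1) N), (Nat.eqb_spec (K (p + 1)) (K p)); auto; simpl in Hv; lia. }
      destruct (I2 (p + 1) ltac:(lia)) as (Y1 & Y2 & Y3).
      apply wp_sto; ev; [exact I|repeat split; lia|lia|].
      split; [split; [exact Hst|apply HnxE]|cbn [ecost bcost]; lia].
      split; [lia|split].
      + intros p' Hp'. destruct (Nat.eq_dec p' p) as [->|]; auto. rewrite Y2 by lia. exact HK1.
      + intros HH. rewrite <- HK1. auto.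
    - apply wp_sto; ev; [exact I|repeat split; lia|lia|].
      split; [split; [exact Hst|apply HnxE]|cbn [ecost bcost]; lia].
      split; [lia|split].
      + intros p' Hp'. replace p' with p by lia. reflexivity.
      + intros HH HK1. rewrite Ev in Hv.
        destruct (Nat.ltb_spec (p + 1) N), (Nat.eqb_spec (K (p + 1)) (K p)); simpl in Hv; try lia; congruence. }
  intros s2 F2 (I1 & I2) _ C2. split; [|split].
  - intros r Hr. destruct (I1 r Hr) as (J1 & J2 & J3). split; [auto|split].
    + intros p Hp Hgp. apply J2; auto. lia.
    + intros HH. apply J3. exact HH.
  - intros p Hp. apply I2. lia.
  - lia.
Qed.

Lemma sorted_bound (f : nat -> nat) (A : list nat) m :
  Permutation (map f (seq 0 n)) A -> (forall x, In x A -> x < m) -> forall i, i < n -> f i < m.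
Proof.
  intros HP HA i Hi. apply HA. eapply Permutation_in; [exact HP|]. apply in_map, in_seq. lia.
Qed.

Definition prepped (sh : nat) (A B : list nat) (s : state) : Prop :=
  penv s /\ va s 7 = sh /\
  (Permutation (map (ar s 0) (seq 0 n)) A /\ sorted_arr (ar s 0) n) /\
  (Permutation (map (ar s 1) (seq 0 n)) B /\ sorted_arr (ar s 1) n) /\
  (Permutation (map (ar s 2) (seq 0 (n * n)))
      (map (fun t => enc k n sh (ar s 0) (ar s 1) (t / n) (t mod n)) (seq 0 (n * n))) /\
   sorted_arr (ar s 2) (n * n)) /\
  (forall r, r < M -> startok (fun p => ar s 2 p / (TL * TL * SK)) (n * n) r (ar s 5 r)) /\
  (forall p, p < n * n -> nxok (fun p => ar s 2 p / (TL * TL)) (n * n) p (ar s 6 p)).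

Lemma prep_spec s A B : inp = n :: A ++ B -> length A = n -> length B = n ->
  (forall x, In x A \/ In x B -> x < n ^ k) -> w <= length (rn s) ->
  wp w inp (p_prep k) s (fun s' => prepped (bval 0 (firstn w (rn s))) A B s' /\
    rn s' = skipn w (rn s) /\ ck s' + 1 <= ck s + (k + 20) * 4900 * (n * n + 1)).
Proof.
  intros Hinp HA HB Hlt Hr. unfold p_prep.
  apply wp_seq. eapply wp_conseq_fr; [apply init_spec; now rewrite Hinp|].
  intros s1 F1 (E1 & C1).
  assert (R1 : rn s1 = rn s) by (apply F1; reflexivity). clear F1. rewrite <- R1 in Hr.
  apply wp_seq. eapply wp_conseq_fr; [apply rand_spec; auto|].
  intros s2 F2 (V2 & R2 & C2). apply (penv_fr _ _ _ F2 eq_refl) in E1. clear F2.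
  rewrite R1 in *. set (sh := bval 0 (firstn w (rn s))) in *.
  apply wp_seq. eapply wp_conseq_fr; [apply (read_spec s2 A B); auto|].
  intros s3 F3 (PA & PB & C3). apply (penv_fr _ _ _ F3 eq_refl) in E1. carry F3.
  assert (R3 : rn s3 = rn s2) by (apply F3; reflexivity). clear F3.
  assert (Ha : forall i, i < n -> ar s3 0 i < n ^ k).
  { apply (sorted_bound _ A); [apply PA|]. auto. }
  assert (Hb : forall i, i < n -> ar s3 1 i < n ^ k).
  { apply (sorted_bound _ B); [apply PB|]. auto. }
  apply wp_seq. eapply wp_conseq_fr; [apply (build_spec s3 sh); auto|].
  intros s4 F4 (PX & SX & C4). apply (penv_fr _ _ _ F4 eq_refl) in E1. carry F4.
  arrs F4 0. arrs F4 1. rewrite <- HA0, <- HA1 in *.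
  assert (R4 : rn s4 = rn s3) by (apply F4; reflexivity). clear F4.
  eapply wp_conseq_fr; [apply (index_spec s4); auto|].
  { intros p Hp. assert (In (ar s4 2 p) (map (ar s4 2) (seq 0 (n * n)))) as Hin
      by (apply in_map, in_seq; lia).
    apply (Permutation_in _ PX), in_map_iff in Hin as (t & <- & Ht). apply in_seq in Ht.
    assert (Hn : 0 < n) by (clear - Hp; nia).
    destruct (enc_decode sh (ar s4 0) (ar s4 1) Ha Hb (t / n) (t mod n)) as (_ & _ & _ & _ & ->).
    - apply Nat.Div0.div_lt_upper_bound. lia.
    - apply Nat.mod_upper_bound. lia.
    - apply bkt_lt. }
  intros s5 F5 (S5 & N5 & C5). apply (penv_fr _ _ _ F5 eq_refl) in E1. carry F5.
  arrs F5 0. arrs F5 1. arrs F5 2.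
  assert (R5 : rn s5 = rn s4) by (apply F5; reflexivity). clear F5.
  split; [|split; [congruence|]].
  - unfold prepped. rewrite HA2, HA3, HA4. repeat (split; auto).
  - rewrite wn_eq in C2.
    assert (HTL : TL <= 2 * (n + 1)).
    { destruct (Nat.eq_dec n 0) as [En|En]; [rewrite En; vm_compute; lia|].
      pose proof (TL_le n ltac:(lia)). lia. }
    pose proof (Ln_lt_TL n) as HL. pose proof (M_le n) as HM. pose proof (Ln_pos n) as HL1.
    assert (HM2 : M <= 4 * ((n + 1) * (n + 1))).
    { etransitivity; [exact HM|]. transitivity (2 * (n + 1) * (2 * (n + 1))); [apply Nat.mul_le_mono; auto|lia]. }
    assert (Hnn : n <= n * n) by (clear; nia).
    (* Every cost becomes a multiple of [c * Y] with [Y = n * n + 1], and the sum stays below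
       [4900 * (c * Y)]. The 1 added to the clock in the statement pays for the halting step. *)
    set (c := k + 20) in *. set (Y := n * n + 1).
    assert (Hc : 1 <= c) by (unfold c; lia).
    assert (HTY : TL <= 2 * Y) by (unfold Y; lia). assert (HLY : L <= 2 * Y) by lia.
    assert (HMY : M <= 16 * Y) by (unfold Y; lia). assert (HnY : n <= Y) by (unfold Y; lia).
    assert (HNY : n * n <= Y) by (unfold Y; lia). assert (HY1 : 1 <= Y) by (unfold Y; lia).
    fold Y. clearbody Y c. set (N := n * n) in *. clearbody N.
    assert (Q1 : 30 * (c * L) <= 60 * (c * Y)) by (clear - HLY; nia).
    assert (Q2 : 2 * (c * (200 * (n + TL) + 150)) <= 1500 * (c * Y)) by (clear - HTY HnY HY1; nia).
    assert (Q3 : c * (200 * (N + TL) + 150) <= 750 * (c * Y)) by (clear - HTY HNY HY1; nia).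
    assert (Q4 : Y <= c * Y) by (clear - Hc; nia).
    set (Z := c * Y) in *. replace (c * 4900 * Y) with (4900 * Z) by (unfold Z; lia).
    clearbody Z. clear - C1 C2 C3 C4 C5 Q1 Q2 Q3 Q4 HLY HMY HnY HNY HY1. lia.
Qed.

End Prep.

(** * Queries *)

(* 31, 32 sizes of A' and B'; 33 offset of the part of the input being read;
   arrays 7, 8 membership flags of A', B'; 9, 10 polynomials. *)
Definition p_find (a : nat) : cmd :=
  16 <- C 0 ;; 17 <- V 3 ;;
  CFor 18 1 (
    17 <- V 17 /: C 2 ;;
    CIf (V 16 +: V 17 <: V 0)
      (CIf (V 15 <: EArr a (V 16 +: V 17)) CSkip (16 <- V 16 +: V 17)) CSkip).

Definition p_flags (a f len : nat) : cmd :=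
  CFor 13 0 (CSto f (V 13) (C 0)) ;;
  CFor 14 len (15 <- EIn (V 33 +: V 14) ;; p_find a ;; CSto f (V 16) (C 1)).

Definition p_poly (a f p : nat) : cmd :=
  CFor 13 10 (CSto p (V 13) (C 0)) ;;
  CFor 13 0 (14 <- e_hash (EArr a (V 13)) ;; CSto p (V 14) (EArr p (V 14) +: EArr f (V 13))).

Notation e_inbucket := ((V 20 <: V 9) *: (EArr 2 (V 20) /: V 30 =: V 19)).

(** Sums of two hash values run below [2 M], so the count of a bucket is spread over two entries of
    the convolution, [r] and [r + M]. [e] is the carry by which the hash of [a + b] may exceed the
    sum of the hashes modulo [M]. *)
Definition p_bucket (e : nat) : cmd :=
  19 <- (V 16 +: V 5 -: C e) %: V 5 ;;
  17 <- V 17 +: EArr 9 (V 19) +: EArr 9 (V 19 +: V 5) ;;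
  20 <- EArr 5 (V 19) ;; 21 <- e_inbucket ;;
  CWhile (V 21) (
    22 <- EArr 2 (V 20) ;;
    CIf (V 22 /: V 29 %: V 8 =: V 15) (20 <- EArr 6 (V 20))
      (18 <- V 18 +: EArr 7 (V 22 /: V 3 %: V 3) *: EArr 8 (V 22 %: V 3) ;; 20 <- V 20 +: C 1) ;;
    21 <- e_inbucket).

Definition p_query : cmd :=
  31 <- EIn (C 1) ;; 32 <- EIn (C 2) ;; 33 <- C 3 ;; p_flags 0 7 31 ;;
  33 <- C 3 +: V 31 ;; p_flags 1 8 32 ;;
  p_poly 0 7 9 ;; p_poly 1 8 10 ;; p_mul ;;
  33 <- C 3 +: V 31 +: V 32 ;;
  CFor 35 0 (
    15 <- EIn (V 33 +: V 35) ;; 16 <- e_hash (V 15) ;; 17 <- C 0 ;; 18 <- C 0 ;;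
    p_bucket 0 ;; p_bucket 1 ;; COut (V 18 <: V 17)).

(** * Counting pairs by hash value *)

Definition memn (x : nat) (A : list nat) : nat := b2n (existsb (Nat.eqb x) A).

Lemma memn_iff x A : memn x A = 1 <-> In x A.
Proof.
  unfold memn. split.
  - destruct (existsb (Nat.eqb x) A) eqn:E; [|discriminate]. intros _.
    apply existsb_exists in E as (y & Hy & Hxy). apply Nat.eqb_eq in Hxy. now subst.
  - intros H. replace (existsb (Nat.eqb x) A) with true; [reflexivity|].
    symmetry. apply existsb_exists. exists x. split; auto. apply Nat.eqb_refl.
Qed.

Lemma memn_01 x A : memn x A = 0 \/ memn x A = 1.
Proof. unfold memn. destruct (existsb _ _); auto. Qed.

Definition pcoef (h fl : nat -> nat) (m g : nat) : nat := sumn m (fun i => if h i =? g then fl i else 0).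

Definition pconvn (h1 f1 h2 f2 : nat -> nat) (m g : nat) : nat :=
  sumn m (fun i => sumn m (fun j => if h1 i + h2 j =? g then f1 i * f2 j else 0)).

Lemma sumn_bound m f c : (forall i, i < m -> f i <= c) -> sumn m f <= m * c.
Proof. intros H. rewrite <- sumn_const. now apply sumn_le. Qed.

Lemma pcoef_le h fl m g : (forall i, i < m -> fl i <= 1) -> pcoef h fl m g <= m.
Proof.
  intros H. rewrite <- (Nat.mul_1_r m) at 2. apply sumn_bound. intros i Hi.
  specialize (H i Hi). destruct (_ =? _); lia.
Qed.

Lemma pconvn_le h1 f1 h2 f2 m g : (forall i, f1 i <= 1) -> (forall i, f2 i <= 1) ->
  pconvn h1 f1 h2 f2 m g <= m * m.
Proof.
  intros H1 H2. apply sumn_bound. intros i Hi. rewrite <- (Nat.mul_1_r m) at 2.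
  apply sumn_bound. intros j Hj. specialize (H1 i). specialize (H2 j).
  destruct (_ =? _); [|lia]. change 1 with (1 * 1). now apply Nat.mul_le_mono.
Qed.

Lemma sumz_indicator n h v z : h < n ->
  sumz n (fun g => (if (h =? g)%nat then v else 0) * pw z g)%Z = (v * pw z h)%Z.
Proof.
  induction n as [|n IH]; intros Hh; [lia|]. cbn [sumz].
  destruct (Nat.eqb_spec h n) as [->|Hne].
  - rewrite (sumz_ext n _ (fun _ => 0%Z)), sumz_zero; [ring|].
    intros i Hi. destruct (Nat.eqb_spec n i); [lia|ring].
  - rewrite IH by lia. ring.
Qed.

Lemma of_nat_sumn m f : Z.of_nat (sumn m f) = sumz m (fun i => Z.of_nat (f i)).
Proof. induction m; cbn [sumn sumz]; lia. Qed.

Lemma evb_pcoef D h fl m z : (forall i, i < m -> h i < D) ->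
  evb z D (fun g => Z.of_nat (pcoef h fl m g)) 0 = sumz m (fun i => Z.of_nat (fl i) * pw z (h i))%Z.
Proof.
  intros Hh. unfold evb, pcoef.
  rewrite (sumz_ext D _ (fun g => sumz m (fun i => (if (h i =? g)%nat then Z.of_nat (fl i) else 0) * pw z g)%Z)).
  - rewrite sumz_swap. apply sumz_ext. intros i Hi. now apply sumz_indicator, Hh.
  - intros g Hg. rewrite Nat.add_0_l, of_nat_sumn, Z.mul_comm, <- sumz_scal. apply sumz_ext. intros i _.
    destruct (_ =? _); ring.
Qed.

Lemma evb_pconvn D h1 f1 h2 f2 m z : (forall i j, i < m -> j < m -> h1 i + h2 j < D) ->
  evb z D (fun g => Z.of_nat (pconvn h1 f1 h2 f2 m g)) 0 =
  (sumz m (fun i => Z.of_nat (f1 i) * pw z (h1 i)) * sumz m (fun j => Z.of_nat (f2 j) * pw z (h2 j)))%Z.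
Proof.
  intros Hh. unfold evb, pconvn.
  rewrite (sumz_ext D _ (fun g => sumz m (fun i => sumz m (fun j =>
     (if (h1 i + h2 j =? g)%nat then Z.of_nat (f1 i * f2 j) else 0) * pw z g)))%Z).
  - rewrite sumz_swap, Z.mul_comm, <- sumz_scal. apply sumz_ext. intros i Hi.
    rewrite sumz_swap, Z.mul_comm, <- sumz_scal. apply sumz_ext. intros j Hj.
    rewrite sumz_indicator by auto. rewrite Nat2Z.inj_mul, pw_add. ring.
  - intros g Hg. rewrite Nat.add_0_l, of_nat_sumn, Z.mul_comm, <- sumz_scal. apply sumz_ext. intros i _.
    rewrite of_nat_sumn, <- sumz_scal. apply sumz_ext. intros j _.
    destruct (_ =? _); ring.
Qed.

Lemma firstn_snoc (A : list nat) t : t < length A -> firstn (S t) A = firstn t A ++ [nth t A 0].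
Proof.
  revert t. induction A as [|y A IH]; intros t Ht; [simpl in Ht; lia|].
  destruct t; [reflexivity|]. cbn [firstn app nth]. f_equal. apply IH. simpl in Ht. lia.
Qed.

Lemma list_sum_perm (l1 l2 : list nat) : Permutation l1 l2 -> list_sum l1 = list_sum l2.
Proof. induction 1; simpl; lia. Qed.

Lemma sumn_list N f : sumn N f = list_sum (map f (seq 0 N)).
Proof.
  induction N as [|N IH]; [reflexivity|].
  rewrite seq_S, map_app, list_sum_app. cbn [sumn]. rewrite IH. simpl. lia.
Qed.

Lemma sumn_perm N X f (G : nat -> nat) : Permutation (map X (seq 0 N)) (map f (seq 0 N)) ->
  sumn N (fun p => G (X p)) = sumn N (fun t => G (f t)).
Proof.
  intros H. rewrite !sumn_list, <- (map_map X G), <- (map_map f G).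
  apply list_sum_perm, Permutation_map, H.
Qed.

Lemma sumn_perm_list N X (A : list nat) (G : nat -> nat) : Permutation (map X (seq 0 N)) A ->
  sumn N (fun p => G (X p)) = list_sum (map G A).
Proof. intros H. rewrite sumn_list, <- (map_map X G). apply list_sum_perm, Permutation_map, H. Qed.

Lemma sumn_app m m' f : sumn (m + m') f = sumn m f + sumn m' (fun i => f (m + i)).
Proof.
  induction m'; [rewrite Nat.add_0_r; simpl; lia|]. rewrite Nat.add_succ_r. cbn [sumn]. lia.
Qed.

Lemma sumn_square m n (H : nat -> nat -> nat) :
  sumn (m * n) (fun t => H (t / n) (t mod n)) = sumn m (fun i => sumn n (H i)).
Proof.
  induction m as [|m IH]; [reflexivity|]. cbn [Nat.mul sumn].
  rewrite Nat.add_comm, sumn_app, IH. f_equal. apply sumn_ext. intros j Hj.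
  now destruct (blk_divmod n m j Hj) as [-> ->].
Qed.

Lemma sumn_pos m f : 0 < sumn m f -> exists i, i < m /\ 0 < f i.
Proof.
  induction m as [|m IH]; cbn [sumn]; intros H; [lia|].
  destruct (Nat.eq_dec (f m) 0) as [E|E].
  - destruct IH as (i & Hi & Hf); [lia|]. exists i. split; [lia|auto].
  - exists m. lia.
Qed.

Lemma sumn_term m f i : i < m -> f i <= sumn m f.
Proof.
  induction m as [|m IH]; intros Hi; [lia|]. cbn [sumn].
  destruct (Nat.eq_dec i m) as [->|]; [lia|]. specialize (IH ltac:(lia)). lia.
Qed.

Lemma mod_shift Z e M : 2 <= M -> e <= 1 -> ((Z + e) mod M + M - e) mod M = Z mod M.
Proof.
  intros HM He. pose proof (Nat.div_mod_eq (Z + e) M) as E.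
  pose proof (Nat.mod_upper_bound (Z + e) M ltac:(lia)) as Hr.
  set (q := (Z + e) / M) in *. set (r := (Z + e) mod M) in *. clearbody q r.
  destruct (Nat.le_gt_cases e r) as [H|H].
  - replace (r + M - e) with (r - e + 1 * M) by lia. rewrite Nat.Div0.mod_add.
    replace Z with (r - e + q * M) by lia. now rewrite Nat.Div0.mod_add.
  - assert (e = 1) as -> by lia. assert (r = 0) as -> by lia.
    destruct q; [lia|]. replace Z with (M - 1 + q * M) by lia. rewrite Nat.Div0.mod_add.
    f_equal.
Qed.

(* Adding two truncated products loses at most one carry. *)
Lemma hash_add k n sh x y : exists e, e <= 1 /\
  hashn k n sh (x + y) = (hashn k n sh x + hashn k n sh y + e) mod Mn n.
Proof.
  unfold hashn. rewrite Nat.mul_add_distr_l.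
  assert (HW : 2 ^ wn k n = Un k n * Mn n).
  { unfold Un, Mn. rewrite <- Nat.pow_add_r. f_equal. pose proof (lpar_bounds n).
    rewrite wn_eq, Nat.mul_add_distr_r. lia. }
  rewrite Nat.Div0.add_mod. set (p := (sh * x) mod 2 ^ wn k n). set (q := (sh * y) mod 2 ^ wn k n).
  assert (HU : 0 < Un k n) by apply pow2_gt0.
  rewrite HW. set (u := Un k n) in *. set (m := Mn n).
  pose proof (Nat.div_mod_eq p u) as Ep. pose proof (Nat.div_mod_eq q u) as Eq0.
  pose proof (Nat.mod_upper_bound p u ltac:(lia)). pose proof (Nat.mod_upper_bound q u ltac:(lia)).
  rewrite Nat.Div0.mod_mul_r. rewrite (Nat.mul_comm u), Nat.div_add, (Nat.div_small ((p + q) mod u)), Nat.add_0_l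
    by (try apply Nat.mod_upper_bound; lia).
  exists ((p mod u + q mod u) / u). split.
  - apply Nat.lt_succ_r, Nat.Div0.div_lt_upper_bound. lia.
  - f_equal. rewrite Ep at 1. rewrite Eq0 at 1.
    replace (u * (p / u) + p mod u + (u * (q / u) + q mod u)) with (p mod u + q mod u + (p / u + q / u) * u) by lia.
    rewrite Nat.div_add by lia. lia.
Qed.

(** The bucket of the pairs of sum [c] whose hash addition loses the carry [e]. *)
Definition bidx (k n sh c e : nat) : nat := (hashn k n sh c + Mn n - e) mod Mn n.

Definition inb (k n sh c e x y : nat) : bool :=
  (hashn k n sh x + hashn k n sh y) mod Mn n =? bidx k n sh c e.

Definition fpind (k n sh c x y : nat) : nat :=
  if x + y =? c then 0 else b2n (inb k n sh c 0 x y) + b2n (inb k n sh c 1 x y).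

(** All of [A] and [B] is counted, whatever the subsets of the query are: the walk also visits
    stored pairs outside the subsets, and this number measures its time. *)
Definition fpsum (k n sh : nat) (A B : list nat) (c : nat) : nat :=
  list_sum (map (fun x => list_sum (map (fpind k n sh c x) B)) A).

Lemma inb_true k n sh x y : inb k n sh (x + y) 0 x y = true \/ inb k n sh (x + y) 1 x y = true.
Proof.
  destruct (hash_add k n sh x y) as (e & He & E). pose proof (M_pos n) as HM.
  assert (HH : inb k n sh (x + y) e x y = true).
  { unfold inb, bidx. rewrite E. apply Nat.eqb_eq. symmetry. apply mod_shift; [exact HM|exact He]. }
  destruct e as [|[|]]; auto; lia.
Qed.

Lemma perm_nodup_inj (a : nat -> nat) N A : Permutation (map a (seq 0 N)) A -> NoDup A ->
  forall i j, i < N -> j < N -> a i = a j -> i = j.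
Proof.
  intros HP HN i j Hi Hj E. apply (Permutation_NoDup (Permutation_sym HP)) in HN.
  rewrite (NoDup_nth _ 0) in HN. rewrite length_map, length_seq in HN. apply HN; auto.
  rewrite !(nth_indep _ 0 (a 0)) by (rewrite length_map, length_seq; auto).
  rewrite !map_nth, !seq_nth by auto. exact E.
Qed.

Lemma perm_in (a : nat -> nat) N A x : Permutation (map a (seq 0 N)) A -> In x A -> exists i, i < N /\ a i = x.
Proof.
  intros HP HI. apply (Permutation_in _ (Permutation_sym HP)), in_map_iff in HI as (i & E & Hi).
  apply in_seq in Hi. exists i. split; [lia|auto].
Qed.

(** * Correctness and cost of the query *)

Section Query.
Variables (k n : nat).
Hypothesis Hk : 1 <= k.
Variable inp : list nat.

Local Notation w := (wn k n).
Local Notation L := (Ln n).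
Local Notation TL := (TLn n).
Local Notation M := (Mn n).
Local Notation l := (lpar n).
Local Notation SK := (SKn k n).
Local Notation U := (Un k n).
Let X12 := 2 ^ (12 * L).

Lemma find_spec a s x f :
  a < 3 -> penv k n s -> va s 15 = x -> (forall i, i < n -> ar s a i = f i) ->
  sorted_arr f n -> (forall i j, i < n -> j < n -> f i = f j -> i = j) ->
  (exists i, i < n /\ f i = x) ->
  wp w inp (p_find a) s (fun s' => va s' 16 < n /\ f (va s' 16) = x /\ ck s' <= ck s + 60 * L + 20).
Proof.
  intros Ha He H15 Hf HS Hinj (idx & Hidx & Hx). unfold p_find.
  pose proof (X12_word k n Hk) as HX. fold X12 in HX.
  pose proof (X12_facts k n Hk) as (B1 & B2 & B3 & B4 & B5 & B6 & B7 & B8 & B9). fold X12 in B4.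
  destruct He as (H0 & H1 & _ & H3 & _).
  asg v16 E16. asg v17 E17.
  (* The index sought stays in a window of length [2 ^ (L - i)] starting at scalar 16; a probe at
     [n] or beyond counts as too large. *)
  apply wp_for with (K := 50) (N := L)
    (I := fun i s' => va s' 17 = 2 ^ (L - i) /\ va s' 16 <= idx /\ idx < va s' 16 + 2 ^ (L - i)); auto; try lia.
  { ev. subst v16 v17. rewrite Nat.sub_0_r. change (2 ^ L) with TL. lia. }
  { intros i s' Hi F (I1 & I2 & I3) Hx'. carry F.
    assert (HA : ar s' a = ar s a) by (apply F; reflexivity).
    assert (H15' : va s' 15 = x) by (rewrite (proj1 F 15 eq_refl); exact H15).
    assert (H0' : va s' 0 = n) by (rewrite (proj1 F 0 eq_refl); exact H0).
    clear F. set (st := 2 ^ (L - S i)) in *.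
    assert (E2 : 2 ^ (L - i) = 2 * st).
    { unfold st. replace (L - i) with (S (L - S i)) by lia. apply Nat.pow_succ_r'. }
    assert (Hst : 2 * st <= TL) by (rewrite <- E2; apply pow2_le; lia).
    assert (Hst0 : 0 < st) by apply pow2_gt0.
    asg h Eh. rewrite E2, Nat.mul_comm, Nat.div_mul in Eh by lia. subst h.
    remember (va s' 16) as ps eqn:Eps.
    apply wp_if; ev; rewrite <- ?Eps, ?H0'; [repeat split; lia| |]; intros Hc.
    - destruct (Nat.ltb_spec (ps + st) n) as [Hlt|]; [|congruence].
      apply wp_if; ev; rewrite <- ?Eps, ?HA, ?H15', ?Hf by auto; [repeat split; auto; lia| |]; intros Hc2.
      + destruct (Nat.ltb_spec x (f (ps + st))) as [Hlt2|]; [|congruence].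
        apply wp_skip. ev. rewrite <- Eps. repeat split; auto; try (cbn [ecost bcost]; lia).
        destruct (Nat.lt_ge_cases idx (ps + st)); auto.
        pose proof (HS (ps + st) idx ltac:(lia) Hidx). lia.
      + destruct (Nat.ltb_spec x (f (ps + st))) as [|Hge]; [discriminate|].
        apply wp_asg; ev; rewrite <- ?Eps; [repeat split; auto; lia|]. intros v Ev. subst v.
        repeat split; auto; try (cbn [ecost bcost]; lia).
        destruct (Nat.lt_ge_cases idx (ps + st)) as [Hl|]; auto.
        pose proof (HS idx (ps + st) ltac:(lia) Hlt).
        pose proof (Hinj idx (ps + st) Hidx Hlt ltac:(lia)). lia.
    - destruct (Nat.ltb_spec (ps + st) n) as [|Hge]; [discriminate|].
      apply wp_skip. ev. rewrite <- Eps. repeat split; auto; try (cbn [ecost bcost]; lia). }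
  intros s' F (I1 & I2 & I3) _ C. rewrite Nat.sub_diag in I3. change (2 ^ 0) with 1 in I3.
  replace (va s' 16) with idx by lia. cbn [ck ecost] in C. repeat split; auto. lia.
Qed.

Lemma flags_spec a f len s (g : nat -> nat) A' off :
  a < 3 -> (f = 7 \/ f = 8) -> (len = 31 \/ len = 32) -> penv k n s -> (forall i, i < n -> ar s a i = g i) ->
  sorted_arr g n -> (forall i j, i < n -> j < n -> g i = g j -> i = j) ->
  (forall i, i < n -> g i < 2 ^ w) ->
  (forall x, In x A' -> exists i, i < n /\ g i = x) ->
  va s len = length A' -> va s 33 = off -> length A' <= n -> off <= 3 + 2 * n ->
  (forall t, t < length A' -> nth (off + t) inp 0 = nth t A' 0) ->
  wp w inp (p_flags a f len) s (fun s' => (forall i, i < n -> ar s' f i = memn (g i) A') /\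
    ck s' <= ck s + n * (60 * L + 100) + 50 * n + 50).
Proof.
  intros Ha Hff Hlen He Hg HS Hinj Hgw HA' Hl H33 HlA Hoff Hin. unfold p_flags.
  pose proof (X12_word k n Hk) as HX. fold X12 in HX.
  pose proof (X12_facts k n Hk) as (B1 & B2 & B3 & B4 & B5 & B6 & B7 & B8 & B9). fold X12 in B4.
  assert (Hfa : Nat.eqb a f = false) by (apply Nat.eqb_neq; lia).
  assert (H0 : va s 0 = n) by apply He.
  assert (Hln : Nat.eqb 14 len = false) by (destruct Hlen; subst; reflexivity).
  apply wp_seq. apply wp_tab with (a := f) (K := 20) (N := n) (f := fun _ => 0); auto; try lia.
  { intros i s' Hi F Hx. apply wp_sto; ev; known; [exact I|lia|lia|]. split; [|cbn [ecost]; lia].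
    unfold aset. now rewrite Nat.eqb_refl. }
  intros s1 F1 A1 C1.
  assert (HA1 : ar s1 a = ar s a).
  { apply F1. cbn -[Nat.eqb]. now rewrite Hfa. }
  assert (He1 : penv k n s1) by (eapply penv_fr; eauto; reflexivity).
  assert (H33' : va s1 33 = off) by (rewrite (proj1 F1 33 eq_refl); exact H33).
  assert (Hl' : va s1 len = length A').
  { rewrite (proj1 F1 len); auto. destruct Hlen; subst; reflexivity. }
  clear F1.
  apply wp_for with (K := 60 * L + 60) (N := length A')
    (I := fun t s' => forall i, i < n -> ar s' f i = memn (g i) (firstn t A')); auto; try lia.
  { destruct Hlen as [-> | ->]; reflexivity. }
  { intros t s' Ht F I1 Hx.
    assert (Ea : ar s' a = ar s a).
    { rewrite <- HA1. apply F. cbn -[Nat.eqb]. now rewrite Hfa. }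
    assert (He' : penv k n s') by (eapply penv_fr; eauto; reflexivity).
    assert (H33s : va s' 33 = off) by (rewrite (proj1 F 33 eq_refl); exact H33').
    clear F.
    assert (HtA : In (nth t A' 0) A') by (apply nth_In; auto).
    destruct (HA' _ HtA) as (idx & Hidx & Ex).
    asg x Exx; rewrite ?Hin, <- ?Ex by auto; auto; try lia. rewrite Hin in Exx by auto.
    apply wp_seq. eapply wp_conseq_fr.
    { apply (find_spec a _ x g); auto.
      - intros i Hi. cbn [ar]. rewrite Ea. auto.
      - exists idx. split; auto. congruence. }
    intros s2 F2 (P1 & P2 & C2).
    assert (Ef : ar s2 f = ar s' f) by (apply F2; reflexivity). clear F2.
    apply wp_sto; ev; [exact I|lia|lia|]. split; [|cbn [ck ecost bcost] in *; lia].
    intros i Hi. unfold aset. rewrite Nat.eqb_refl, Ef.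
    assert (Hfn : firstn (S t) A' = firstn t A' ++ [x]).
    { rewrite Exx. now apply firstn_snoc. }
    unfold memn. rewrite Hfn, existsb_app. cbn [existsb]. rewrite orb_false_r.
    unfold wr, upd. destruct (Nat.eqb_spec i (va s2 16)) as [Ei|Ei].
    - rewrite Ei, P2, Nat.eqb_refl, orb_true_r. reflexivity.
    - rewrite I1 by auto. unfold memn. f_equal.
      destruct (Nat.eqb_spec (g i) x) as [E|E]; [|now rewrite orb_false_r].
      exfalso. apply Ei. apply Hinj; auto. congruence. }
  intros s2 F2 I2 _ C2. rewrite firstn_all in I2. split; auto.
  assert (length A' * (60 * L + 60 + 9) <= n * (60 * L + 60 + 9)) by (apply Nat.mul_le_mono_r; auto). lia.
Qed.

Lemma poly_spec a f P s sh (g fl : nat -> nat) :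
  a < 3 -> (f = 7 \/ f = 8) -> (P = 9 \/ P = 10) -> penv k n s -> va s 7 = sh ->
  (forall i, i < n -> ar s a i = g i) -> (forall i, i < n -> ar s f i = fl i) ->
  (forall i, i < n -> fl i <= 1) ->
  wp w inp (p_poly a f P) s (fun s' =>
    (forall x, x < 2 * M -> ar s' P x = pcoef (fun i => hashn k n sh (g i)) fl n x) /\
    ck s' <= ck s + 100 * M + 100 * n + 50).
Proof.
  intros Ha Hff HP He H7 Hg Hfl Hf1. unfold p_poly.
  pose proof (X12_word k n Hk) as HX. fold X12 in HX.
  pose proof (X12_facts k n Hk) as (B1 & B2 & B3 & B4 & B5 & B6 & B7 & B8 & B9). fold X12 in B4.
  assert (HTT : 2 * (TL * TL) <= TL * TL * TL * TL).
  { clear - B3. set (T := TL) in *. clearbody T. nia. }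
  pose proof (M_pos n) as HM.
  assert (HaP : Nat.eqb a P = false) by (apply Nat.eqb_neq; lia).
  assert (HfP : Nat.eqb f P = false) by (apply Nat.eqb_neq; lia).
  destruct He as (H0 & H1 & H2 & H3 & H4 & H5 & H6 & H8 & H9 & H10 & H11 & H12 & H29 & H30).
  apply wp_seq. apply wp_tab with (a := P) (K := 20) (N := 2 * M) (f := fun _ => 0); auto; try lia.
  { intros i s' Hi F Hx. apply wp_sto; ev; known; [exact I|lia|lia|]. split; [|cbn [ecost]; lia].
    unfold aset. now rewrite Nat.eqb_refl. }
  intros s1 F1 A1 C1. carry F1.
  assert (Ea : ar s1 a = ar s a) by (apply F1; cbn -[Nat.eqb]; now rewrite HaP).
  assert (Ef : ar s1 f = ar s f) by (apply F1; cbn -[Nat.eqb]; now rewrite HfP).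
  clear F1.
  set (h := fun i => hashn k n sh (g i)).
  apply wp_for with (K := 60) (N := n)
    (I := fun i s' => forall x, x < 2 * M -> ar s' P x = pcoef h fl i x); auto; try lia.
  { intros i s' Hi F I1 Hx. carry F.
    assert (Ea' : ar s' a = ar s a) by (rewrite <- Ea; apply F; cbn -[Nat.eqb]; now rewrite HaP).
    assert (Ef' : ar s' f = ar s f) by (rewrite <- Ef; apply F; cbn -[Nat.eqb]; now rewrite HfP).
    clear F. pose proof (hashn_lt k n Hk sh (g i)) as Hh.
    asg hv Ehv. rewrite Hg in Ehv by auto. change (hv = h i) in Ehv. change (h i < M) in Hh.
    assert (Hc : pcoef h fl i hv <= i) by (apply pcoef_le; intros; apply Hf1; lia).
    assert (Hfi : fl i <= 1) by auto.
    apply wp_sto; ev; known; rewrite ?Hfl, ?I1 by lia; [exact I|repeat split; auto; lia|lia|].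
    split; [|cbn [ecost bcost]; lia].
    intros x Hxx. unfold aset. rewrite Nat.eqb_refl. unfold pcoef. cbn [sumn]. fold (pcoef h fl i x).
    rewrite <- Ehv. unfold wr, upd. rewrite (Nat.eqb_sym x hv).
    destruct (Nat.eqb_spec hv x) as [->|]; [|rewrite I1 by lia; lia]. reflexivity. }
  intros s2 F2 I2 _ C2. split; auto. lia.
Qed.

Lemma bucket_mod x : (x / (TL * TL)) / SK = x / (TL * TL * SK).
Proof. now rewrite Nat.Div0.div_div. Qed.

Lemma sumn_tail_zero m m' f : m <= m' -> (forall i, m <= i < m' -> f i = 0) -> sumn m' f = sumn m f.
Proof.
  induction 1 as [|m' Hm IH]; intros Hf; auto. cbn [sumn]. rewrite IH by (intros; apply Hf; lia).
  rewrite (Hf m') by lia. lia.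
Qed.

(* The records of bucket [r] with a sum other than [c] are visited one by one;
   those with sum [c] are contiguous and skipped in one step. *)
Lemma bucket_spec e s (X sums g : nat -> nat) (fA fB : nat -> nat) c h N cv fp :
  let r := (h + M - e) mod M in
  let F := fun p => if (g p =? r) && negb (sums p =? c) then 1 else 0 in
  let G := fun p => F p * (fA (X p / TL mod TL) * fB (X p mod TL)) in
  e <= 1 -> penv k n s -> va s 15 = c -> va s 16 = h -> va s 17 = cv -> va s 18 = fp -> h < M -> N = n * n ->
  ar s 2 = X -> ar s 7 = fA -> ar s 8 = fB ->
  g = (fun p => X p / (TL * TL * SK)) -> sums = (fun p => X p / (TL * TL) mod SK) ->
  sorted_arr X N -> (forall p, p < N -> fA (X p / TL mod TL) <= 1 /\ fB (X p mod TL) <= 1) ->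
  (forall r, r < M -> startok g N r (ar s 5 r)) ->
  (forall p, p < N -> nxok (fun p => X p / (TL * TL)) N p (ar s 6 p)) ->
  cv + ar s 9 r + ar s 9 (r + M) < 2 ^ w -> fp + N < 2 ^ w -> c < SK ->
  wp w inp (p_bucket e) s (fun s' =>
    va s' 17 = cv + ar s 9 r + ar s 9 (r + M) /\ va s' 18 = fp + sumn N G /\
    ck s' <= ck s + 100 * sumn N F + 300).
Proof.
  intros r F G He1 He H15 H16 H17 H18 Hh HN HX2 HA7 HA8 Hgd Hsd HS Hfl Hst Hnx Hcv Hfp Hc.
  pose proof (X12_word k n Hk) as HX. fold X12 in HX.
  pose proof (X12_facts k n Hk) as (B1 & B2 & B3 & B4 & B5 & B6 & B7 & B8 & B9). fold X12 in B4.
  assert (HTT : 2 * (TL * TL) <= TL * TL * TL * TL).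
  { clear - B3. set (T := TL) in *. clearbody T. nia. }
  pose proof (M_pos n) as HM.
  destruct He as (H0 & H1 & H2 & H3 & H4 & H5 & H6 & H8 & H9 & H10 & H11 & H12 & H29 & H30).
  assert (Hr : r < M) by (apply Nat.mod_upper_bound; lia).
  destruct (Hst r Hr) as (St1 & St2 & St3).
  unfold p_bucket. rewrite <- HN in *.
  asg rv0 Erv. change (rv0 = r) in Erv. subst rv0.
  asg cv' Ecv. asg p0 Ep0.
  assert (Hb1 : forall c : bool, (if c then 1 else 0) <= 1) by (intros []; lia).
  asg b0 Eb0; try (match goal with |- ?A * ?B < _ => assert (A * B <= 1 * 1) by (apply Nat.mul_le_mono; apply Hb1) end; lia).
  assert (HNX : N <= X12) by lia.
  set (K := fun p => X p / (TL * TL)).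
  assert (Hgx : forall p, X p / (TL * TL * SK) = g p) by (intros; now rewrite Hgd).
  assert (HKg : forall p, K p = g p * SK + sums p).
  { intros p. rewrite Hgd, Hsd. unfold K. rewrite <- bucket_mod, (Nat.mul_comm _ SK). apply Nat.div_mod_eq. }
  assert (HKmono : forall p q, p <= q -> q < N -> K p <= K q).
  { intros p q Hpq Hq. apply Nat.Div0.div_le_mono. auto. }
  assert (Hgmono : forall p q, p <= q -> q < N -> g p <= g q).
  { intros p q Hpq Hq. rewrite Hgd. apply Nat.Div0.div_le_mono. auto. }
  assert (Hcond : forall p, (if p <? N then 1 else 0) * (if g p =? r then 1 else 0) <> 0 -> p < N /\ g p = r).
  { intros p. destruct (Nat.ltb_spec p N), (Nat.eqb_spec (g p) r); simpl; auto; lia. }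
  assert (HF1 : forall p, F p <= 1) by (intros; unfold F; destruct (_ && _); lia).
  assert (HG1 : forall p, p < N -> G p <= 1).
  { intros p Hp. destruct (Hfl p Hp). specialize (HF1 p). unfold G.
    destruct (F p) as [|[|]]; [lia| |lia]. destruct (fA _) as [|[|]]; lia. }
  assert (HsG : forall p, p <= N -> sumn p G <= p).
  { intros p Hp. rewrite <- (Nat.mul_1_r p) at 2. apply sumn_bound. intros. apply HG1. lia. }
  (* [sk] tells whether the run of sum [c] has been jumped over. This happens at most once, since
     afterwards no record of the bucket has that sum; the time is thus charged to the false
     positives and one jump. *)
  apply wp_while with (m := N - p0) (I := fun m s' => exists p sk, m = N - p /\ p <= N /\
    va s' 3 = TL /\ va s' 8 = SK /\ va s' 9 = N /\ va s' 29 = TL * TL /\ va s' 30 = TL * TL * SK /\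
    va s' 15 = c /\ va s' 19 = r /\ va s' 17 = cv' /\
    ar s' 2 = X /\ ar s' 6 = ar s 6 /\ ar s' 7 = fA /\ ar s' 8 = fB /\
    va s' 20 = p /\ va s' 18 = fp + sumn p G /\
    va s' 21 = (if p <? N then 1 else 0) * (if g p =? r then 1 else 0) /\
    (p < N -> r <= g p) /\ sk <= 1 /\
    (sk = 1 -> forall q, p <= q < N -> g q = r -> sums q <> c) /\
    ck s' <= ck s + 90 * (sumn p F + sk) + 100).
  { assert (Z0 : forall q, q < p0 -> F q = 0).
    { intros q Hq. unfold F. destruct (Nat.eqb_spec (g q) r) as [E|]; [|reflexivity].
      rewrite <- Ep0 in *. pose proof (St2 q ltac:(lia) E). lia. }
    exists p0, 0. rewrite <- Ep0 in *. ev.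
    rewrite (sumn_tail_zero 0 p0 F) by (try lia; intros; apply Z0; lia).
    rewrite (sumn_tail_zero 0 p0 G) by (try lia; intros; unfold G; rewrite Z0; lia).
    cbn [sumn]. rewrite Eb0, Hgx. repeat (split; [solve [auto; lia]|]).
    cbn [ecost bcost]. lia. }
  intros m s' (p & sk & Em & HpN & A3 & A8 & A9 & A29 & A30 & A15 & A19 & A17 & R2 & R6 & R7 & R8 &
    A20 & A18 & A21 & Hrg & Hsk & Hskc & Ck).
  split; [exact I|]. ev. rewrite A21. split.
  - intros Hz.
    (* The loop stops at the end of the table or in another bucket; buckets are sorted and [p] has
       reached at least [r], so no record of bucket [r] can follow. *)
    assert (ZF : forall q, p <= q < N -> F q = 0).
    { intros q Hq. unfold F. destruct (Nat.eqb_spec (g q) r) as [E|]; [|reflexivity]. exfalso.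
      pose proof (Hgmono p q ltac:(lia) ltac:(lia)). specialize (Hrg ltac:(lia)).
      destruct (Nat.ltb_spec p N); [|lia]. destruct (Nat.eqb_spec (g p) r); [discriminate|lia]. }
    rewrite (sumn_tail_zero p N F) by auto.
    rewrite (sumn_tail_zero p N G) by (auto; intros; unfold G; rewrite ZF; auto).
    split; [congruence|split; [exact A18|]]. cbn [ecost]. lia.
  - intros Hz. destruct (Hcond p Hz) as [Hp Hgp]. clear Hz.
    destruct (Hfl p Hp) as [Hf1 Hf2].
    asg x Ex2.
    assert (Exs : x / (TL * TL) mod SK = sums p) by (rewrite Ex2, Hsd; reflexivity).
    assert (Hnext : forall s1 v sk', v <= N -> p < v ->
       va s1 3 = TL -> va s1 8 = SK -> va s1 9 = N -> va s1 29 = TL * TL -> va s1 30 = TL * TL * SK ->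
       va s1 15 = c -> va s1 19 = r -> va s1 17 = cv' ->
       ar s1 2 = X -> ar s1 6 = ar s 6 -> ar s1 7 = fA -> ar s1 8 = fB ->
       va s1 20 = v -> va s1 18 = fp + sumn v G -> sk' <= 1 ->
       (sk' = 1 -> forall q, v <= q < N -> g q = r -> sums q <> c) ->
       ck s1 + 30 <= ck s + 90 * (sumn v F + sk') + 100 ->
       wp w inp (21 <- e_inbucket) s1 (fun s' => exists m', m' < m /\ exists p sk, m' = N - p /\ p <= N /\
    va (tick 1 s') 3 = TL /\ va (tick 1 s') 8 = SK /\ va (tick 1 s') 9 = N /\ va (tick 1 s') 29 = TL * TL /\ va (tick 1 s') 30 = TL * TL * SK /\
    va (tick 1 s') 15 = c /\ va (tick 1 s') 19 = r /\ va (tick 1 s') 17 = cv' /\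
    ar (tick 1 s') 2 = X /\ ar (tick 1 s') 6 = ar s 6 /\ ar (tick 1 s') 7 = fA /\ ar (tick 1 s') 8 = fB /\
    va (tick 1 s') 20 = p /\ va (tick 1 s') 18 = fp + sumn p G /\
    va (tick 1 s') 21 = (if p <? N then 1 else 0) * (if g p =? r then 1 else 0) /\
    (p < N -> r <= g p) /\ sk <= 1 /\
    (sk = 1 -> forall q, p <= q < N -> g q = r -> sums q <> c) /\
    ck (tick 1 s') <= ck s + 90 * (sumn p F + sk) + 100)).
    { intros s1 v sk' Hv Hpv G3 G8 G9 G29 G30 G15 G19 G17 Q2 Q6 Q7 Q8 G20 G18 Hsk' Hskc' Hck'.
      asg b1 Eb1; try (match goal with |- ?A * ?B < _ => assert (A * B <= 1 * 1) by (apply Nat.mul_le_mono; apply Hb1) end; lia).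
      exists (N - v). split; [lia|]. exists v, sk'. rewrite Eb1, Hgx.
      repeat (split; [solve [auto; lia]|]).
      split; [intros HH; specialize (Hgmono p v ltac:(lia) HH); lia|].
      split; [auto|split; [auto|]]. cbn [ecost bcost]. lia. }
    cbv beta in Hnext.
    destruct (Hnx p Hp) as (V1 & V2 & V3).
    apply wp_seq. apply wp_if; ev; rewrite ?A8, ?A15, ?A29, ?Exs; [repeat split; auto| |]; intros Hsc.
    + destruct (Nat.eqb_spec (sums p) c) as [Esc|]; [|congruence].
      assert (Esk : sk = 0).
      { destruct sk as [|[|]]; [auto| |lia]. exfalso. apply (Hskc eq_refl p); auto; lia. }
      apply wp_asg; ev; rewrite ?A20; [repeat split; auto; lia|]. intros v Ev. rewrite R6 in Ev.
      rewrite <- Ev in *.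
      assert (ZF : forall q, p <= q < v -> F q = 0).
      { intros q Hq. unfold F. specialize (V2 q Hq). change (K q = K p) in V2.
        assert (sums q = c) as ->.
        { rewrite <- Esc. rewrite Hsd. change (K q mod SK = K p mod SK). now rewrite V2. }
        rewrite Nat.eqb_refl, andb_false_r. reflexivity. }
      apply (Hnext _ v 1); ev; auto; try lia.
      * rewrite (sumn_tail_zero p v G); [auto|lia|]. intros q Hq. unfold G. rewrite ZF; auto.
      (* A later record of this bucket with sum [c] would have the key of [p]; sortedness then gives
         record [v] that key as well, against the choice of [v]. *)
      * intros _ q Hq Hgq Hsq. specialize (V3 ltac:(lia)). apply V3.
        change (K v = K p).
        pose proof (HKmono p v ltac:(lia) ltac:(lia)). pose proof (HKmono v q ltac:(lia) ltac:(lia)) as HH.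
        rewrite (HKg q), Hgq, Hsq in HH. rewrite (HKg p), Hgp, Esc in *. lia.
      * rewrite (sumn_tail_zero p v F); [|lia|auto]. cbn [ecost bcost tick ck]. lia.
    + destruct (Nat.eqb_spec (sums p) c) as [|Esc]; [discriminate|].
      assert (EF : F p = 1).
      { unfold F. rewrite Hgp, Nat.eqb_refl. destruct (Nat.eqb_spec (sums p) c); [contradiction|reflexivity]. }
      assert (EG : G p = fA (x / TL mod TL) * fB (x mod TL)) by (unfold G; rewrite EF, Ex2; lia).
      pose proof (HsG p HpN) as HsGp. pose proof (HG1 p Hp) as HG1p.
      assert (HxT : x / TL mod TL < TL /\ x mod TL < TL) by (split; apply Nat.mod_upper_bound; lia).
      apply wp_seq. apply wp_asg; ev; rewrite ?A3, ?A18, ?A20, ?R7, ?R8.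
      { rewrite <- ?EG. rewrite Ex2 in *. repeat split; auto; try lia. }
      intros v18 E18. rewrite <- EG in E18.
      apply wp_asg; ev; rewrite ?A20; [repeat split; auto; lia|]. intros v20 E20'.
      rewrite Nat.add_1_r in E20'.
      apply (Hnext _ (S p) sk); ev; auto; try lia.
      * rewrite E18. cbn [sumn]. lia.
      * intros Hs1 q Hq. apply Hskc; auto. lia.
      * cbn [sumn]. rewrite EF. cbn [ecost bcost]. lia.
Qed.

Section Answer.
Variables (sh : nat) (a b : nat -> nat) (A' B' : list nat).
Hypothesis Ha : forall i, i < n -> a i < n ^ k.
Hypothesis Hb : forall i, i < n -> b i < n ^ k.
Let fA := fun i => memn (a i) A'.
Let fB := fun j => memn (b j) B'.
Let h1 := fun i => hashn k n sh (a i).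
Let h2 := fun j => hashn k n sh (b j).

Lemma pconvn_fold r : r < M ->
  pconvn h1 fA h2 fB n r + pconvn h1 fA h2 fB n (r + M) =
  sumn n (fun i => sumn n (fun j => if (h1 i + h2 j) mod M =? r then fA i * fB j else 0)).
Proof.
  intros Hr. unfold pconvn. rewrite <- sumn_add. apply sumn_ext. intros i Hi.
  rewrite <- sumn_add. apply sumn_ext. intros j Hj.
  pose proof (hashn_lt k n Hk sh (a i)) as L1. pose proof (hashn_lt k n Hk sh (b j)) as L2.
  change (h1 i < M) in L1. change (h2 j < M) in L2.
  destruct (Nat.lt_ge_cases (h1 i + h2 j) M) as [H|H].
  - rewrite Nat.mod_small by auto. destruct (Nat.eqb_spec (h1 i + h2 j) (r + M)); lia.
  - replace (h1 i + h2 j) with (h1 i + h2 j - M + 1 * M) at 3 by lia.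
    rewrite Nat.Div0.mod_add, Nat.mod_small by lia.
    destruct (Nat.eqb_spec (h1 i + h2 j) r), (Nat.eqb_spec (h1 i + h2 j) (r + M)),
      (Nat.eqb_spec (h1 i + h2 j - M) r); lia.
Qed.

Variable X : nat -> nat.
Hypothesis HX : Permutation (map X (seq 0 (n * n)))
  (map (fun t => enc k n sh a b (t / n) (t mod n)) (seq 0 (n * n))).

Lemma records_sum (G : nat -> nat) (GG : nat -> nat -> nat) :
  (forall i j, i < n -> j < n -> G (enc k n sh a b i j) = GG i j) ->
  sumn (n * n) (fun p => G (X p)) = sumn n (fun i => sumn n (GG i)).
Proof.
  intros HG. rewrite (sumn_perm _ _ _ _ HX).
  rewrite <- (sumn_square n n GG). apply sumn_ext. intros t Ht.
  assert (0 < n) by (destruct n; simpl in *; lia).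
  apply HG; [apply Nat.Div0.div_lt_upper_bound; auto|apply Nat.mod_upper_bound; lia].
Qed.

Lemma fp_indicator c e i j : i < n -> j < n ->
  (if (enc k n sh a b i j / (TL * TL * SK) =? bidx k n sh c e) &&
      negb (enc k n sh a b i j / (TL * TL) mod SK =? c) then 1 else 0)
  = (if a i + b j =? c then 0 else b2n (inb k n sh c e (a i) (b j))).
Proof.
  intros Hi Hj. destruct (enc_decode k n Hk sh a b Ha Hb i j Hi Hj) as (_ & _ & _ & -> & ->).
  unfold inb. destruct (a i + b j =? c); [now rewrite andb_false_r|].
  rewrite andb_true_r. reflexivity.
Qed.

(** The number of false positives in the bucket, on which the time depends; [fpw] weighs them with
    the membership flags and is what the query subtracts. *)
Definition fpe c e : nat :=
  sumn n (fun i => sumn n (fun j => if a i + b j =? c then 0 else b2n (inb k n sh c e (a i) (b j)))).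
Definition fpw c e : nat :=
  sumn n (fun i => sumn n (fun j =>
    (if a i + b j =? c then 0 else b2n (inb k n sh c e (a i) (b j))) * (fA i * fB j))).

Lemma bucket_sums (phA phB : nat -> nat) c e :
  (forall i, i < n -> phA i = memn (a i) A') -> (forall j, j < n -> phB j = memn (b j) B') ->
  let F := fun p => if (X p / (TL * TL * SK) =? bidx k n sh c e) && negb (X p / (TL * TL) mod SK =? c)
                    then 1 else 0 in
  sumn (n * n) F = fpe c e /\
  sumn (n * n) (fun p => F p * (phA (X p / TL mod TL) * phB (X p mod TL))) = fpw c e.
Proof.
  intros HpA HpB F. split.
  - unfold F. apply (records_sum (fun x => if (x / (TL * TL * SK) =? bidx k n sh c e) &&
      negb (x / (TL * TL) mod SK =? c) then 1 else 0)).
    intros i j Hi Hj. now apply fp_indicator.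
  - unfold F. apply (records_sum (fun x => (if (x / (TL * TL * SK) =? bidx k n sh c e) &&
      negb (x / (TL * TL) mod SK =? c) then 1 else 0) * (phA (x / TL mod TL) * phB (x mod TL)))).
    intros i j Hi Hj. rewrite fp_indicator by auto.
    destruct (enc_decode k n Hk sh a b Ha Hb i j Hi Hj) as (-> & -> & _).
    now rewrite HpA, HpB.
Qed.

Lemma record_indices p : p < n * n -> X p / TL mod TL < n /\ X p mod TL < n.
Proof.
  intros Hp. assert (In (X p) (map X (seq 0 (n * n)))) as Hin by (apply in_map, in_seq; lia).
  apply (Permutation_in _ HX), in_map_iff in Hin as (t & <- & Ht). apply in_seq in Ht.
  assert (0 < n) by (destruct n; simpl in *; lia).
  assert (t / n < n) by (apply Nat.Div0.div_lt_upper_bound; lia).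
  assert (t mod n < n) by (apply Nat.mod_upper_bound; lia).
  now destruct (enc_decode k n Hk sh a b Ha Hb (t / n) (t mod n)) as (-> & -> & _).
Qed.

Definition cve c e : nat :=
  pconvn h1 fA h2 fB n (bidx k n sh c e) + pconvn h1 fA h2 fB n (bidx k n sh c e + M).

(** In each bucket the count exceeds the false positives by the number of its pairs from [A'] and
    [B'] with sum [c], and by [inb_true] every such pair lies in one of the two buckets. *)
Lemma answer_iff c :
  fpw c 0 + fpw c 1 < cve c 0 + cve c 1 <->
  exists i j, i < n /\ j < n /\ fA i = 1 /\ fB j = 1 /\ a i + b j = c.
Proof.
  assert (HE : forall e, cve c e = fpw c e + sumn n (fun i => sumn n (fun j =>
     (if a i + b j =? c then b2n (inb k n sh c e (a i) (b j)) else 0) * (fA i * fB j)))).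
  { intros e. unfold cve, fpw. rewrite pconvn_fold.
    2:{ apply Nat.mod_upper_bound. pose proof (M_pos n). lia. }
    rewrite <- sumn_add. apply sumn_ext. intros i Hi. rewrite <- sumn_add. apply sumn_ext. intros j Hj.
    unfold inb. change (hashn k n sh (a i)) with (h1 i). change (hashn k n sh (b j)) with (h2 j).
    destruct (a i + b j =? c), ((h1 i + h2 j) mod M =? bidx k n sh c e); simpl; lia. }
  rewrite !HE. clear HE. split.
  - intros H.
    assert (exists e, 0 < sumn n (fun i => sumn n (fun j =>
     (if a i + b j =? c then b2n (inb k n sh c e (a i) (b j)) else 0) * (fA i * fB j)))) as (e & He).
    { set (S0 := sumn n _) in H at 1. match type of H with _ < _ + _ + (_ + ?s1) => set (S1 := s1) in H end.
      destruct (Nat.eq_dec S0 0); [exists 1; fold S1; lia|exists 0; fold S0; lia]. }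
    apply sumn_pos in He as (i & Hi & He). apply sumn_pos in He as (j & Hj & He).
    exists i, j. destruct (Nat.eqb_spec (a i + b j) c) as [E|]; [|simpl in He; lia].
    unfold fA, fB in *. destruct (memn_01 (a i) A') as [E1|E1], (memn_01 (b j) B') as [E2|E2];
      rewrite ?E1, ?E2 in *; auto; lia.
  - intros (i & j & Hi & Hj & E1 & E2 & E).
    assert (HT : forall e, inb k n sh c e (a i) (b j) = true -> 0 < sumn n (fun i => sumn n (fun j =>
     (if a i + b j =? c then b2n (inb k n sh c e (a i) (b j)) else 0) * (fA i * fB j)))).
    { intros e He. eapply Nat.lt_le_trans; [|apply (sumn_term n _ i Hi)]. cbv beta.
      eapply Nat.lt_le_trans; [|apply (sumn_term n _ j Hj)]. cbv beta.
      rewrite E, Nat.eqb_refl, He, E1, E2. simpl. lia. }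
    destruct (inb_true k n sh (a i) (b j)) as [Hin|Hin]; rewrite E in Hin.
    + specialize (HT 0 Hin). lia.
    + specialize (HT 1 Hin). lia.
Qed.

End Answer.

Lemma fpe_fpsum sh (a b : nat -> nat) A B c :
  Permutation (map a (seq 0 n)) A -> Permutation (map b (seq 0 n)) B ->
  fpe sh a b c 0 + fpe sh a b c 1 = fpsum k n sh A B c.
Proof.
  intros HA HB. unfold fpe, fpsum. rewrite <- sumn_add.
  rewrite <- (sumn_perm_list n a A _ HA). apply sumn_ext. intros i Hi.
  rewrite <- sumn_add, <- (sumn_perm_list n b B _ HB). apply sumn_ext. intros j Hj.
  unfold fpind. destruct (_ =? c); reflexivity.
Qed.

Lemma answers_spec sh s (a b X : nat -> nat) A B A' B' C' :
  penv k n s -> va s 7 = sh -> va s 31 = length A' -> va s 32 = length B' -> ou s = [] ->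
  length A' <= n -> length B' <= n ->
  Permutation (map a (seq 0 n)) A -> Permutation (map b (seq 0 n)) B ->
  (forall i, i < n -> a i < n ^ k) -> (forall i, i < n -> b i < n ^ k) ->
  Permutation (map X (seq 0 (n * n)))
    (map (fun t => enc k n sh a b (t / n) (t mod n)) (seq 0 (n * n))) -> sorted_arr X (n * n) ->
  ar s 2 = X ->
  (forall i, i < n -> ar s 7 i = memn (a i) A') -> (forall i, i < n -> ar s 8 i = memn (b i) B') ->
  (forall g, g < 2 * M -> ar s 9 g = pconvn (fun i => hashn k n sh (a i)) (fun i => memn (a i) A')
      (fun j => hashn k n sh (b j)) (fun j => memn (b j) B') n g) ->
  (forall r, r < M -> startok (fun p => X p / (TL * TL * SK)) (n * n) r (ar s 5 r)) ->
  (forall p, p < n * n -> nxok (fun p => X p / (TL * TL)) (n * n) p (ar s 6 p)) ->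
  (forall x, In x A' -> In x A) -> (forall x, In x B' -> In x B) ->
  length C' = n -> (forall x, In x C' -> x < n ^ k) ->
  (forall t, t < n -> nth (3 + length A' + length B' + t) inp 0 = nth t C' 0) ->
  wp w inp (33 <- C 3 +: V 31 +: V 32 ;;
    CFor 35 0 (
    15 <- EIn (V 33 +: V 35) ;; 16 <- e_hash (V 15) ;; 17 <- C 0 ;; 18 <- C 0 ;;
    p_bucket 0 ;; p_bucket 1 ;; COut (V 18 <: V 17))) s (fun s' => ou s' = answer A' B' C' /\
    ck s' <= ck s + 1000 * n + 100 + 100 * list_sum (map (fpsum k n sh A B) C')).
Proof.
  intros He H7 H31 H32 Hou HlA HlB PA PB Ha Hb PX SX HX2 H7f H8f H9f Hst Hnx IA' IB' HlC HltC IC.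
  pose proof (X12_word k n Hk) as HX. fold X12 in HX.
  pose proof (X12_facts k n Hk) as (B1 & B2 & B3 & B4 & B5 & B6 & B7 & B8 & B9). fold X12 in B4.
  pose proof (M_pos n) as HM.
  assert (HTT : 2 * (TL * TL) <= TL * TL * TL * TL).
  { clear - B3. set (T := TL) in *. clearbody T. nia. }
  assert (Hnk : n ^ k < 2 ^ w).
  { eapply Nat.lt_le_trans; [apply nk_lt; auto|]. apply pow2_le. rewrite wn_eq.
    apply Nat.mul_le_mono_r. lia. }
  assert (HSKk : n ^ k < SK) by (pose proof (SK_ge k n Hk); pose proof (nk_lt k n Hk); lia).
  assert (H0 : va s 0 = n) by apply He.
  asg v33 E33.
  set (ans := fun c => if existsb (fun a => existsb (fun b => Nat.eqb (a + b) c) B') A' then 1 else 0).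
  (* The cost of a target depends on its own false positives, so a uniform bound per round would
     lose the expectation; [T] adds them up over the targets handled so far. *)
  apply wp_for_gen with (N := n) (T := fun t => 800 * t + 100 * list_sum (map (fpsum k n sh A B) (firstn t C')))
    (I := fun t s' => ou s' = map ans (firstn t C')); auto; try lia.
  { intros t s1 Ht F Io Hx.
    assert (He1 : penv k n s1) by (refine (penv_fr k n _ _ _ F eq_refl _); exact He).
    assert (K7 : va s1 7 = sh) by (rewrite (proj1 F 7 eq_refl); exact H7).
    assert (K33 : va s1 33 = 3 + length A' + length B') by (rewrite (proj1 F 33 eq_refl); exact E33).
    assert (R2 : ar s1 2 = X) by (rewrite (proj1 (proj2 F) 2 eq_refl); exact HX2).
    assert (R5 : ar s1 5 = ar s 5) by exact (proj1 (proj2 F) 5 eq_refl).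
    assert (R6 : ar s1 6 = ar s 6) by exact (proj1 (proj2 F) 6 eq_refl).
    assert (R7 : ar s1 7 = ar s 7) by exact (proj1 (proj2 F) 7 eq_refl).
    assert (R8 : ar s1 8 = ar s 8) by exact (proj1 (proj2 F) 8 eq_refl).
    assert (R9 : ar s1 9 = ar s 9) by exact (proj1 (proj2 F) 9 eq_refl).
    clear F. set (c := nth t C' 0) in *.
    assert (Hc : c < n ^ k) by (apply HltC, nth_In; lia).
    pose proof (hashn_lt k n Hk sh c) as Hh.
    asg c0 Ec; rewrite ?IC by auto; fold c; try lia. rewrite IC in Ec by auto. fold c in Ec. subst c0.
    assert (K6 : va s1 6 = U) by apply He1.
    asg h Eh. change (h = hashn k n sh c) in Eh. asg cv Ecv. asg fp Efp. subst cv fp.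
    assert (Hpcv : forall g, pconvn (fun i => hashn k n sh (a i)) (fun i => memn (a i) A')
      (fun j => hashn k n sh (b j)) (fun j => memn (b j) B') n g <= n * n).
    { intros g. apply pconvn_le; intros i; [destruct (memn_01 (a i) A')|destruct (memn_01 (b i) B')]; lia. }
    assert (Hr : forall e, bidx k n sh c e < M) by (intros; apply Nat.mod_upper_bound; lia).
    assert (Hcve : forall e, ar s 9 (bidx k n sh c e) + ar s 9 (bidx k n sh c e + M) = cve sh a b A' B' c e).
    { intros e. specialize (Hr e). rewrite !H9f by lia. reflexivity. }
    assert (Hcveb : forall e, cve sh a b A' B' c e <= 2 * (n * n)).
    { intros e. unfold cve. pose proof (Hpcv (bidx k n sh c e)). pose proof (Hpcv (bidx k n sh c e + M)).
      lia. }
    pose proof (bucket_sums sh a b A' B' Ha Hb X PX (ar s 7) (ar s 8) c) as HBS.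
    assert (Hfl : forall p, p < n * n -> ar s 7 (X p / TL mod TL) <= 1 /\ ar s 8 (X p mod TL) <= 1).
    { intros p Hp. destruct (record_indices sh a b Ha Hb X PX p Hp) as [Hi Hj].
      rewrite H7f, H8f by auto.
      destruct (memn_01 (a (X p / TL mod TL)) A'), (memn_01 (b (X p mod TL)) B'); lia. }
    assert (Hfpw : forall e, fpw sh a b A' B' c e <= n * n).
    { intros e. apply sumn_bound. intros i Hi. rewrite <- (Nat.mul_1_r n) at 2. apply sumn_bound. intros j Hj.
      destruct (memn_01 (a i) A') as [-> | ->], (memn_01 (b j) B') as [-> | ->];
        destruct (a i + b j =? c), (inb k n sh c e (a i) (b j)); simpl; lia. }
    apply wp_seq. eapply wp_conseq_fr.
    { eapply (bucket_spec 0 _ X (fun p => X p / (TL * TL) mod SK) (fun p => X p / (TL * TL * SK))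
         (ar s 7) (ar s 8) c h (n * n) 0 0); auto; try lia; ev; rewrite ?R5, ?R6, ?R9; auto;
      try (rewrite Eh; change ((hashn k n sh c + M - 0) mod M) with (bidx k n sh c 0); rewrite <- Nat.add_assoc, Hcve;
           pose proof (Hcveb 0); lia). }
    intros s2 F2 (P17 & P18 & C2).
    pose proof (penv_fr k n _ _ _ F2 eq_refl He1) as He2.
    clear He1. destruct (HBS 0 H7f H8f) as [HF0 HG0]. destruct (HBS 1 H7f H8f) as [HF1 HG1]. clear HBS.
    pose proof (eq_refl : (hashn k n sh c + M - 0) mod M = bidx k n sh c 0) as Hb0.
    pose proof (eq_refl : (hashn k n sh c + M - 1) mod M = bidx k n sh c 1) as Hb1.
    rewrite Eh in P17, P18, C2. cbn [ar ck ecost] in P17, P18, C2.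
    rewrite Hb0, R9, <- Nat.add_assoc, Hcve in P17. rewrite Hb0, HG0 in P18. rewrite Hb0, HF0 in C2.
    assert (K15 : va s2 15 = c) by exact (proj1 F2 15 eq_refl).
    assert (K16 : va s2 16 = hashn k n sh c) by (rewrite (proj1 F2 16 eq_refl); exact Eh).
    assert (T2 : ar s2 2 = X) by (rewrite (proj1 (proj2 F2) 2 eq_refl); exact R2).
    assert (T5 : ar s2 5 = ar s 5) by (rewrite (proj1 (proj2 F2) 5 eq_refl); exact R5).
    assert (T6 : ar s2 6 = ar s 6) by (rewrite (proj1 (proj2 F2) 6 eq_refl); exact R6).
    assert (T7 : ar s2 7 = ar s 7) by (rewrite (proj1 (proj2 F2) 7 eq_refl); exact R7).
    assert (T8 : ar s2 8 = ar s 8) by (rewrite (proj1 (proj2 F2) 8 eq_refl); exact R8).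
    assert (T9 : ar s2 9 = ar s 9) by (rewrite (proj1 (proj2 F2) 9 eq_refl); exact R9).
    assert (O2 : ou s2 = map ans (firstn t C')) by (rewrite (proj1 (proj2 (proj2 F2)) eq_refl); exact Io).
    clear F2.
    pose proof (Hcveb 0) as Q0. pose proof (Hcveb 1) as Q1. pose proof (Hfpw 0) as Q2. pose proof (Hfpw 1) as Q3.
    apply wp_seq. eapply wp_conseq_fr.
    { eapply (bucket_spec 1 _ X (fun p => X p / (TL * TL) mod SK) (fun p => X p / (TL * TL * SK))
         (ar s 7) (ar s 8) c (hashn k n sh c) (n * n)); eauto; try lia; rewrite ?T5, ?T6, ?T9; auto; try lia.
      rewrite Hb1, <- Nat.add_assoc, Hcve. lia. }
    intros s3 F3 (P17' & P18' & C3). rewrite Hb1, T9, <- Nat.add_assoc, Hcve in P17'.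
    rewrite Hb1, HG1 in P18'. rewrite Hb1, HF1 in C3.
    assert (O3 : ou s3 = map ans (firstn t C')) by (rewrite (proj1 (proj2 (proj2 F3)) eq_refl); exact O2).
    clear F3. apply wp_out; ev; [repeat split; auto|]. rewrite P17', P18', O3.
    split.
    - rewrite firstn_snoc by lia. rewrite map_app. f_equal. cbn [map]. fold c. f_equal.
      pose proof (answer_iff sh a b A' B' c) as HA. unfold ans.
      destruct (existsb (fun a0 => existsb (fun b0 => a0 + b0 =? c) B') A') eqn:EX.
      + apply existsb_exists in EX as (x & Hx1 & EX). apply existsb_exists in EX as (y & Hy1 & EX).
        apply Nat.eqb_eq in EX.
        destruct (perm_in a n A x PA (IA' x Hx1)) as (i & Hi & <-).
        destruct (perm_in b n B y PB (IB' y Hy1)) as (j & Hj & <-).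
        destruct HA as [_ HA]. rewrite <- !memn_iff in *.
        specialize (HA (ex_intro _ i (ex_intro _ j (conj Hi (conj Hj (conj Hx1 (conj Hy1 EX))))))).
        destruct (Nat.ltb_spec (0 + fpw sh a b A' B' c 0 + fpw sh a b A' B' c 1)
          (0 + cve sh a b A' B' c 0 + cve sh a b A' B' c 1)); auto. lia.
      + destruct (Nat.ltb_spec (0 + fpw sh a b A' B' c 0 + fpw sh a b A' B' c 1)
          (0 + cve sh a b A' B' c 0 + cve sh a b A' B' c 1)) as [HL|]; auto.
        destruct HA as [HA _]. destruct (HA ltac:(lia)) as (i & j & Hi & Hj & Hx1 & Hy1 & EQ).
        rewrite memn_iff in Hx1, Hy1. exfalso. rewrite <- not_true_iff_false in EX. apply EX.
        apply existsb_exists. exists (a i). split; auto. apply existsb_exists. exists (b j). split; auto.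
        now apply Nat.eqb_eq.
    - rewrite firstn_snoc by lia. rewrite map_app, list_sum_app. cbn [map list_sum fold_right]. fold c.
      rewrite <- (fpe_fpsum sh a b A B c PA PB). cbn [ecost bcost] in C2 |- *. lia. }
  intros s' F Io Hx Hck. split.
  - rewrite Io, <- HlC, firstn_all. reflexivity.
  - rewrite <- HlC, firstn_all, HlC in Hck. simpl firstn in Hck. cbn [ck ecost bcost map list_sum fold_right] in Hck. lia.
Qed.

Lemma query_spec s sh A B A' B' C' :
  inp = query_input n A' B' C' -> prepped k n sh A B s -> ou s = [] ->
  NoDup A -> NoDup B -> (forall x, In x A \/ In x B -> x < n ^ k) -> length A = n -> length B = n ->
  sub_set A' A -> sub_set B' B -> int_set n k C' ->
  wp w inp p_query s (fun s' => ou s' = answer A' B' C' /\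
    ck s' <= ck s + 2 * 4000 * (2 * M * ((l + 1) * (l + 1))) + 400 * M + n * (200 * L + 3000) + 1000 +
      100 * list_sum (map (fpsum k n sh A B) C')).
Proof.
  intros Hinp (He & H7 & (PA & SA) & (PB & SB) & (PX & SX) & Hst & Hnx) Hou HNA HNB Hlt HlA HlB
    (NA' & IA') (NB' & IB') (NC' & HlC & HltC).
  pose proof (X12_word k n Hk) as HX. fold X12 in HX.
  pose proof (X12_facts k n Hk) as (B1 & B2 & B3 & B4 & B5 & B6 & B7 & B8 & B9). fold X12 in B4.
  pose proof (M_pos n) as HM. pose proof (lpar_bounds n) as Hl. pose proof (Ln_pos n) as HL1.
  assert (HTT : 2 * (TL * TL) <= TL * TL * TL * TL).
  { clear - B3. set (T := TL) in *. clearbody T. nia. }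
  assert (Ha : forall i, i < n -> ar s 0 i < n ^ k) by (apply (sorted_bound k n Hk _ A); auto).
  assert (Hb : forall i, i < n -> ar s 1 i < n ^ k) by (apply (sorted_bound k n Hk _ B); auto).
  set (a := ar s 0) in *. set (b := ar s 1) in *. set (X := ar s 2) in *.
  assert (Hnk : n ^ k < 2 ^ w).
  { eapply Nat.lt_le_trans; [apply nk_lt; auto|]. apply pow2_le. rewrite wn_eq.
    apply Nat.mul_le_mono_r. lia. }
  assert (HlA' : length A' <= n) by (rewrite <- HlA; apply NoDup_incl_length; auto).
  assert (HlB' : length B' <= n) by (rewrite <- HlB; apply NoDup_incl_length; auto).
  assert (I1 : nth 1 inp 0 = length A') by (rewrite Hinp; reflexivity).
  assert (I2 : nth 2 inp 0 = length B') by (rewrite Hinp; reflexivity).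
  assert (IA : forall t, t < length A' -> nth (3 + t) inp 0 = nth t A' 0).
  { intros t Ht. rewrite Hinp. cbn [query_input nth Nat.add]. apply app_nth1. auto. }
  assert (IB : forall t, t < length B' -> nth (3 + length A' + t) inp 0 = nth t B' 0).
  { intros t Ht. rewrite Hinp. cbn [query_input nth Nat.add]. rewrite app_nth2, app_nth1 by lia. f_equal. lia. }
  assert (IC : forall t, t < n -> nth (3 + length A' + length B' + t) inp 0 = nth t C' 0).
  { intros t Ht. rewrite Hinp. cbn [query_input nth Nat.add]. rewrite !app_nth2 by lia. f_equal. lia. }
  unfold p_query.
  asg v31 E31; rewrite ?I1; try lia. rewrite I1 in E31. asg v32 E32; rewrite ?I2; try lia. rewrite I2 in E32.
  asg v33 E33.
  apply wp_seq. eapply wp_conseq_fr.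
  { apply (flags_spec 0 7 31 _ a A' 3); auto; try lia.
    - apply (perm_nodup_inj a n A); auto.
    - intros i Hi. specialize (Ha i Hi). lia.
    - intros x Hx. apply (perm_in a n A); auto. }
  intros s1 F1 (G7 & C1). cbn [ck ecost] in C1.
  pose proof (penv_fr k n _ _ _ F1 eq_refl He) as He1.
  assert (K31 : va s1 31 = length A') by (rewrite (proj1 F1 31 eq_refl); exact E31).
  assert (K32 : va s1 32 = length B') by (rewrite (proj1 F1 32 eq_refl); exact E32).
  assert (K7 : va s1 7 = sh) by (rewrite (proj1 F1 7 eq_refl); exact H7).
  assert (R0 : ar s1 0 = a) by exact (proj1 (proj2 F1) 0 eq_refl).
  assert (R1 : ar s1 1 = b) by exact (proj1 (proj2 F1) 1 eq_refl).
  assert (R2 : ar s1 2 = X) by exact (proj1 (proj2 F1) 2 eq_refl).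
  assert (R5 : ar s1 5 = ar s 5) by exact (proj1 (proj2 F1) 5 eq_refl).
  assert (R6 : ar s1 6 = ar s 6) by exact (proj1 (proj2 F1) 6 eq_refl).
  assert (O1 : ou s1 = []) by (rewrite (proj1 (proj2 (proj2 F1)) eq_refl); exact Hou). clear F1.
  asg v33' E33'.
  apply wp_seq. eapply wp_conseq_fr.
  { apply (flags_spec 1 8 32 _ b B' (3 + length A')); auto; try lia.
    - intros i Hi. cbn [ar]. now rewrite R1.
    - apply (perm_nodup_inj b n B); auto.
    - intros i Hi. specialize (Hb i Hi). lia.
    - intros x Hx. apply (perm_in b n B); auto. }
  intros s2 F2 (G8 & C2). cbn [ck ecost bcost] in C2.
  pose proof (penv_fr k n _ _ _ F2 eq_refl He1) as He2.
  assert (K31' : va s2 31 = length A') by (rewrite (proj1 F2 31 eq_refl); exact K31).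
  assert (K32' : va s2 32 = length B') by (rewrite (proj1 F2 32 eq_refl); exact K32).
  assert (K7' : va s2 7 = sh) by (rewrite (proj1 F2 7 eq_refl); exact K7).
  assert (S0 : ar s2 0 = a) by (rewrite <- R0; exact (proj1 (proj2 F2) 0 eq_refl)).
  assert (S1 : ar s2 1 = b) by (rewrite <- R1; exact (proj1 (proj2 F2) 1 eq_refl)).
  assert (S2 : ar s2 2 = X) by (rewrite <- R2; exact (proj1 (proj2 F2) 2 eq_refl)).
  assert (S5 : ar s2 5 = ar s 5) by (rewrite <- R5; exact (proj1 (proj2 F2) 5 eq_refl)).
  assert (S6 : ar s2 6 = ar s 6) by (rewrite <- R6; exact (proj1 (proj2 F2) 6 eq_refl)).
  assert (S7 : ar s2 7 = ar s1 7) by exact (proj1 (proj2 F2) 7 eq_refl).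
  assert (O2 : ou s2 = []) by (rewrite (proj1 (proj2 (proj2 F2)) eq_refl); exact O1). clear F2.
  rewrite <- S7 in G7. clear R0 R1 R2 R5 R6 S7 E31 E32 E33 E33' K31 K32 K7 O1 He1 v31 v32 v33 v33'.
  set (fA := fun i => memn (a i) A'). set (fB := fun i => memn (b i) B').
  set (h1 := fun i => hashn k n sh (a i)). set (h2 := fun i => hashn k n sh (b i)).
  assert (HfA : forall i, fA i <= 1) by (intros i; unfold fA; destruct (memn_01 (a i) A'); lia).
  assert (HfB : forall i, fB i <= 1) by (intros i; unfold fB; destruct (memn_01 (b i) B'); lia).
  apply wp_seq. eapply wp_conseq_fr.
  { apply (poly_spec 0 7 9 _ sh a fA); auto. now rewrite S0. }
  intros s3 F3 (G9 & C3). fold h1 in G9.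
  pose proof (penv_fr k n _ _ _ F3 eq_refl He2) as He3.
  assert (T7' : va s3 7 = sh) by (rewrite (proj1 F3 7 eq_refl); exact K7').
  assert (T1 : ar s3 1 = b) by (rewrite <- S1; exact (proj1 (proj2 F3) 1 eq_refl)).
  assert (T8 : ar s3 8 = ar s2 8) by exact (proj1 (proj2 F3) 8 eq_refl).
  apply wp_seq. eapply wp_conseq_fr.
  { apply (poly_spec 1 8 10 _ sh b fB); auto; [now rewrite T1|now rewrite T8]. }
  intros s4 F4 (G10 & C4). fold h2 in G10.
  pose proof (penv_fr k n _ _ _ F4 eq_refl He3) as He4.
  assert (T9 : ar s4 9 = ar s3 9) by exact (proj1 (proj2 F4) 9 eq_refl).
  assert (ED : 2 ^ (l + 1) = 2 * M) by (rewrite Nat.add_1_r; apply Nat.pow_succ_r').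
  assert (Hlpow : forall j, j <= 12 * L -> 2 ^ j <= X12) by (intros; apply pow2_le; auto).
  assert (Hh1 : forall i, h1 i < M) by (intros; apply hashn_lt; auto).
  assert (Hh2 : forall i, h2 i < M) by (intros; apply hashn_lt; auto).
  assert (Hpc : forall g, pconvn h1 fA h2 fB n g <= n * n).
  { intros g. now apply pconvn_le. }
  apply wp_seq. eapply wp_conseq_fr.
  (* Hash values are below [M], so the product has exponents below [2 * M = 2 ^ (l + 1)], and the
     negacyclic convolution of that length is the ordinary one. *)
  { apply (wp_mul w inp _ (fun g => Z.of_nat (pcoef h1 fA n g)) (fun g => Z.of_nat (pcoef h2 fB n g))
      (fun g => Z.of_nat (pconvn h1 fA h2 fB n g)) (l + 1)).
    - pose proof (Hlpow (2 * (l + 1)) ltac:(lia)). lia.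
    - lia.
    - rewrite ED. apply He4.
    - apply He4.
    - rewrite ED. intros g Hg. rewrite T9, G9 by auto. apply cw_const.
      pose proof (pcoef_le h1 fA n g ltac:(auto)). lia.
    - rewrite ED. intros g Hg. rewrite G10 by auto. apply cw_const.
      pose proof (pcoef_le h2 fB n g ltac:(auto)). lia.
    - intros z. rewrite ED, evb_pconvn, !evb_pcoef; auto.
      + intros i Hi. specialize (Hh2 i). lia.
      + intros i Hi. specialize (Hh1 i). lia.
      + intros i j Hi Hj. specialize (Hh1 i). specialize (Hh2 j). lia.
    - intros g Hg. split; [lia|]. rewrite <- Nat2Z.inj_mul. apply Nat2Z.inj_lt.
      apply (Nat.le_lt_trans _ X12); [|lia].
      etransitivity; [apply Nat.mul_le_mono_l; etransitivity; [apply Hpc|exact B8]|].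
      unfold TLn. rewrite <- !Nat.pow_add_r. apply Hlpow. lia. }
  intros s5 F5 (G5 & C5). rewrite ED in *.
  pose proof (penv_fr k n _ _ _ F5 eq_refl He4) as He5.
  assert (G9' : forall g, g < 2 * M -> ar s5 9 g = pconvn h1 fA h2 fB n g).
  { intros g Hg. apply Nat2Z.inj. auto. }
  assert (U31 : va s5 31 = length A') by (rewrite (proj1 F5 31 eq_refl), (proj1 F4 31 eq_refl), (proj1 F3 31 eq_refl); exact K31').
  assert (U32 : va s5 32 = length B') by (rewrite (proj1 F5 32 eq_refl), (proj1 F4 32 eq_refl), (proj1 F3 32 eq_refl); exact K32').
  assert (U7 : va s5 7 = sh) by (rewrite (proj1 F5 7 eq_refl), (proj1 F4 7 eq_refl); exact T7').
  assert (UO : ou s5 = []) by (rewrite (proj1 (proj2 (proj2 F5)) eq_refl), (proj1 (proj2 (proj2 F4)) eq_refl),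
    (proj1 (proj2 (proj2 F3)) eq_refl); exact O2).
  assert (U2 : ar s5 2 = X) by (rewrite (proj1 (proj2 F5) 2 eq_refl), (proj1 (proj2 F4) 2 eq_refl), (proj1 (proj2 F3) 2 eq_refl); exact S2).
  assert (U5 : ar s5 5 = ar s 5) by (rewrite (proj1 (proj2 F5) 5 eq_refl), (proj1 (proj2 F4) 5 eq_refl), (proj1 (proj2 F3) 5 eq_refl); exact S5).
  assert (U6 : ar s5 6 = ar s 6) by (rewrite (proj1 (proj2 F5) 6 eq_refl), (proj1 (proj2 F4) 6 eq_refl), (proj1 (proj2 F3) 6 eq_refl); exact S6).
  assert (U7f : ar s5 7 = ar s2 7) by (rewrite (proj1 (proj2 F5) 7 eq_refl), (proj1 (proj2 F4) 7 eq_refl); exact (proj1 (proj2 F3) 7 eq_refl)).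
  assert (U8f : ar s5 8 = ar s2 8) by (rewrite (proj1 (proj2 F5) 8 eq_refl), (proj1 (proj2 F4) 8 eq_refl); exact (proj1 (proj2 F3) 8 eq_refl)).
  clear F3 F4 F5.
  eapply wp_conseq.
  { apply (answers_spec sh s5 a b X A B A' B' C'); auto; [now rewrite U7f|now rewrite U8f|now rewrite U5|now rewrite U6]. }
  intros s6 [Ho C6]. split; [exact Ho|]. cbn [ck ecost bcost] in *.
  lia.
Qed.

End Query.

(** * Expected number of collisions *)

Lemma sumn_filter N (p : nat -> bool) : sumn N (fun i => b2n (p i)) = length (filter p (seq 0 N)).
Proof.
  induction N as [|N IH]; [reflexivity|].
  rewrite seq_S, filter_app, length_app. cbn [sumn]. rewrite IH. simpl. destruct (p N); reflexivity.
Qed.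

Lemma count_inj N m (f : nat -> nat) : (forall i j, i < N -> j < N -> f i = f j -> i = j) ->
  sumn N (fun i => b2n (f i <? m)) <= m.
Proof.
  intros Hf. rewrite sumn_filter, <- (length_map f), <- (length_seq m 0) at 1.
  apply NoDup_incl_length.
  - assert (HN : NoDup (filter (fun i => f i <? m) (seq 0 N))) by apply NoDup_filter, seq_NoDup.
    assert (HI : forall i, In i (filter (fun i => f i <? m) (seq 0 N)) -> i < N).
    { intros i Hi. apply filter_In in Hi as [Hi _]. apply in_seq in Hi. lia. }
    induction (filter (fun i => f i <? m) (seq 0 N)) as [|x l IH]; [constructor|].
    inversion HN; subst. cbn [map]. constructor.
    + intros Hin. apply in_map_iff in Hin as (y & E & Hy).
      assert (y = x) by (apply Hf; auto using in_eq, in_cons). congruence.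
    + apply IH; auto using in_cons.
  - intros v Hv. apply in_map_iff in Hv as (x & <- & Hx). apply filter_In in Hx as [_ Hx].
    apply Nat.ltb_lt in Hx. apply in_seq. lia.
Qed.

(** Induction on [u]. For even [d], the number [d], the offset, the window and the modulus are
    halved together, and the range of [s] covers two periods. For odd [d], multiplication by [d] is
    injective modulo [2 ^ w], so the window is hit at most as often as it has elements. The bound on
    [d] makes an odd case occur before [u] is used up. *)
Lemma count_window u : forall w (d a m : Z), (d <> 0 -> Z.abs d < 2 ^ Z.of_nat u -> 0 <= m -> (u <= w)%nat ->
  Z.of_nat (sumn (2 ^ w) (fun s => b2n ((Z.of_nat s * d + a * 2 ^ Z.of_nat u) mod 2 ^ Z.of_nat w <? m * 2 ^ Z.of_nat u)))
  <= m * 2 ^ Z.of_nat u)%Z.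
Proof.
  induction u as [|u IH]; intros w d a m Hd Hlt Hm Hu; [change (2 ^ Z.of_nat 0)%Z with 1%Z in Hlt; lia|].
  pose proof (Z.div_mod d 2 ltac:(lia)) as Ed. pose proof (Z.mod_pos_bound d 2 ltac:(lia)).
  assert (Hpw : (0 < 2 ^ Z.of_nat w)%Z) by (apply Z.pow_pos_nonneg; lia).
  destruct (Z.eq_dec (d mod 2) 0) as [Z0|Z1].
  - destruct w as [|w]; [lia|]. set (d1 := (d / 2)%Z) in *.
    rewrite !Nat2Z.inj_succ, !Z.pow_succ_r in * by lia.
    set (pu := (2 ^ Z.of_nat u)%Z) in *. set (W := (2 ^ Z.of_nat w)%Z) in *.
    specialize (IH w d1 a m ltac:(lia) ltac:(lia) Hm ltac:(lia)).
    replace (2 ^ S w)%nat with (2 ^ w + 2 ^ w)%nat by (rewrite Nat.pow_succ_r'; lia). rewrite sumn_app.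
    assert (HP : forall s, b2n ((Z.of_nat s * d + a * (2 * pu)) mod (2 * W) <? m * (2 * pu))%Z =
       b2n ((Z.of_nat s * d1 + a * pu) mod W <? m * pu)%Z).
    { intros s. f_equal.
      replace (Z.of_nat s * d + a * (2 * pu))%Z with (2 * (Z.of_nat s * d1 + a * pu))%Z by (rewrite Ed at 1; rewrite Z0; ring).
      rewrite Z.mul_mod_distr_l by lia.
      apply eq_true_iff_eq. rewrite !Z.ltb_lt. lia. }
    set (G := fun s => b2n ((Z.of_nat s * d1 + a * pu) mod W <? m * pu)%Z) in *.
    match goal with |- (Z.of_nat (?x + ?y) <= _)%Z =>
      assert (x = sumn (2 ^ w) G) as -> by (apply sumn_ext; intros; apply HP);
      assert (y = sumn (2 ^ w) G) as -> end.
    { apply sumn_ext. intros i _. rewrite HP. unfold G. do 2 f_equal.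
      rewrite Nat2Z.inj_add, Nat2Z.inj_pow. change (Z.of_nat 2 ^ Z.of_nat w)%Z with W.
      replace ((W + Z.of_nat i) * d1 + a * pu)%Z with (Z.of_nat i * d1 + a * pu + d1 * W)%Z by ring.
      apply Z_mod_plus_full. }
    fold W in IH. fold G in IH. lia.
  - set (W := (2 ^ Z.of_nat w)%Z) in *. set (pu := (2 ^ Z.of_nat (S u))%Z) in *.
    assert (Hpu : (0 <= pu)%Z) by (apply Z.pow_nonneg; lia).
    set (f := fun s => Z.to_nat ((Z.of_nat s * d + a * pu) mod W)).
    rewrite (sumn_ext _ _ (fun s => b2n (f s <? Z.to_nat (m * pu)))).
    2:{ intros s _. f_equal. apply eq_true_iff_eq. rewrite Z.ltb_lt, Nat.ltb_lt. unfold f.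
        pose proof (Z.mod_pos_bound (Z.of_nat s * d + a * pu) W Hpw). nia. }
    apply Z.le_trans with (Z.of_nat (Z.to_nat (m * pu))); [apply inj_le, count_inj|rewrite Z2Nat.id; nia].
    intros i j Hi Hj E. unfold f in E.
    pose proof (Z.mod_pos_bound (Z.of_nat i * d + a * pu) W Hpw).
    pose proof (Z.mod_pos_bound (Z.of_nat j * d + a * pu) W Hpw).
    assert (E2 : ((Z.of_nat i * d + a * pu) mod W = (Z.of_nat j * d + a * pu) mod W)%Z) by lia.
    assert (Hdiv : (W | d * (Z.of_nat i - Z.of_nat j))%Z).
    { apply Z.mod_divide; [lia|].
      replace (d * (Z.of_nat i - Z.of_nat j))%Z with ((Z.of_nat i * d + a * pu) - (Z.of_nat j * d + a * pu))%Z by ring.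
      rewrite Zminus_mod, E2, Z.sub_diag. apply Z.mod_0_l. lia. }
    apply Z.gauss in Hdiv.
    + assert (HW : W = Z.of_nat (2 ^ w)) by (rewrite Nat2Z.inj_pow; reflexivity).
      destruct Hdiv as [q Hq]. assert (q = 0)%Z by nia. lia.
    + apply Znumtheory.Zgcd_1_rel_prime, Znumtheory.rel_prime_sym, Zpow_facts.rel_prime_Zpower_r; [lia|].
      apply Znumtheory.bezout_rel_prime, Znumtheory.Bezout_intro with 1%Z (- (d / 2))%Z. lia.
Qed.

Lemma Un_Mn k n : 2 ^ wn k n = Un k n * Mn n.
Proof.
  unfold Un, Mn. rewrite <- Nat.pow_add_r. f_equal. pose proof (lpar_bounds n).
  rewrite wn_eq, Nat.mul_add_distr_r. lia.
Qed.

(* A false positive confines the product of the multiplier with x + y - c to a short window modulo 2^w. *)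
Lemma inb_window k n sh c e x y : e <= 1 -> inb k n sh c e x y = true ->
  ((Z.of_nat sh * (Z.of_nat x + Z.of_nat y - Z.of_nat c) + 2 * Z.of_nat (Un k n)) mod Z.of_nat (2 ^ wn k n)
   < 4 * Z.of_nat (Un k n))%Z.
Proof.
  intros He H. unfold inb, bidx in H. apply Nat.eqb_eq in H.
  assert (HU : 0 < Un k n) by apply pow2_gt0. pose proof (M_pos n) as HM.
  assert (HD : forall z, exists q r, sh * z = Un k n * (Mn n * q + hashn k n sh z) + r /\ r < Un k n).
  { intros z. exists (sh * z / 2 ^ wn k n), (((sh * z) mod 2 ^ wn k n) mod Un k n). split.
    - pose proof (Nat.div_mod_eq (sh * z) (2 ^ wn k n)) as E. rewrite E at 1.
      pose proof (Nat.div_mod_eq ((sh * z) mod 2 ^ wn k n) (Un k n)) as E'. unfold hashn.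
      rewrite Nat.mul_add_distr_l, Nat.mul_assoc, <- Un_Mn. lia.
    - apply Nat.mod_upper_bound. lia. }
  destruct (HD x) as (q1 & r1 & E1 & L1), (HD y) as (q2 & r2 & E2 & L2), (HD c) as (q3 & r3 & E3 & L3).
  pose proof (Nat.div_mod_eq (hashn k n sh x + hashn k n sh y) (Mn n)) as D1.
  pose proof (Nat.div_mod_eq (hashn k n sh c + Mn n - e) (Mn n)) as D2.
  rewrite H in D1. rewrite Un_Mn.
  set (q4 := (hashn k n sh x + hashn k n sh y) / Mn n) in *.
  set (q5 := (hashn k n sh c + Mn n - e) / Mn n) in *.
  set (r := (hashn k n sh c + Mn n - e) mod Mn n) in *.
  set (hx := hashn k n sh x) in *. set (hy := hashn k n sh y) in *. set (hc := hashn k n sh c) in *.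
  set (u := Un k n) in *. set (M := Mn n) in *. clearbody q4 q5 r hx hy hc u M. clear HD H.
  (* What remains of the product, shifted by [2 u], after removing multiples of [2 ^ w = u M]. Each
     rounding error is below [u] and [e <= 1], so [v] lies in [[0, 4 u)]; this fixes the shift and
     the width of the window. *)
  set (v := (2 * Z.of_nat u - Z.of_nat u * Z.of_nat e + Z.of_nat r1 + Z.of_nat r2 - Z.of_nat r3)%Z).
  assert (Hv : (0 <= v < 4 * Z.of_nat u)%Z) by (unfold v; assert (e = 0 \/ e = 1) as [-> | ->] by lia; lia).
  replace (Z.of_nat sh * (Z.of_nat x + Z.of_nat y - Z.of_nat c) + 2 * Z.of_nat u)%Z
    with (v + (Z.of_nat q1 + Z.of_nat q2 - Z.of_nat q3 + Z.of_nat q4 - Z.of_nat q5 + 1) * Z.of_nat (u * M))%Z.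
  - rewrite Z_mod_plus_full. eapply Z.le_lt_trans; [apply Z.mod_le; nia|lia].
  - apply (f_equal Z.of_nat) in E1, E2, E3, D1.
    assert (D2' : (Z.of_nat hc + Z.of_nat M - Z.of_nat e = Z.of_nat M * Z.of_nat q5 + Z.of_nat r)%Z) by nia.
    rewrite !Nat2Z.inj_add, !Nat2Z.inj_mul, ?Nat2Z.inj_add, ?Nat2Z.inj_mul in *. unfold v.
    set (X := Z.of_nat hx) in *.
    assert (DX : (X = Z.of_nat M * Z.of_nat q4 + Z.of_nat r - Z.of_nat hy)%Z) by lia.
    assert (DC : (Z.of_nat hc = Z.of_nat M * Z.of_nat q5 + Z.of_nat r - Z.of_nat M + Z.of_nat e)%Z) by lia.
    rewrite !Z.mul_sub_distr_l, !Z.mul_add_distr_l, E1, E2, E3, DX, DC. ring.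
Qed.

(** Each of the two buckets admits at most [4 U] multipliers out of [2 ^ w = U M], so on average a
    pair is counted at most [8 / M] times. *)
Lemma collision_bound k n c x y : 1 <= k -> x < n ^ k -> y < n ^ k -> c < n ^ k ->
  sumn (2 ^ wn k n) (fun sh => fpind k n sh c x y) <= 8 * Un k n.
Proof.
  intros Hk Hx Hy Hc. unfold fpind. destruct (Nat.eqb_spec (x + y) c) as [|Hne].
  - rewrite sumn_const. lia.
  - set (d := (Z.of_nat x + Z.of_nat y - Z.of_nat c)%Z).
    pose proof (nk_lt k n Hk) as Hnk. pose proof (lpar_bounds n) as Hl. pose proof (Ln_pos n) as HL.
    set (u := wn k n - lpar n).
    assert (Hu : Z.of_nat (Un k n) = (2 ^ Z.of_nat u)%Z) by (unfold Un; rewrite Nat2Z.inj_pow; reflexivity).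
    (* The difference has at most [k L + 1] bits, while [u = w - l] is at least [(k + 18) L]. *)
    assert (Hd : (Z.abs d < 2 ^ Z.of_nat u)%Z).
    { rewrite <- Hu. apply (Z.lt_le_trans _ (Z.of_nat (2 * 2 ^ (k * Ln n)))); [unfold d; lia|].
      apply inj_le. rewrite <- Nat.pow_succ_r'. unfold Un. apply pow2_le. rewrite wn_eq, Nat.mul_add_distr_r. lia. }
    pose proof (count_window u (wn k n) d 2 4 ltac:(unfold d; lia) Hd ltac:(lia) ltac:(unfold u; lia)) as HC.
    rewrite sumn_add.
    set (T := fun s => b2n ((Z.of_nat s * d + 2 * 2 ^ Z.of_nat u) mod 2 ^ Z.of_nat (wn k n) <? 4 * 2 ^ Z.of_nat u)%Z) in *.
    assert (HT : forall e, e <= 1 -> sumn (2 ^ wn k n) (fun sh => b2n (inb k n sh c e x y)) <= sumn (2 ^ wn k n) T).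
    { intros e He. apply sumn_le. intros sh _. destruct (inb k n sh c e x y) eqn:E; [|simpl; lia].
      apply inb_window in E; auto. fold d in E. rewrite Hu, Nat2Z.inj_pow in E. apply Z.ltb_lt in E.
      change (Z.of_nat 2) with 2%Z in E. unfold T. rewrite E. auto. }
    pose proof (HT 0 ltac:(lia)). pose proof (HT 1 ltac:(lia)). lia.
Qed.

(** * Random bits and running time *)

Lemma sumn_swap m N (f : nat -> nat -> nat) :
  sumn m (fun i => sumn N (fun j => f i j)) = sumn N (fun j => sumn m (fun i => f i j)).
Proof.
  induction m as [|m IH]; cbn [sumn]; [now rewrite sumn_const, Nat.mul_0_r|].
  now rewrite IH, <- sumn_add.
Qed.

Lemma length_filter_map {X Y} (f : X -> Y) p (A : list X) :
  length (filter p (map f A)) = length (filter (fun x => p (f x)) A).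
Proof. induction A as [|x A IH]; simpl; auto. destruct (p (f x)); simpl; auto. Qed.

Lemma length_allbits m : length (allbits m) = 2 ^ m.
Proof. induction m; [reflexivity|]. cbn [allbits]. rewrite length_app, !length_map, IHm. simpl. lia. Qed.

Lemma allbits_length m r : In r (allbits m) -> length r = m.
Proof.
  revert r. induction m as [|m IH]; intros r; cbn [allbits]; [intros [<-|[]]; reflexivity|].
  intros H. apply in_app_or in H as [H|H]; apply in_map_iff in H as (r' & <- & H); simpl; auto.
Qed.

Lemma filter_ext_in_le {X} (p q : X -> bool) (A : list X) :
  (forall x, In x A -> p x = true -> q x = true) -> length (filter p A) <= length (filter q A).
Proof.
  induction A as [|x A IH]; intros H; [auto|]. cbn [filter].
  specialize (IH ltac:(intros; apply H; auto using in_cons)).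
  pose proof (H x ltac:(auto using in_eq)) as Hx.
  destruct (p x); [rewrite Hx by auto; simpl; lia|destruct (q x); simpl; lia].
Qed.

(** [acc] is the value of the bits already read, most significant first, so the next bit selects one
    half of the remaining range of multipliers. *)
Lemma count_bits w m : forall (p : nat -> bool) acc,
  length (filter (fun r => p (bval acc (firstn w r))) (allbits (w + m))) =
  2 ^ m * sumn (2 ^ w) (fun s => b2n (p (acc * 2 ^ w + s))).
Proof.
  induction w as [|w IH]; intros p acc.
  - cbn [firstn bval fold_left Nat.add Nat.pow sumn]. rewrite Nat.mul_1_r, Nat.add_0_r.
    rewrite <- (length_allbits m). destruct (p acc); simpl b2n.
    + rewrite Nat.mul_1_r. induction (allbits m); simpl; auto.
    + rewrite Nat.mul_0_r. induction (allbits m); simpl; auto.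
  - cbn [Nat.add allbits]. rewrite filter_app, length_app, !length_filter_map. cbn [firstn].
    unfold bval. cbn [fold_left]. fold (bval (2 * acc + b2n false)). fold (bval (2 * acc + b2n true)).
    pose proof (IH p (2 * acc + b2n false)) as I0. pose proof (IH p (2 * acc + b2n true)) as I1.
    unfold bval in *. rewrite I0, I1. clear I0 I1 IH.
    replace (2 ^ S w) with (2 ^ w + 2 ^ w) by (rewrite Nat.pow_succ_r'; lia).
    rewrite sumn_app, Nat.mul_add_distr_l. f_equal; f_equal; apply sumn_ext; intros s _; do 2 f_equal;
      cbn [b2n]; lia.
Qed.

Lemma prob_bits w m (p : list bool -> bool) (q : nat -> bool) :
  (forall r, length r = w + m -> p r = true -> q (bval 0 (firstn w r)) = true) ->
  (prob (w + m) p * 2 ^ w <= INR (sumn (2 ^ w) (fun s => b2n (q s))))%R.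
Proof.
  intros H. unfold prob.
  assert (HC : length (filter p (allbits (w + m))) <= 2 ^ m * sumn (2 ^ w) (fun s => b2n (q s))).
  { pose proof (count_bits w m q 0) as E. cbn [Nat.mul Nat.add] in E. rewrite <- E. apply filter_ext_in_le.
    intros r Hr. apply H. now apply allbits_length in Hr. }
  apply le_INR in HC. rewrite mult_INR, pow_INR in HC. change (INR 2) with 2%R in HC.
  rewrite pow_add. assert (0 < 2 ^ m)%R by (apply pow_lt; lra). assert (0 < 2 ^ w)%R by (apply pow_lt; lra).
  apply Rmult_le_reg_l with (2 ^ m)%R; [auto|].
  replace (2 ^ m * (INR (length (filter p (allbits (w + m)))) / (2 ^ w * 2 ^ m) * 2 ^ w))%R
    with (INR (length (filter p (allbits (w + m))))) by (field; lra).
  exact HC.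
Qed.

Lemma sumn_tail q N : sumn N (fun t => b2n (t <=? q)) <= q + 1.
Proof.
  rewrite <- (sumn_ext N (fun t => b2n (t <? q + 1))); [apply (count_inj N (q + 1) (fun t => t)); auto|].
  intros t _. f_equal. apply eq_true_iff_eq. rewrite Nat.ltb_lt, Nat.leb_le. lia.
Qed.

(** Exchange of summation in the tail formula for the expectation: for a fixed multiplier [s] at
    most [T s + 1] values of [t] can be slow, whatever the number [N] of terms. *)
Lemma exp_partial_le w D n tp A B A' B' C' (T : nat -> nat) N : w <= tp ->
  (forall t r, length r = tp + t -> query_slow D n tp t A B A' B' C' r = true -> t <= T (bval 0 (firstn w r))) ->
  (exp_partial D n tp A B A' B' C' N * 2 ^ w <= INR (sumn (2 ^ w) (fun s => (T s + 1)%nat)))%R.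
Proof.
  intros Hw HT.
  apply Rle_trans with (INR (sumn N (fun t => sumn (2 ^ w) (fun s => b2n (Nat.leb t (T s)))))).
  - induction N as [|N IH]; cbn [exp_partial sumn]; [simpl; lra|].
    rewrite plus_INR, Rmult_plus_distr_r. apply Rplus_le_compat; [exact IH|].
    replace (tp + N) with (w + (tp - w + N)) by lia. apply (prob_bits w _ _ (fun s => N <=? T s)).
    intros r Hr Hs. apply Nat.leb_le. apply (HT N r); auto. lia.
  - apply le_INR. rewrite sumn_swap. apply sumn_le. intros s _. apply sumn_tail.
Qed.

(** * Runs of the two programs *)

Section Runs.
Variables (k n : nat).
Hypothesis Hk : 1 <= k.

Definition dsk : ds_algorithm := DS (k + 20) (ccode (p_prep k) 0) (ccode p_query 0).
Local Notation w := (wn k n).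
Local Notation tp := ((k + 20) * 4900 * (n * n) + (k + 20) * 4900).

(** A random string as long as the preprocessing time therefore contains a complete multiplier. *)
Lemma w_le_tp : w <= tp.
Proof.
  rewrite wn_eq. assert (Ln n <= n + 1).
  { unfold Ln. pose proof (Nat.log2_le_lin n ltac:(lia)). lia. }
  assert (n <= n * n) by (destruct n; simpl; lia).
  transitivity ((k + 20) * (4900 * (n * n) + 4900)); [apply Nat.mul_le_mono_l; lia|lia].
Qed.

Lemma w_big : 80 < 2 ^ w.
Proof. pose proof (big_word k n Hk). pose proof (pow2_gt0 (12 * Ln n)). lia. Qed.

(* The query only reads scalars, arrays and the remaining random bits of the preprocessed state. *)
Definition ready (sh : nat) (A B : list nat) (c1 : cfg) : Prop :=
  exists s, prepped k n sh A B s /\ rel w s (mem c1).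

Lemma prep_run A B r : int_set n k A -> int_set n k B -> w <= length r ->
  exists c1, run_prep dsk n tp A B r = Some c1 /\ ready (bval 0 (firstn w r)) A B c1.
Proof.
  intros (NA & LA & HA) (NB & LB & HB) Hr.
  set (s0 := St (fun _ => 0) (fun _ _ => 0) [] r 0).
  destruct (prep_spec k n Hk (prep_input n A B) s0 A B) as (s' & Hbs & HP & Hrn & Hck); auto.
  { intros x [Hx|Hx]; auto. }
  destruct (compile_correct w _ _ _ _ zero_mem w_big (eq_refl : wfc (p_prep k) = true) Hbs) as (m' & HR & HX).
  { split; [|split]; intros; simpl; auto. apply pow2_gt0. }
  eexists. split.
  - unfold run_prep. cbn [dsk ds_wconst ds_prep]. change (word_size (k + 20) n) with w.
    cbn [s0 ou rn ck] in HX, Hck.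
    replace tp with (S (ck s' - 0) + (tp - S (ck s' - 0))) by lia.
    apply exec_mono. exact HX.
  - exists s'. split; [exact HP|exact HR].
Qed.

(** Only the last term depends on the multiplier; it is the only one that has to be averaged. *)
Definition qtime (A B C' : list nat) (sh : nat) : nat :=
  2 * 4000 * (2 * Mn n * ((lpar n + 1) * (lpar n + 1))) + 400 * Mn n + n * (200 * Ln n + 3000) + 1000 +
  100 * list_sum (map (fpsum k n sh A B) C').

Lemma query_run sh A B A' B' C' c1 : int_set n k A -> int_set n k B ->
  sub_set A' A -> sub_set B' B -> int_set n k C' -> ready sh A B c1 ->
  exists c2, run_query dsk n (S (qtime A B C' sh)) A' B' C' c1 = Some c2 /\ out c2 = answer A' B' C'.
Proof.
  intros (NA & LA & HA) (NB & LB & HB) HA' HB' HC (s & HP & HR).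
  set (s0 := St (va s) (ar s) [] (rnd c1) 0).
  destruct (query_spec k n Hk (query_input n A' B' C') s0 sh A B A' B' C') as (s' & Hbs & Ho & Hck); auto.
  { intros x [Hx|Hx]; auto. }
  destruct (compile_correct w _ _ _ _ (mem c1) w_big (eq_refl : wfc p_query = true) Hbs HR) as (m' & HR' & HX).
  eexists. split.
  2: instantiate (1 := Cfg _ _ _ _); exact Ho.
  unfold run_query. cbn [dsk ds_wconst ds_query]. change (word_size (k + 20) n) with w.
  cbn [s0 ou rn ck] in HX, Hck.
  assert (HT : ck s' <= qtime A B C' sh) by (unfold qtime; lia). clear Hck.
  replace (S (qtime A B C' sh)) with (S (ck s' - 0) + (qtime A B C' sh - ck s')) by lia.
  apply exec_mono. exact HX.
Qed.

(* Padding the random string does not change a halting run, and a padded run is long enough for [prep_run]. *)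
Lemma las_vegas A B A' B' C' r t1 t2 c1 c2 : int_set n k A -> int_set n k B ->
  sub_set A' A -> sub_set B' B -> int_set n k C' ->
  run_prep dsk n t1 A B r = Some c1 -> run_query dsk n t2 A' B' C' c1 = Some c2 ->
  out c2 = answer A' B' C'.
Proof.
  intros HA HB HA' HB' HC H1 H2. set (x := repeat false w).
  destruct (prep_run A B (r ++ x)) as (d1 & R1 & HR); auto.
  { unfold x. rewrite length_app, repeat_length. lia. }
  apply (exec_more_rnd _ _ _ x) in H1.
  assert (d1 = more_rnd x c1) as -> by exact (exec_det _ _ _ _ _ _ _ _ R1 H1).
  destruct (query_run _ A B A' B' C' (more_rnd x c1) HA HB HA' HB' HC HR) as (d2 & R2 & Ho).
  apply (exec_more_rnd _ _ _ x) in H2.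
  assert (d2 = more_rnd x c2) as -> by exact (exec_det _ _ _ _ _ _ _ _ R2 H2).
  exact Ho.
Qed.

Lemma slow_time A B A' B' C' t r : int_set n k A -> int_set n k B ->
  sub_set A' A -> sub_set B' B -> int_set n k C' -> w <= length r ->
  query_slow dsk n tp t A B A' B' C' r = true -> t <= qtime A B C' (bval 0 (firstn w r)).
Proof.
  intros HA HB HA' HB' HC Hr. unfold query_slow.
  destruct (prep_run A B r HA HB Hr) as (c1 & -> & HR).
  destruct (query_run _ A B A' B' C' c1 HA HB HA' HB' HC HR) as (c2 & HQ & _).
  destruct (Nat.le_gt_cases t (qtime A B C' (bval 0 (firstn w r)))) as [|Hlt]; [auto|].
  unfold run_query in *.
  replace t with (S (qtime A B C' (bval 0 (firstn w r))) + (t - S (qtime A B C' (bval 0 (firstn w r))))) by lia.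
  rewrite (exec_mono _ _ _ _ _ _ _ HQ). discriminate.
Qed.

Lemma sumn_list_sum N (A : list nat) m (f : nat -> nat -> nat) b : length A = m ->
  (forall x, In x A -> sumn N (f x) <= b) -> sumn N (fun s => list_sum (map (fun x => f x s) A)) <= m * b.
Proof.
  intros <-.
  induction A as [|x A IH]; intros H; cbn [map list_sum fold_right length]; [rewrite sumn_const; lia|].
  rewrite sumn_add. pose proof (H x (in_eq _ _)). specialize (IH (fun y Hy => H y (in_cons _ _ _ Hy))).
  unfold list_sum in IH. lia.
Qed.

(** The constant 1001 includes the 1 of the tail sum [T s + 1]. *)
Definition qbase : nat :=
  2 * 4000 * (2 * Mn n * ((lpar n + 1) * (lpar n + 1))) + 400 * Mn n + n * (200 * Ln n + 3000) + 1001.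

(** [800 = 100 * 8]: time 100 for each false positive, and [8 U] from [collision_bound] for each of
    the [n^3] triples from [C'], [A] and [B]. *)
Lemma qtime_sum A B C' : int_set n k A -> int_set n k B -> int_set n k C' ->
  sumn (2 ^ w) (fun s => qtime A B C' s + 1) <= 2 ^ w * qbase + 800 * (n * n * n) * Un k n.
Proof.
  intros (NA & LA & HA) (NB & LB & HB) (NC & LC & HC).
  rewrite (sumn_ext _ _ (fun s => qbase + 100 * list_sum (map (fpsum k n s A B) C'))).
  2:{ intros s _. unfold qtime, qbase. lia. }
  rewrite sumn_add, sumn_const, sumn_mull.
  assert (HS : sumn (2 ^ w) (fun s => list_sum (map (fpsum k n s A B) C')) <= n * (n * (n * (8 * Un k n)))).
  { apply (sumn_list_sum _ C' n (fun c s => fpsum k n s A B c)); auto. intros c Hc.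
    apply (sumn_list_sum _ A n (fun x s => list_sum (map (fpind k n s c x) B))); auto. intros x Hx.
    apply (sumn_list_sum _ B n (fun y s => fpind k n s c x y)); auto. intros y Hy.
    apply collision_bound; auto. }
  lia.
Qed.

End Runs.

(** * Estimates over the reals *)

Lemma Ln_le_ln n : 2 <= n -> (INR (Ln n) <= 4 * ln (INR n))%R.
Proof.
  intros Hn. unfold Ln. rewrite plus_INR. set (j := Nat.log2 n).
  assert (Hj : 1 <= j) by (apply Nat.log2_le_pow2; simpl; lia).
  assert (Hp : 2 ^ j <= n) by (apply Nat.log2_spec; lia).
  apply le_INR in Hp, Hj. rewrite pow_INR in Hp. change (INR 2) with 2%R in Hp. change (INR 1) with 1%R in *.
  assert (H2 : (0 < 2 ^ j)%R) by (apply pow_lt; lra).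
  assert (Hln : (ln (2 ^ j) <= ln (INR n))%R).
  { destruct Hp as [Hp|Hp]; [left; now apply ln_increasing|rewrite Hp; right; reflexivity]. }
  rewrite ln_pow in Hln by lra.
  (* The factor 4 comes from [j + 1 <= 2 j] and [ln 2 > 1 / 2]. *)
  pose proof ln_lt_2. nra.
Qed.

Ltac inr_lit c v := replace (INR c) with (IZR v) in * by (rewrite INR_IZR_INZ; reflexivity).

(** Squares are compared. With [T = 2^L], the square of [M L] lies between [T^3] and [4 T^3], and
    [n <= T <= 2 n]; hence it lies between [n^3 = S^2] and [32 n^3], and 6 is the root of 32 rounded
    up. *)
Lemma table_bounds n : 1 <= n ->
  let S := (INR n * sqrt (INR n))%R in
  (1 <= INR n <= S /\ S <= INR (Mn n) * INR (Ln n) <= 6 * S /\ S * S = INR n * INR n * INR n)%R.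
Proof.
  intros Hn S.
  pose proof (lpar_lower n) as Hl. pose proof (lpar_upper n) as Hu.
  pose proof (n_lt_TL n) as HT1. pose proof (TL_le n Hn) as HT2.
  apply le_INR in Hl, Hu, HT2, Hn. apply Nat.lt_le_incl, le_INR in HT1. rewrite !mult_INR in *.
  inr_lit 1 1%Z. inr_lit 2 2%Z. inr_lit 4 4%Z.
  set (x := INR n) in *. set (t := INR (TLn n)) in *. set (p := (INR (Mn n) * INR (Ln n))%R) in *.
  assert (Hp : (0 <= p)%R) by (apply Rmult_le_pos; apply pos_INR).
  assert (HS : (S * S = x * x * x)%R).
  { unfold S. pose proof (sqrt_sqrt x ltac:(lra)). nra. }
  assert (Hs1 : (1 <= sqrt x)%R) by (rewrite <- sqrt_1; apply sqrt_le_1; lra).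
  assert (HxS : (x <= S)%R) by (unfold S; nra).
  assert (Ht3 : (x * x * x <= t * t * t <= 8 * (x * x * x))%R).
  { assert (x * x <= t * t <= 4 * (x * x))%R by nra. nra. }
  repeat split; try lra; clearbody S; nra.
Qed.

(** Covers [4 * (869600 + 800)] as well as the additive constants, which alone matter for [n = 0]
    and [n = 1], where the main term vanishes. *)
Definition qconst : nat := 4 * 1000 * 1000.

Lemma qconst_INR : INR qconst = 4000000%R.
Proof. unfold qconst. rewrite !mult_INR. inr_lit 4 4%Z. inr_lit 1000 1000%Z. lra. Qed.

(** The factor 18 is [2 * 9], from [l + 1 <= 3 L]. *)
Lemma qbase_le n : 1 <= n ->
  qbase n <= 2 * 4000 * (18 * (Mn n * Ln n * Ln n)) + 400 * (Mn n * Ln n) + 3200 * (n * Ln n) + 1001.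
Proof.
  intros Hn. unfold qbase. pose proof (lpar_bounds n) as Hl. pose proof (Ln_pos n) as HL.
  set (L := Ln n) in *. set (l := lpar n) in *. set (M := Mn n). clearbody L l M.
  assert (H1 : (l + 1) * (l + 1) <= (3 * L) * (3 * L)) by (apply Nat.mul_le_mono; lia).
  assert (H2 : 2 * M * ((l + 1) * (l + 1)) <= 18 * (M * L * L)).
  { etransitivity; [apply Nat.mul_le_mono_l, H1|]. lia. }
  assert (H3 : M <= M * L) by (destruct L; lia). assert (H4 : n <= n * L) by (destruct L; lia). lia.
Qed.

Lemma expected_bound k n E : 1 <= k ->
  (E * 2 ^ wn k n <= INR (2 ^ wn k n * qbase n + 800 * (n * n * n) * Un k n))%R ->
  (E <= INR qconst * (INR n * sqrt (INR n) * ln (INR n) + 1))%R.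
Proof.
  intros Hk HE. rewrite qconst_INR.
  assert (HU : (0 < INR (Un k n))%R) by (apply lt_0_INR, pow2_gt0).
  assert (HM : (2 <= INR (Mn n))%R).
  { pose proof (M_pos n) as H. apply le_INR in H. inr_lit 2 2%Z. exact H. }
  assert (HW : (2 ^ wn k n = INR (Un k n) * INR (Mn n))%R).
  { rewrite <- mult_INR, <- Un_Mn, pow_INR. reflexivity. }
  rewrite plus_INR, !mult_INR, pow_INR in HE. change (INR 2) with 2%R in HE. rewrite HW in HE.
  inr_lit 800 800%Z.
  set (m := INR (Mn n)) in *. set (u := INR (Un k n)) in *. set (x := INR n) in *. set (b := INR (qbase n)) in *.
  assert (HE' : (E * m <= m * b + 800 * (x * x * x))%R).
  { apply Rmult_le_reg_l with u; [auto|]. nra. }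
  clear HE HW HU. clearbody u.
  destruct (Nat.eq_dec n 0) as [->|Hn0].
  - change x with 0%R in *.
    assert (b <= 4000000)%R.
    { rewrite <- qconst_INR. apply le_INR. unfold qbase, qconst.
      change (Mn 0) with 4. change (lpar 0) with 2. lia. }
    nra.
  - destruct (table_bounds n ltac:(lia)) as ((Hx1 & HxS) & (HS1 & HS6) & HSS). fold x in Hx1, HxS, HS1, HS6, HSS.
    fold m in HS1, HS6. set (S := (x * sqrt x)%R) in *. set (L := INR (Ln n)) in *.
    assert (HL1 : (1 <= L)%R).
    { pose proof (Ln_pos n) as H. apply le_INR in H. inr_lit 1 1%Z. exact H. }
    (* [869600 = 2 * 4000 * 18 * 6 + 400 * 6 + 3200], the 6 being that of [table_bounds]. *)
    assert (Hb : (b <= 869600 * (S * L) + 1001)%R).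
    { pose proof (qbase_le n ltac:(lia)) as H. apply le_INR in H. rewrite !plus_INR, !mult_INR in H.
      inr_lit 2 2%Z. inr_lit 4000 4000%Z. inr_lit 18 18%Z. inr_lit 400 400%Z. inr_lit 3200 3200%Z. inr_lit 1001 1001%Z.
      fold b x m L in H.
      assert (m * L * L <= 6 * (S * L))%R by nra. assert (m * L <= 6 * (S * L))%R by nra.
      assert (x * L <= S * L)%R by nra. lra. }
    (* The walks cost [800 n^3 / M], and [n^3 = S^2 <= M L S]: here the choice of [M] balances the
       walks against the convolution. *)
    assert (HEL : (E <= b + 800 * (S * L))%R).
    { apply Rmult_le_reg_l with m; [lra|]. rewrite <- HSS in HE'.
      assert (S * S <= m * L * S)%R by (apply Rmult_le_compat_r; lra). lra. }
    destruct (Nat.eq_dec n 1) as [->|Hn1].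
    + change x with 1%R in *. change L with 1%R in *. unfold S in *. rewrite sqrt_1, ln_1 in *. lra.
    + pose proof (Ln_le_ln n ltac:(lia)) as Hln. fold L x in Hln.
      assert (S * L <= S * (4 * ln x))%R by (apply Rmult_le_compat_l; lra). assert (0 <= S * L)%R by (apply Rmult_le_pos; lra). lra.
Qed.

Theorem theorem2 :
  forall k : nat, 1 <= k ->
  exists (D : ds_algorithm) (Cp Cq : nat),
    1 <= ds_wconst D /\
    forall (n : nat) (A B : list nat),
      int_set n k A -> int_set n k B ->
      let tp := Cp * (n * n) + Cp in
      (* preprocessing: always halts within O(n^2) steps *)
      (forall r : list bool, tp <= length r ->
         exists c1, run_prep D n tp A B r = Some c1) /\
      forall A' B' C' : list nat,
        sub_set A' A -> sub_set B' B -> int_set n k C' ->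
        (* Las Vegas: any halting run outputs the correct answers *)
        (forall (r : list bool) (t1 t2 : nat) (c1 c2 : cfg),
           run_prep D n t1 A B r = Some c1 ->
           run_query D n t2 A' B' C' c1 = Some c2 ->
           out c2 = answer A' B' C') /\
        (* expected query time O(n^1.5 log n) *)
        (forall N : nat,
           (exp_partial D n tp A B A' B' C' N
            <= INR Cq * (INR n * sqrt (INR n) * ln (INR n) + 1))%R).
Proof.
  intros k Hk. exists (dsk k), ((k + 20) * 4900), qconst. split; [cbn [dsk ds_wconst]; lia|].
  intros n A B HA HB tp. pose proof (w_le_tp k n Hk) as Hw. fold tp in Hw. split.
  - intros r Hr. destruct (prep_run k n Hk A B r HA HB ltac:(lia)) as (c1 & H1 & _). eauto.
  - intros A' B' C' HA' HB' HC. split.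
    + intros r t1 t2 c1 c2. now apply (las_vegas k n Hk A B).
    + intros N. apply (expected_bound k n); [auto|].
      eapply Rle_trans.
      * apply (exp_partial_le (wn k n) _ _ _ _ _ _ _ _ (qtime k n A B C')); [exact Hw|].
        intros t r Hr. apply (slow_time k n Hk); auto. lia.
      * apply le_INR, qtime_sum; auto.
Qed.
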